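(* Let $0\le\alpha<1$ and let $f\in Q_B^{\alpha}(D^n)$, i.e. $f:D^n\to\mathbb{C}^n$ is a normalized quasi-convex mapping of type B and order $\alpha$ on the unit polydisk. Then for all $z\in D^n$: $$\frac{\|D^3f(0)(z^3)\|}{3!}\le\frac{(1-\alpha)(3-2\alpha)}{3}\|z\|^3\quad\text{if } n=2,$$ $$\frac{\|D^3f(0)(z^3)\|}{3!}\le\frac{(1-\alpha)\left(\frac32\sqrt3+1-\frac32\sqrt3\,\alpha\right)}{3}\|z\|^3\quad\text{if } n\ge3 .$$ For $n=2$ the estimate is sharp: for each $\alpha$ the constant $\frac{(1-\alpha)(3-2\alpha)}{3}$ cannot be replaced by a smaller one valid for all $f\in Q_B^\alpha(D^2)$ and all $z\in D^2$.
   Context: $\mathbb{C}^n$ carries the norm $\|z\|=\max_{1\le k\le n}|z_k|$, and $D^n=\{z\in\mathbb{C}^n:\|z\|<1\}$ is its open unit ball. For $x\ne0$, $T(x)=\{T_x\in(\mathbb{C}^n)^*:\|T_x\|=1,\ T_x(x)=\|x\|\}$. For holomorphic $f:D^n\to\mathbb{C}^n$, $D^mf(x)$ is the $m$-th Fréchet derivative at $x$ (a symmetric $m$-linear map) and $D^mf(x)(y^m)=D^mf(x)(y,\dots,y)$. $f$ is normalized if $f(0)=0$, $Df(0)=I$, and locally biholomorphic if $Df(x)$ is invertible for each $x\in D^n$. $Q_B^\alpha(D^n)$ (quasi-convex mappings of type B and order $\alpha$) is the family of normalized locally biholomorphic mappings $f:D^n\to\mathbb{C}^n$ such that $\mathrm{Re}\{T_x[(Df(x))^{-1}(D^2f(x)(x^2)+Df(x)x)]\}\ge\alpha\|x\|$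 for all $x\in D^n\setminus\{0\}$ and all $T_x\in T(x)$. *)

(* Defs.v *)
From HB Require Import structures.
From mathcomp Require Import all_boot all_order all_algebra.
From mathcomp Require Import complex.
From mathcomp Require Import boolp classical_sets reals topology normedtype.
From mathcomp Require Import derive.

Set Implicit Arguments.
Unset Strict Implicit.
Unset Printing Implicit Defensive.
Import Order.TTheory GRing.Theory Num.Theory.
Import numFieldNormedType.Exports.

Local Open Scope classical_set_scope.
Local Open Scope ring_scope.

(* The library topologizes R^o for every numFieldType R but gives no topology
   to the concrete type R[i]; these instances transport it. *)
HB.instance Definition _ (R : rcfType) := PseudoPointedMetric.copy R[i] R[i]^o.
HB.instance Definition _ (R : rcfType) := NormedModule.copy R[i] R[i]^o.

(* C^n is 'rV[R[i]]_n, whose library norm is mx_norm, the maximum of the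
   moduli of the coordinates. That norm takes its values in R[i]; they are
   nonnegative reals, and rnorm reads them in R. *)
Definition rnorm (R : realType) (V : normedModType R[i]) (x : V) : R :=
  complex.Re `|x|.

Definition polydisk (R : realType) (n : nat) : set 'rV[R[i]]_n :=
  [set x | rnorm x < 1].
Arguments polydisk {R n}.

(* Linear functionals on C^n are automatically continuous, so {scalar _} is
   the whole dual space. *)
Definition dual_norm (R : realType) (n : nat) (T : {scalar 'rV[R[i]]_n}) : R :=
  sup [set complex.Re `|T y| | y in [set y : 'rV[R[i]]_n | rnorm y <= 1]].

Definition support_functional (R : realType) (n : nat) (x : 'rV[R[i]]_n)
    (T : {scalar 'rV[R[i]]_n}) : Prop :=
  dual_norm T = 1 /\ T x = `|x|.

(* A normed module over R[i] has an R[i]-linear differential 'd, so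
   differentiability on an open set is holomorphy. Maps are total functions,
   but only their values on the polydisk matter here. *)
Definition holomorphic_on_polydisk (R : realType) (n : nat)
    (f : 'rV[R[i]]_n -> 'rV[R[i]]_n) : Prop :=
  forall x : 'rV[R[i]]_n, polydisk x -> differentiable f x.

(* iter_diff f [:: y1; ...; ym] x is D^m f(x)(y1, ..., ym), by
   D^m f(x)(y1, y2, ..., ym) = D(x' |-> D^(m-1) f(x')(y2, ..., ym))(x)(y1). *)
Fixpoint iter_diff (R : realType) (V W : normedModType R[i]) (f : V -> W)
    (ys : seq V) : V -> W :=
  if ys is y :: ys' then fun x => 'd (iter_diff f ys') x y else f.

(* D^m f(x)(y^m) *)
Definition diffn (R : realType) (V W : normedModType R[i]) (m : nat)
    (f : V -> W) (x y : V) : W :=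
  iter_diff f (nseq m y) x.

(* Vectors are rows: 'd f x v = v *m 'J f x, hence (Df(x))^-1 w is
   w *m invmx ('J f x). *)
Definition normalized (R : realType) (n : nat)
    (f : 'rV[R[i]]_n -> 'rV[R[i]]_n) : Prop :=
  f 0 = 0 /\ 'J f 0 = 1%:M.

Definition locally_biholomorphic (R : realType) (n : nat)
    (f : 'rV[R[i]]_n -> 'rV[R[i]]_n) : Prop :=
  forall x : 'rV[R[i]]_n, polydisk x -> 'J f x \in unitmx.

(* Q_B^alpha(D^n) *)
Definition quasi_convex_B (R : realType) (n : nat) (alpha : R)
    (f : 'rV[R[i]]_n -> 'rV[R[i]]_n) : Prop :=
  [/\ holomorphic_on_polydisk f, normalized f, locally_biholomorphic f &
    forall (x : 'rV[R[i]]_n) (T : {scalar 'rV[R[i]]_n}),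
      polydisk x -> x != 0 -> support_functional x T ->
      alpha * rnorm x <=
        complex.Re (T ((diffn 2 f x x + diffn 1 f x x) *m invmx ('J f x)))].

(* Main.v *)
(* Put [v(t) = Df(tz)^-1 (t D^2f(tz)(z^2) + Df(tz) z)]. Where [|z_k| = |z| = 1],
   the function [conj(z_k) v_k] has real part [>= alpha] and value 1 at 0, so
   Caratheodory's inequality bounds its first two Taylor coefficients. Comparing
   coefficients in [v J = t D^2f(z^2) + Df z] expresses them by [D^2f(0)(z^2)]
   and [D^3f(0)(z^3) - D^2f(0)(z, D^2f(0)(z^2))]; the maximum principle in [z_k]
   removes the restriction on [z_k], and the mixed term is controlled by the
   polarization constant of quadratic forms on C^n with the maximum norm, which
   is 1 for n = 2 and at most [3 sqrt 3 / 4] in general. Equality for n = 2 is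
   attained by [(F(z_1), F(z_2))] with [F' = (1 - z)^(-2 (1 - alpha))].

   That complex differentiable maps are smooth is obtained from Goursat's
   theorem on rectangles, pulled back by [exp]: the mean value over circles of
   a function holomorphic in a punctured disc and continuous at its center is
   the value at the center. *)

From HB Require Import structures.
Require Import Defs.
From mathcomp Require Import all_boot all_order all_algebra.
From mathcomp Require Import complex.
From mathcomp Require Import boolp classical_sets functions reals interval_inference topology normedtype.
From mathcomp Require Import sequences landau derive measure lebesgue_measure lebesgue_integral ftc realfun trigo exp.
From mathcomp Require Import ring lra.
Set Implicit Arguments. Unset Strict Implicit. Unset Printing Implicit Defensive.
Import Order.TTheory GRing.Theory Num.Theory.
Import numFieldNormedType.Exports.
Local Open Scope ring_scope.
Local Notation Re := complex.Re.
Local Notation Im := complex.Im.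

(** * Real-valued norms and epsilon-delta differentials *)

(** The hypothesis on [f] says something about the [k]-th coordinate only at points where that
    coordinate has maximal modulus: there [conj(x_k) / |x|] times the [k]-th coordinate is a support
    functional. The quantities to be bounded are polynomials in [z], so the [k]-th coordinate can be
    made a unimodular variable; it is then automatically maximal, and the maximum principle carries
    the bound to the whole ball. The obstacle is the mixed term. [D^2f(0)(z^2)] need not be parallel
    to [z], so a bound on a quadratic form has to be turned into one on its bilinear form, and only
    here does the dimension enter. With [m = 2 (1 - alpha)] and polarization constant [kappa] the
    result is [m + kappa m^2]; division by 3! gives [(1 - alpha) (1 + 2 kappa (1 - alpha)) / 3], the
    first constant of the theorem for [kappa = 1] and the second for [kappa = 3 sqrt 3 / 4]. The
    extremal map has [F'''(0) = m + m^2], which is why sharpness goes with [kappa = 1]. *)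

Section RealNorm.
Variable R : realType.
Local Notation C := R[i].
Implicit Type V : normedModType C.

Lemma rnormE V (x : V) : `|x| = (rnorm x)%:C%C.
Proof. by rewrite /rnorm RRe_real // ger0_real. Qed.

Lemma rnorm_ge0 V (x : V) : 0 <= rnorm x.
Proof. by rewrite -ler0c -rnormE normr_ge0. Qed.

Lemma rnorm0 V : rnorm (0 : V) = 0.
Proof. by rewrite /rnorm normr0. Qed.

Lemma rnorm_eq0 V (x : V) : (rnorm x == 0) = (x == 0).
Proof. by rewrite -(inj_eq (@complexI R)) -rnormE normr_eq0. Qed.

Lemma rnorm_gt0 V (x : V) : (0 < rnorm x) = (x != 0).
Proof. by rewrite lt_def rnorm_ge0 andbT rnorm_eq0. Qed.

Lemma rnormN V (x : V) : rnorm (- x) = rnorm x.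
Proof. by rewrite /rnorm normrN. Qed.

Lemma rnormD V (x y : V) : rnorm (x + y) <= rnorm x + rnorm y.
Proof. by rewrite -lecR rmorphD /= -!rnormE ler_normD. Qed.

Lemma rnormB V (x y : V) : rnorm (x - y) <= rnorm x + rnorm y.
Proof. by rewrite -(rnormN y) rnormD. Qed.

Lemma rnormZ V (c : C) (x : V) : rnorm (c *: x) = rnorm c * rnorm x.
Proof. by apply: (@complexI R); rewrite rmorphM /= -!rnormE normrZ. Qed.

Lemma rnormM (x y : C) : rnorm (x * y) = rnorm x * rnorm y.
Proof. by apply: (@complexI R); rewrite rmorphM /= -!rnormE normrM. Qed.

Lemma rnorm1 : rnorm (1 : C) = 1.
Proof. by rewrite /rnorm normr1. Qed.

Lemma rnormV (x : C) : rnorm x^-1 = (rnorm x)^-1.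
Proof. by apply: (@complexI R); rewrite fmorphV /= -!rnormE normfV. Qed.

Lemma rnormX (x : C) n : rnorm (x ^+ n) = rnorm x ^+ n.
Proof. by elim: n => [|n IH]; rewrite ?expr0 ?rnorm1 // !exprS rnormM IH. Qed.

Lemma rnormR (a : R) : rnorm a%:C%C = `|a|.
Proof. by rewrite /rnorm normc_def /= expr0n /= addr0 sqrtr_sqr. Qed.

Lemma rnormRp (a : R) : 0 <= a -> rnorm a%:C%C = a.
Proof. by move=> a0; rewrite rnormR ger0_norm. Qed.

Lemma rnorm_sqr (z : C) : rnorm z ^+ 2 = Re z ^+ 2 + Im z ^+ 2.
Proof. by rewrite /rnorm normc_def /= sqr_sqrtr // addr_ge0 // sqr_ge0. Qed.

Lemma rnorm_conj (z : C) : rnorm z^*%C = rnorm z.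
Proof. by case: z => a b; rewrite /rnorm !normc_def /= sqrrN. Qed.

Lemma mul_conj (z : C) : z * z^*%C = (rnorm z ^+ 2)%:C%C.
Proof.
rewrite rnorm_sqr; case: z => a b; apply/eqP; rewrite eq_complex /=.
by apply/andP; split; apply/eqP; ring.
Qed.

Lemma Re_rnorm (z : C) : `|Re z| <= rnorm z.
Proof.
rewrite -(@ler_pXn2r _ 2) ?nnegrE ?rnorm_ge0 // rnorm_sqr real_normK ?num_real //.
by rewrite lerDl sqr_ge0.
Qed.

Lemma Im_rnorm (z : C) : `|Im z| <= rnorm z.
Proof.
rewrite -(@ler_pXn2r _ 2) ?nnegrE ?rnorm_ge0 // rnorm_sqr real_normK ?num_real //.
by rewrite lerDr sqr_ge0.
Qed.

Lemma Re_le_rnorm (z : C) : Re z <= rnorm z.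
Proof. exact: le_trans (ler_norm _) (Re_rnorm z). Qed.

Lemma rnorm_ReIm (z : C) : rnorm z <= `|Re z| + `|Im z|.
Proof.
rewrite -(@ler_pXn2r _ 2) ?nnegrE ?rnorm_ge0 ?addr_ge0 // rnorm_sqr.
rewrite -(real_normK (num_real (Re z))) -(real_normK (num_real (Im z))).
rewrite sqrrD addrAC lerDl mulrn_wge0 // mulr_ge0 //.
Qed.

Lemma rnorm_rV_le n (x : 'rV[C]_n) K : 0 <= K ->
  (rnorm x <= K) <-> (forall j, rnorm (x 0 j) <= K).
Proof.
move=> K0; rewrite -lecR -rnormE.
have K0' : 0 <= K%:C%C :> C by rewrite ler0c.
have -> : (`|x| <= K%:C%C) = ((\big[Num.max/0%:nng]_i `|x i.1 i.2|%:nng) <= NngNum K0').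
  by rewrite /Num.norm /= mx_normE -num_le.
split=> [/bigmax_leP[_ h] j|h].
  by have := h (0, j) isT; rewrite -num_le /= -lecR -rnormE.
apply/bigmax_leP; split; first by rewrite -num_le /=.
by move=> [i j] _; rewrite -num_le /= rnormE lecR ord1; apply: h.
Qed.

Lemma rnorm_coord n (x : 'rV[C]_n) j : rnorm (x 0 j) <= rnorm x.
Proof. by have /rnorm_rV_le := lexx (rnorm x); apply; apply: rnorm_ge0. Qed.

Lemma rnorm_sum V I (r : seq I) (P : pred I) (F : I -> V) :
  rnorm (\sum_(i <- r | P i) F i) <= \sum_(i <- r | P i) rnorm (F i).
Proof.
elim/big_ind2 : _ => [|x a y b h1 h2|//]; first by rewrite rnorm0.
by rewrite (le_trans (rnormD _ _)) // lerD.
Qed.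

Lemma rnorm_le0 V (x : V) : (forall e, 0 < e -> rnorm x <= e) -> x = 0.
Proof.
move=> h; apply/eqP; rewrite -rnorm_eq0 eq_le rnorm_ge0 andbT.
by apply/ler_addgt0Pr => e e0; rewrite add0r h.
Qed.

(** The order of [C] compares only numbers with equal imaginary parts, so a positive complex number
    is a positive real. Filter statements over [C] can therefore be read with real epsilons. *)
Lemma gt0_complex (e : C) : 0 < e -> exists2 d : R, 0 < d & e = d%:C%C.
Proof.
case: e => a b; rewrite ltcE /= => /andP[/eqP -> a0]; exists a => //.
Qed.

Lemma near_rnorm V (x : V) (P : V -> Prop) :
  (\forall y \near x, P y) <-> exists2 d, 0 < d & forall h, rnorm h < d -> P (x + h).
Proof.
split=> [/nbhs_normP[e /= /gt0_complex[d d0 ->] h]|[d d0 h]].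
  exists d => // y yd; apply: h; rewrite /ball_ /=.
  by rewrite opprD addNKr normrN rnormE ltcR.
apply/nbhs_normP; exists d%:C%C => /=; first by rewrite ltcR.
move=> y; rewrite /ball_ /= => yd; rewrite -(subrK x y) addrC; apply: h.
by rewrite -ltcR -rnormE distrC.
Qed.

Lemma cont_rnorm (V W : normedModType C) (f : V -> W) x : {for x, continuous f} <->
  forall e, 0 < e -> exists2 d, 0 < d &
    forall h, rnorm h < d -> rnorm (f (x + h) - f x) <= e.
Proof.
split=> [/cvgrPdist_le h e e0|h].
  have /h/near_rnorm[d d0 hd] : 0 < e%:C%C :> C by rewrite ltcR.
  by exists d => // y /hd; rewrite distrC rnormE lecR.
apply/cvgrPdist_le => _ /gt0_complex[e e0 ->].
have [d d0 hd] := h e e0.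
by apply/near_rnorm; exists d => // y /hd; rewrite distrC rnormE lecR.
Qed.

(** The remainder estimate alone, for an arbitrary map [L]: a candidate such as an average can be
    tested separately from its linearity and continuity. *)
Definition has_diff (V W : normedModType C) (f : V -> W) (x : V) (L : V -> W) :=
  forall e, 0 < e -> exists2 d, 0 < d &
    forall h, rnorm h < d -> rnorm (f (x + h) - f x - L h) <= e * rnorm h.

Lemma diff_has_diff (V W : normedModType C) (f : V -> W) x : differentiable f x -> has_diff f x ('d f x).
Proof.
move=> /diff_locallyP[_ /eqaddoP h] e e0.
have /h/near_rnorm[d d0 hd] : 0 < e%:C%C :> C by rewrite ltcR.
exists d => // y /hd.
rewrite add0r !rnormE -rmorphM /= lecR; congr (rnorm _ <= _).
by rewrite [x + y]addrC -addrA -opprD.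
Qed.

Lemma has_diff_diff (V W : normedModType C) (f : V -> W) x (L : {linear V -> W}) :
  continuous L -> has_diff f x L -> differentiable f x /\ 'd f x = L :> (V -> W).
Proof.
move=> cL h.
have E : f \o shift x = cst (f x) + L +o_ (0 : V) id.
  apply/eqaddoP => _ /gt0_complex[e e0 ->].
  have [d d0 hd] := h e e0.
  apply/near_rnorm; exists d => // y /hd.
  rewrite add0r !rnormE -rmorphM /= lecR; congr (rnorm _ <= _).
  by rewrite [x + y]addrC -addrA -opprD.
have := diff_unique cL E => dE; split=> //.
by apply/diff_locallyP; rewrite dE.
Qed.

End RealNorm.

(** * Integrals of continuous functions on segments *)

Section Integral.
Variable R : realType.
Local Notation C := R[i].
Implicit Types (a b c : R).

Definition cont_on (T : topologicalType) a b (phi : R -> T) :=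
  forall x, a <= x <= b -> {for x, continuous phi}.

(** Composing [phi] with the clamp onto [[a, b]] gives a function continuous on the whole line, so
    the fundamental theorem also yields two-sided derivatives at the endpoints. *)
Lemma ex_antiderivative a b (phi : R -> R) : a <= b -> cont_on a b phi ->
  exists Phi : R -> R, forall x, a <= x <= b -> is_derive x 1 Phi (phi x).
Proof.
move=> ab cphi.
pose cl (x : R) := Num.max a (Num.min x b).
have clab x : a <= cl x <= b.
  by rewrite /cl le_max lexx /= ge_max ab ge_min lexx orbT.
have ccl : continuous cl.
  move=> x; have h := @continuous_min R R id (cst b) x (fun A => id) (@cst_continuous _ _ b x).
  by have := @continuous_max R R (cst a) _ x (@cst_continuous _ _ a x) h; apply.
pose psi := phi \o cl.
have cpsi : continuous psi.
  by move=> x; apply: continuous_comp; [exact: ccl|exact: cphi].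
(* Integrating from [a - 1] makes [a] an interior point. *)
exists (fun x => (\int[lebesgue_measure]_(t in `[a - 1, x]) psi t)%R).
move=> x /andP[ax xb].
have [] := @continuous_FTC1_closed R psi (a - 1) x (b + 1).
- by rewrite (le_lt_trans xb) // ltrDl.
- apply: continuous_compact_integrable; first exact: segment_compact.
  exact: continuous_subspaceT.
- by rewrite (lt_le_trans _ ax) // gtrBl.
- exact: cpsi.
move=> dF F'E; apply: DeriveDef => //.
rewrite -derive1E F'E /psi /= /cl.
by congr phi; rewrite min_l // max_r.
Qed.

(** The integral is the increment of a chosen antiderivative, which turns linearity and additivity
    into algebra of antiderivatives. If none exists the choice defaults to 0; [rintE] shows that the
    choice among several does not matter. *)
Definition rint a b (phi : R -> R) : R :=
  let Phi := xget (fun=> 0)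
    [set Phi : R -> R | forall x, a <= x <= b -> is_derive x 1 Phi (phi x)]%classic in
  Phi b - Phi a.

(** Mean value theorem for [Psi - Phi]. Used in both directions with [phi = psi], it also shows that
    two antiderivatives have the same increment. *)
Lemma derive_le a b (Phi Psi phi psi : R -> R) : a <= b ->
  (forall x, a <= x <= b -> is_derive x 1 Phi (phi x)) ->
  (forall x, a <= x <= b -> is_derive x 1 Psi (psi x)) ->
  (forall x, a <= x <= b -> phi x <= psi x) ->
  Phi b - Phi a <= Psi b - Psi a.
Proof.
move=> ab dPhi dPsi le.
have d x : a <= x <= b -> is_derive x 1 (Psi - Phi) (psi x - phi x).
  by move=> xab; apply: is_deriveB; [exact: dPsi|exact: dPhi].
have [||c cab E] := @MVT_segment R (Psi - Phi) (fun x => psi x - phi x) a b ab.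
- by move=> x /[!in_itv] /= /andP[/ltW ax /ltW xb]; apply: d; rewrite ax.
- apply: derivable_within_continuous => x /[!in_itv] /= xab.
  by have [] := d x xab.
have : 0 <= (psi c - phi c) * (b - a).
  by apply: mulr_ge0; rewrite subr_ge0 // le //; move: cab; rewrite in_itv.
rewrite -E /= => h.
suff -> : Psi b - Psi a = (Psi - Phi) b - (Psi - Phi) a + (Phi b - Phi a) by rewrite lerDr.
by rewrite !fctE; ring.
Qed.

Lemma rintE a b (phi Phi : R -> R) : a <= b ->
  (forall x, a <= x <= b -> is_derive x 1 Phi (phi x)) ->
  rint a b phi = Phi b - Phi a.
Proof.
move=> ab dPhi; rewrite /rint; case: xgetP => [Psi _ /= dPsi|/(_ Phi)/(_ dPhi)//].
by apply/eqP; rewrite eq_le; apply/andP; split; apply: derive_le ab _ _ _;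
  try eassumption; move=> x _; exact: lexx.
Qed.

Lemma rint_le a b (phi psi : R -> R) : a <= b -> cont_on a b phi -> cont_on a b psi ->
  (forall x, a <= x <= b -> phi x <= psi x) -> rint a b phi <= rint a b psi.
Proof.
move=> ab /(ex_antiderivative ab)[Phi dPhi] /(ex_antiderivative ab)[Psi dPsi] le.
by rewrite (rintE ab dPhi) (rintE ab dPsi); apply: derive_le dPhi dPsi le.
Qed.

Lemma rint_lin a b (k : R) (phi psi : R -> R) : a <= b ->
  cont_on a b phi -> cont_on a b psi ->
  rint a b (fun x => k * phi x + psi x) = k * rint a b phi + rint a b psi.
Proof.
move=> ab /(ex_antiderivative ab)[Phi dPhi] /(ex_antiderivative ab)[Psi dPsi].
have d x : a <= x <= b -> is_derive x 1 (k *: Phi + Psi) (k * phi x + psi x).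
  by move=> xab; apply: is_deriveD; [apply: is_deriveZ; exact: dPhi|exact: dPsi].
rewrite (rintE ab dPhi) (rintE ab dPsi) (rintE ab d).
by rewrite !fctE /GRing.scale /=; ring.
Qed.

Lemma rint_cst a b (k : R) : a <= b -> rint a b (fun=> k) = k * (b - a).
Proof.
move=> ab.
have d x : a <= x <= b -> is_derive x 1 (k *: (id : R -> R)) k.
  by move=> _; apply: is_derive_eq; rewrite /GRing.scale /= mulr1.
by rewrite (rintE ab d) !fctE /GRing.scale /=; ring.
Qed.

Lemma rint_cat a b c (phi : R -> R) : a <= b -> b <= c -> cont_on a c phi ->
  rint a c phi = rint a b phi + rint b c phi.
Proof.
move=> ab bc cphi; have ac := le_trans ab bc.
have [Phi dPhi] := ex_antiderivative ac cphi.
have d1 x : a <= x <= b -> is_derive x 1 Phi (phi x).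
  by move=> /andP[h1 h2]; apply: dPhi; rewrite h1 (le_trans h2).
have d2 x : b <= x <= c -> is_derive x 1 Phi (phi x).
  by move=> /andP[h1 h2]; apply: dPhi; rewrite h2 (le_trans ab).
by rewrite (rintE ac dPhi) (rintE ab d1) (rintE bc d2); ring.
Qed.

Definition cint a b (phi : R -> C) : C :=
  (rint a b (fun t => Re (phi t)) +i* rint a b (fun t => Im (phi t)))%C.

Lemma near_real (x : R) (P : R -> Prop) :
  (\forall y \near x, P y) <-> exists2 d, 0 < d & forall h, `|h| < d -> P (x + h).
Proof.
split=> [/nbhs_normP[d /= d0 h]|[d d0 h]].
  exists d => // y yd; apply: h; rewrite /ball_ /=.
  by rewrite opprD addNKr normrN.
apply/nbhs_normP; exists d => //= y; rewrite /ball_ /= => yd.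
by rewrite -(subrK x y) addrC; apply: h; rewrite distrC.
Qed.

Lemma contRC (phi : R -> C) x : {for x, continuous phi} <->
  forall e, 0 < e -> exists2 d, 0 < d &
    forall h, `|h| < d -> rnorm (phi (x + h) - phi x) <= e.
Proof.
split=> [/cvgrPdist_le h e e0|h].
  have /h/near_real[d d0 hd] : 0 < e%:C%C :> C by rewrite ltcR.
  by exists d => // y /hd; rewrite distrC rnormE lecR.
apply/cvgrPdist_le => _ /gt0_complex[e e0 ->].
have [d d0 hd] := h e e0.
by apply/near_real; exists d => // y /hd; rewrite distrC rnormE lecR.
Qed.

Lemma cont_Re (phi : R -> C) x : {for x, continuous phi} ->
  {for x, continuous (fun t => Re (phi t))}.
Proof.
move=> /contRC h; apply/cvgrPdist_le => e e0.
have [d d0 hd] := h e e0.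
apply/near_real; exists d => // y /hd; apply: le_trans.
by rewrite distrC -raddfB Re_rnorm.
Qed.

Lemma cont_Im (phi : R -> C) x : {for x, continuous phi} ->
  {for x, continuous (fun t => Im (phi t))}.
Proof.
move=> /contRC h; apply/cvgrPdist_le => e e0.
have [d d0 hd] := h e e0.
apply/near_real; exists d => // y /hd; apply: le_trans.
by rewrite distrC -raddfB Im_rnorm.
Qed.

Lemma cont_real_complex (phi : R -> R) x : {for x, continuous phi} ->
  {for x, continuous (fun t => (phi t)%:C%C : C)}.
Proof.
move=> /cvgrPdist_le h; apply/contRC => e e0.
have /near_real[d d0 hd] := h e e0; exists d => // y /hd.
by rewrite -rmorphB /= rnormR distrC.
Qed.

Lemma cont_conj (phi : R -> C) x : {for x, continuous phi} ->
  {for x, continuous (fun t => (phi t)^*%C)}.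
Proof.
move=> /contRC h; apply/contRC => e e0.
have [d d0 hd] := h e e0; exists d => // y /hd.
by rewrite -rmorphB /= rnorm_conj.
Qed.

Lemma cont_mul (phi psi : R -> C) x : {for x, continuous phi} -> {for x, continuous psi} ->
  {for x, continuous (fun t => phi t * psi t)}.
Proof. by move=> h1 h2; have := @continuousM C R phi psi x h1 h2; apply. Qed.

Lemma cont_add (phi psi : R -> C) x : {for x, continuous phi} -> {for x, continuous psi} ->
  {for x, continuous (fun t => phi t + psi t)}.
Proof. by move=> h1 h2; have := @continuousD C C R phi psi x h1 h2; apply. Qed.

Lemma cont_cst (k : C) (x : R) : {for x, continuous (fun _ : R => k)}.
Proof. exact: cst_continuous. Qed.

Lemma cint_lin a b (k : C) (phi psi : R -> C) : a <= b ->
  cont_on a b phi -> cont_on a b psi ->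
  cint a b (fun x => k * phi x + psi x) = k * cint a b phi + cint a b psi.
Proof.
move=> ab cphi cpsi.
have c1 : cont_on a b (fun t => Re (phi t)) by move=> x /cphi; exact: cont_Re.
have c2 : cont_on a b (fun t => Im (phi t)) by move=> x /cphi; exact: cont_Im.
have c3 : cont_on a b (fun t => Re (psi t)) by move=> x /cpsi; exact: cont_Re.
have c4 : cont_on a b (fun t => Im (psi t)) by move=> x /cpsi; exact: cont_Im.
have cl (u v : R -> R) l : cont_on a b u -> cont_on a b v ->
    cont_on a b (fun t => l * u t + v t).
  move=> cu cv x xab.
  have h := @continuousM R _ (cst l) u x (@cst_continuous _ _ l x) (cu x xab).
  by have := @continuousD R R _ _ v x h (cv x xab); apply.
case: k => p q; rewrite /cint; apply/eqP; rewrite eq_complex /=.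
apply/andP; split; apply/eqP.
- transitivity (rint a b (fun t => p * Re (phi t) + (- q * Im (phi t) + Re (psi t)))).
    congr rint; apply/funext => t; case: (phi t) => u v; case: (psi t) => u' v' /=; ring.
  rewrite !rint_lin //; [ring|exact: cl].
- transitivity (rint a b (fun t => p * Im (phi t) + (q * Re (phi t) + Im (psi t)))).
    congr rint; apply/funext => t; case: (phi t) => u v; case: (psi t) => u' v' /=; ring.
  rewrite !rint_lin //; [ring|exact: cl].
Qed.

Lemma cint_cst a b (k : C) : a <= b -> cint a b (fun=> k) = k * (b - a)%:C%C.
Proof.
move=> ab; case: k => p q; rewrite /cint !rint_cst //; apply/eqP.
by rewrite eq_complex /=; apply/andP; split; apply/eqP; ring.
Qed.

Lemma cintZ a b (k : C) (phi : R -> C) : a <= b -> cont_on a b phi ->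
  cint a b (fun x => k * phi x) = k * cint a b phi.
Proof.
move=> ab cphi; transitivity (cint a b (fun x => k * phi x + 0)).
  by congr cint; apply/funext => x; rewrite addr0.
have c0 : cont_on a b (fun=> 0 : C) by move=> x _; exact: cont_cst.
by rewrite (cint_lin k ab cphi c0) (cint_cst 0 ab) mul0r addr0.
Qed.

Lemma cintB a b (phi psi : R -> C) : a <= b -> cont_on a b phi -> cont_on a b psi ->
  cint a b (fun x => phi x - psi x) = cint a b phi - cint a b psi.
Proof.
move=> ab cphi cpsi; transitivity (cint a b (fun x => -1 * psi x + phi x)).
  by congr cint; apply/funext => x; rewrite mulN1r addrC.
by rewrite (cint_lin (-1) ab cpsi cphi) mulN1r addrC.
Qed.

Lemma cint_conj a b (phi : R -> C) : a <= b -> cont_on a b phi ->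
  cint a b (fun x => (phi x)^*%C) = (cint a b phi)^*%C.
Proof.
move=> ab cphi; rewrite /cint /=; congr (_ +i* _)%C.
  by congr rint; apply/funext => t; case: (phi t).
have c2 : cont_on a b (fun t => Im (phi t)) by move=> x /cphi; exact: cont_Im.
transitivity (rint a b (fun t => -1 * Im (phi t) + 0)).
  by congr rint; apply/funext => t; case: (phi t) => u v /=; rewrite mulN1r addr0.
have c0 : cont_on a b (fun=> 0 : R) by move=> x _; exact: cst_continuous.
by rewrite (rint_lin (-1) ab c2 c0) (rint_cst 0 ab) mul0r addr0 mulN1r.
Qed.

Lemma cint_cat a b c (phi : R -> C) : a <= b -> b <= c -> cont_on a c phi ->
  cint a c phi = cint a b phi + cint b c phi.
Proof.
move=> ab bc cphi.
have c1 : cont_on a c (fun t => Re (phi t)) by move=> x /cphi; exact: cont_Re.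
have c2 : cont_on a c (fun t => Im (phi t)) by move=> x /cphi; exact: cont_Im.
by rewrite /cint (rint_cat ab bc c1) (rint_cat ab bc c2).
Qed.

(** The unimodular factor [k] that makes the integral a nonnegative real reduces its modulus to a
    real part, where the real inequality applies. *)
Lemma cint_le a b (phi : R -> C) (w : R -> R) : a <= b -> cont_on a b phi -> cont_on a b w ->
  (forall x, a <= x <= b -> rnorm (phi x) <= w x) -> rnorm (cint a b phi) <= rint a b w.
Proof.
move=> ab cphi cw le; set I := cint a b phi.
have [I0|I0] := eqVneq I 0.
  rewrite I0 rnorm0 -(mul0r (b - a)) -rint_cst // rint_le //.
    by move=> x _; exact: cst_continuous.
  by move=> x /le; apply: le_trans; rewrite rnorm_ge0.
pose k := I^*%C / (rnorm I)%:C%C.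
have k1 : rnorm k = 1.
  by rewrite /k rnormM rnorm_conj rnormV rnormR ger0_norm ?rnorm_ge0 // divff // rnorm_eq0.
have kI : k * I = (rnorm I)%:C%C.
  rewrite /k mulrAC [_ * I]mulrC mul_conj expr2 rmorphM /= mulfK //.
  by rewrite -(rmorph0 (real_complex R)) (inj_eq (@complexI R)) rnorm_eq0.
have -> : rnorm I = Re (cint a b (fun t => k * phi t)) by rewrite cintZ // kI.
have ck : cont_on a b (fun t => Re (k * phi t)).
  by move=> x /cphi h; exact: (cont_Re (cont_mul (@cont_cst k x) h)).
apply: (rint_le ab ck cw) => x /le; apply: le_trans; apply: le_trans (Re_le_rnorm _) _.
by rewrite rnormM k1 mul1r.
Qed.

Lemma cint_le_cst a b (phi : R -> C) K : a <= b -> cont_on a b phi ->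
  (forall x, a <= x <= b -> rnorm (phi x) <= K) -> rnorm (cint a b phi) <= K * (b - a).
Proof.
move=> ab cphi le; rewrite -rint_cst //; apply: (cint_le ab cphi _ le).
by move=> x _; exact: cst_continuous.
Qed.

Lemma cint_affine a b (p q : C) : a <= b ->
  cint a b (fun t => p + q * t%:C%C) =
  p * (b - a)%:C%C + q * ((b ^+ 2 - a ^+ 2) / 2)%:C%C.
Proof.
move=> ab.
have H (u v : R) : rint a b (fun t => u + v * t) = u * (b - a) + v * ((b ^+ 2 - a ^+ 2) / 2).
  have d x : a <= x <= b ->
      is_derive x 1 (u *: id + (v / 2) *: (id * id : R -> R)) (u + v * x).
    move=> _; have i := @is_derive_id R R x 1.
    apply: (is_derive_eq (is_deriveD (is_deriveZ u i) (is_deriveZ (v / 2) (is_deriveM i i)))).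
    by rewrite /GRing.scale /=; field.
  by rewrite (rintE ab d) !fctE /GRing.scale /=; field.
rewrite /cint; case: p => p1 p2; case: q => q1 q2; apply/eqP; rewrite eq_complex /=.
apply/andP; split; apply/eqP.
- transitivity (rint a b (fun t => p1 + q1 * t)).
    by congr rint; apply/funext => t; ring.
  by rewrite H; ring.
- transitivity (rint a b (fun t => p2 + q2 * t)).
    by congr rint; apply/funext => t; ring.
  by rewrite H; ring.
Qed.

End Integral.

(** * Complex derivatives and Goursat's theorem *)

Section ComplexDerivative.
Variable R : realType.
Local Notation C := R[i].

Definition cder (f : C -> C) (z l : C) := has_diff f z (fun h => l * h).

Lemma cder_diff (f : C -> C) z l : cder f z l ->
  differentiable f z /\ forall h, 'd f z h = l * h.
Proof.
move=> h.
have [df E] := @has_diff_diff R C C f z ( *:%R l) (@scaler_continuous C C l) h.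
by split=> // k; exact: (congr1 (@^~ k) E).
Qed.

Lemma diff_cder (f : C -> C) z l : differentiable f z -> (forall h, 'd f z h = l * h) ->
  cder f z l.
Proof.
move=> /diff_has_diff df E e /df[d d0 hd]; exists d => // h.
by rewrite -(E h); exact: hd.
Qed.

Lemma cder_cst (k z : C) : cder (fun=> k) z 0.
Proof. by move=> e e0; exists 1 => // h _; rewrite subrr mul0r subr0 rnorm0 mulr_ge0 ?rnorm_ge0 // ltW. Qed.

Lemma cder_id (z : C) : cder (fun z => z) z 1.
Proof.
move=> e e0; exists 1 => // h _.
by rewrite [z + h]addrC addrK mul1r subrr rnorm0 mulr_ge0 ?rnorm_ge0 // ltW.
Qed.

Lemma cderD (f g : C -> C) z l m : cder f z l -> cder g z m ->
  cder (fun z => f z + g z) z (l + m).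
Proof.
move=> /cder_diff[df Ef] /cder_diff[dg Eg].
apply: diff_cder => [|h]; first exact: (differentiableD df dg).
have E : 'd (fun z => f z + g z) z h = 'd f z h + 'd g z h := congr1 (@^~ h) (diffD df dg).
exact: etrans E (etrans (congr2 +%R (Ef h) (Eg h)) (esym (mulrDl _ _ _))).
Qed.

Lemma cderM (f g : C -> C) z l m : cder f z l -> cder g z m ->
  cder (fun z => f z * g z) z (l * g z + f z * m).
Proof.
move=> /cder_diff[df Ef] /cder_diff[dg Eg].
apply: diff_cder => [|h]; first exact: (differentiableM df dg).
have E : 'd (fun z => f z * g z) z h = f z * 'd g z h + g z * 'd f z h :=
  congr1 (@^~ h) (diffM df dg).
apply: etrans E (etrans (congr2 (fun u v => f z * u + g z * v) (Eg h) (Ef h)) _).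
by ring.
Qed.

Lemma cderZ (k : C) (f : C -> C) z l : cder f z l -> cder (fun z => k * f z) z (k * l).
Proof.
by move=> h; have := cderM (cder_cst k z) h; rewrite mul0r add0r.
Qed.

Lemma cderV (f : C -> C) z l : cder f z l -> f z != 0 ->
  cder (fun z => (f z)^-1) z (- (f z) ^- 2 * l).
Proof.
move=> /cder_diff[df Ef] f0.
apply: diff_cder => [|h]; first exact: (differentiableV df f0).
have E : 'd (fun z => (f z)^-1) z h = - (f z) ^- 2 * 'd f z h := congr1 (@^~ h) (diffV df f0).
exact: etrans E (etrans (congr1 ( *%R _) (Ef h)) (mulrA _ _ _)).
Qed.

Lemma cder_comp (f g : C -> C) z l m : cder g z m -> cder f (g z) l ->
  cder (fun z => f (g z)) z (l * m).
Proof.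
move=> /cder_diff[dg Eg] /cder_diff[df Ef].
apply: diff_cder => [|h]; first exact: (differentiable_comp dg df).
have E : 'd (fun z => f (g z)) z h = 'd f (g z) ('d g z h) := congr1 (@^~ h) (diff_comp dg df).
exact: etrans E (etrans (Ef _) (etrans (congr1 ( *%R l) (Eg h)) (mulrA _ _ _))).
Qed.

Lemma cder_near (f g : C -> C) z l d : 0 < d ->
  (forall h, rnorm h < d -> g (z + h) = f (z + h)) -> cder f z l -> cder g z l.
Proof.
move=> d0 E hf e e0; have [d1 d10 h1] := hf e e0.
exists (Num.min d d1); first by rewrite lt_min d0.
move=> h; rewrite lt_min => /andP[h2 h3]; rewrite E //.
have := E 0; rewrite rnorm0 addr0 => -> //; exact: h1.
Qed.

Lemma cder_unique (f : C -> C) z l m : cder f z l -> cder f z m -> l = m.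
Proof.
move=> /cder_diff[_ Ef] /cder_diff[_ Eg].
by have := etrans (esym (Ef 1)) (Eg 1); rewrite !mulr1.
Qed.

Lemma has_diff_cont (V W : normedModType C) (f : V -> W) x (L : V -> W) K :
  (forall h, rnorm (L h) <= K * rnorm h) ->
  has_diff f x L -> forall e, 0 < e -> exists2 d, 0 < d &
    forall h, rnorm h < d -> rnorm (f (x + h) - f x) <= e.
Proof.
move=> LK h e e0; have [d d0 hd] := h 1 ltr01.
have K0 : 0 < 1 + `|K| by rewrite ltr_pwDl.
exists (Num.min d (e / (1 + `|K|))); first by rewrite lt_min d0 divr_gt0.
move=> y; rewrite lt_min => /andP[/hd h1 h2].
rewrite -(subrK (L y) (f (x + y) - f x)) (le_trans (rnormD _ _)) //.
rewrite (le_trans (lerD h1 (LK y))) // -mulrDl.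
rewrite (@le_trans _ _ ((1 + `|K|) * rnorm y)) //.
  by rewrite ler_wpM2r ?rnorm_ge0 // lerD2l ler_norm.
by rewrite mulrC -ler_pdivlMr // ltW.
Qed.

Lemma cder_cont (f : C -> C) z l : cder f z l ->
  forall e, 0 < e -> exists2 d, 0 < d &
    forall h, rnorm h < d -> rnorm (f (z + h) - f z) <= e.
Proof.
by apply: (@has_diff_cont _ _ _ _ _ (rnorm l)) => h; rewrite rnormM.
Qed.

Lemma cont_path (T : normedModType C) (f : T -> C) (gam : R -> T) (x : R) :
  (forall e, 0 < e -> exists2 d, 0 < d &
    forall h, rnorm h < d -> rnorm (f (gam x + h) - f (gam x)) <= e) ->
  (forall e, 0 < e -> exists2 d, 0 < d &
    forall h, `|h| < d -> rnorm (gam (x + h) - gam x) <= e) ->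
  {for x, continuous (fun t => f (gam t))}.
Proof.
move=> hf hg; apply/contRC => e e0; have [d d0 hd] := hf e e0.
have [d' d'0 hd'] := hg (d / 2) (divr_gt0 d0 (ltr0Sn _ 1)).
exists d' => // h /hd' hh; rewrite -[gam (x + h)](subrK (gam x)) [_ + gam x]addrC.
by apply: hd; rewrite (le_lt_trans hh) // ltr_pdivrMr // ltr_pMr // ltr1n.
Qed.

End ComplexDerivative.

Section Goursat.
Variable R : realType.
Local Notation C := R[i].

Lemma nested_intervals (A : nat -> R) (w : R) : 0 <= w ->
  (forall k, A k <= A k.+1) ->
  (forall k, A k.+1 + w / 2 ^+ k.+1 <= A k + w / 2 ^+ k) ->
  exists x, forall k, A k <= x <= A k + w / 2 ^+ k.
Proof.
move=> w0 inc dec.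
have wk k : 0 <= w / 2 ^+ k by rewrite divr_ge0 // exprn_ge0.
have mono : {homo A : i j / (i <= j)%N >-> i <= j}.
  exact: (@homo_leq _ A _ (fun x => lexx x) (fun y x z => @le_trans _ _ y x z) inc).
have anti k j : A (k + j)%N + w / 2 ^+ (k + j) <= A k + w / 2 ^+ k.
  elim: j => [|j IH]; first by rewrite addn0.
  rewrite addnS; exact: le_trans (dec _) IH.
have ub j k : A j <= A k + w / 2 ^+ k.
  case: (leqP j k) => [/mono h|/ltnW/subnKC kj].
    by apply: le_trans h _; rewrite lerDl.
  by have := anti k (j - k)%N; rewrite kj; apply: le_trans; rewrite lerDl.
exists (sup (range A)) => k; apply/andP; split.
  apply: ub_le_sup; last by exists k.
  by exists (A 0%N + w / 2 ^+ 0) => _ [j _ <-]; exact: ub.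
apply: ge_sup; first by exists (A 0%N), 0%N.
by move=> _ [j _ <-]; exact: ub.
Qed.

Lemma exists_small (w d : R) : 0 < d -> exists k, w / 2 ^+ k < d.
Proof.
move=> d0; exists (Num.truncn (`|w| / d)).+1.
rewrite ltr_pdivrMr ?exprn_gt0 //.
apply: le_lt_trans (ler_norm w) _; rewrite mulrC -ltr_pdivrMr //.
apply: lt_le_trans (truncnS_gt _) _.
by rewrite -natrX ler_nat ltnW // ltn_expl.
Qed.

Variable h : C -> C.

(** The integral over the boundary of [[a, b] x [c, d]], counterclockwise: bottom, right, top,
    left. *)
Definition rect_int (a b c d : R) : C :=
  cint a b (fun s => h (s +i* c)%C) + 'i%C * cint c d (fun t => h (b +i* t)%C)
  - cint a b (fun s => h (s +i* d)%C) - 'i%C * cint c d (fun t => h (a +i* t)%C).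

Definition cder_rect (a b c d : R) :=
  forall z, a <= Re z <= b -> c <= Im z <= d -> exists l, cder h z l.

Lemma cder_rect_hor a b c d t : cder_rect a b c d -> c <= t <= d ->
  cont_on a b (fun s => h (s +i* t)%C).
Proof.
move=> dh ct s sab; apply: (@cont_path R C h (fun s => (s +i* t)%C)).
  by have [|//|l] := dh (s +i* t)%C => //; exact: cder_cont.
move=> e e0; exists e => // u /ltW ue; apply: le_trans ue.
have -> : ((s + u) +i* t - s +i* t)%C = u%:C%C.
  by apply/eqP; rewrite eq_complex /=; apply/andP; split; apply/eqP; ring.
by rewrite rnormR.
Qed.

Lemma cder_rect_ver a b c d s : cder_rect a b c d -> a <= s <= b ->
  cont_on c d (fun t => h (s +i* t)%C).
Proof.
move=> dh sab t ct; apply: (@cont_path R C h (fun t => (s +i* t)%C)).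
  by have [|//|l] := dh (s +i* t)%C => //; exact: cder_cont.
move=> e e0; exists e => // u /ltW ue; apply: le_trans ue.
have -> : (s +i* (t + u) - s +i* t)%C = 'i%C * u%:C%C.
  by apply/eqP; rewrite eq_complex /=; apply/andP; split; apply/eqP; ring.
by rewrite rnormM rnormR /rnorm normc_def /= expr0n expr1n /= add0r sqrtr1 mul1r.
Qed.

Lemma rect_int_split a m b c n d : a <= m <= b -> c <= n <= d -> cder_rect a b c d ->
  rect_int a b c d = rect_int a m c n + rect_int m b c n +
                     rect_int a m n d + rect_int m b n d.
Proof.
move=> /andP[am mb] /andP[cn nd] dh; have ab := le_trans am mb; have cd := le_trans cn nd.
have H t : c <= t <= d -> _ := fun ct => cint_cat am mb (cder_rect_hor dh ct).
have V s : a <= s <= b -> _ := fun sab => cint_cat cn nd (cder_rect_ver dh sab).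
rewrite /rect_int !H ?V ?lexx ?ab ?cd ?cn ?nd ?am ?mb //.
ring.
Qed.

(** An affine function has zero integral over the boundary, by explicit computation, so only the
    deviation from [p + l z] contributes: at most [K] times the perimeter. *)
Lemma rect_int_local a b c d (p l : C) (K : R) : a <= b -> c <= d -> cder_rect a b c d ->
  (forall z, a <= Re z <= b -> c <= Im z <= d -> rnorm (h z - (p + l * z)) <= K) ->
  rnorm (rect_int a b c d) <= 2 * K * ((b - a) + (d - c)).
Proof.
move=> ab cd dh hK.
have ct (u v : C) : cont_on a b (fun t : R => u + v * t%:C%C) /\ cont_on c d (fun t : R => u + v * t%:C%C).
  have h0 (x : R) : {for x, continuous (fun t : R => u + v * t%:C%C)}.
    exact: (cont_add (@cont_cst R u x) (cont_mul (@cont_cst R v x) (@cont_real_complex R id x (fun A => id)))).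
  by split=> x _; exact: h0.
have H t : c <= t <= d -> rnorm (cint a b (fun s => h (s +i* t)%C) -
    cint a b (fun s => (p + l * (0 +i* t)%C) + l * s%:C%C)) <= K * (b - a).
  move=> tcd; have c1 := cder_rect_hor dh tcd.
  have [c2 _] := ct (p + l * (0 +i* t)%C) l.
  rewrite -(cintB ab c1 c2); apply: cint_le_cst ab _ _.
    move=> x /[dup] /c1 h1 /c2 h2.
    by have := @continuousB C C R _ _ x h1 h2; apply.
  move=> x xab; have := hK (x +i* t)%C xab tcd; congr (rnorm (_ - _) <= _).
  by rewrite -addrA -mulrDr; congr (_ + _ * _); apply/eqP; rewrite eq_complex /= !add0r addr0 !eqxx.
have V s : a <= s <= b -> rnorm (cint c d (fun t => h (s +i* t)%C) -
    cint c d (fun t => (p + l * s%:C%C) + (l * 'i%C) * t%:C%C)) <= K * (d - c).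
  move=> sab; have c1 := cder_rect_ver dh sab.
  have [_ c2] := ct (p + l * s%:C%C) (l * 'i%C).
  rewrite -(cintB cd c1 c2); apply: cint_le_cst cd _ _.
    move=> x /[dup] /c1 h1 /c2 h2.
    by have := @continuousB C C R _ _ x h1 h2; apply.
  move=> x xcd; have := hK (s +i* x)%C sab xcd; congr (rnorm (_ - _) <= _).
  by rewrite -addrA -mulrA -mulrDr; congr (_ + _ * _); apply/eqP; rewrite eq_complex /=; apply/andP; split; apply/eqP; ring.
have aab : a <= a <= b by rewrite lexx.
have bab : a <= b <= b by rewrite lexx ab.
have ccd : c <= c <= d by rewrite lexx.
have dcd : c <= d <= d by rewrite lexx cd.
have := H _ ccd; have := H _ dcd; have := V _ aab; have := V _ bab.
rewrite !cint_affine //.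
set I1 := cint a b _; set I2 := cint a b _; set J1 := cint c d _; set J2 := cint c d _.
move=> h1 h2 h3 h4.
have ri (z : C) : rnorm ('i%C * z) = rnorm z.
  by rewrite rnormM [X in X * _]/rnorm normc_def /= expr0n expr1n /= add0r sqrtr1 mul1r.
rewrite -[X in _ <= X](_ : K * (b - a) + K * (d - c) + K * (b - a) + K * (d - c) = _); last by ring.
apply: le_trans (lerD (lerD (lerD h4 h1) h3) h2).
rewrite -(ri (J1 - _)) -(ri (J2 - _)).
apply: le_trans (lerD (le_trans (rnormB _ _) (lerD (rnormD _ _) (lexx _))) (lexx _)).
apply: le_trans (rnormB _ _).
rewrite le_eqVlt; apply/orP; left; apply/eqP; congr rnorm.
rewrite /rect_int -/I1 -/I2 -/J1 -/J2.
have i2 : 'i%C * 'i%C = -1 :> C by rewrite -expr2 sqr_i.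
have e (x : R) : (0 +i* x)%C = 'i%C * x%:C%C.
  by apply/eqP; rewrite eq_complex /=; apply/andP; split; apply/eqP; ring.
rewrite (e c) (e d) (rmorphB _ b a) (rmorphB _ d c) /=.
ring: i2.
Qed.

(** Bisection: the bound to be proved is quadratic in the size of the rectangle, so it adds up
    exactly over four quarters and its failure passes to one of them. At the common point of the
    nested rectangles, differentiability makes it true at small scale. *)
Theorem goursat a b c d : a <= b -> c <= d -> cder_rect a b c d -> rect_int a b c d = 0.
Proof.
move=> ab cd dh; apply: rnorm_le0 => e e0.
pose L := (b - a) + (d - c).
have L0 : 0 <= L by rewrite addr_ge0 // subr_ge0.
(* A bound proportional to an arbitrary [e] is enough; the factor [2 L^2] is absorbed by rescaling
   [e]. *)
wlog suff : e e0 / rnorm (rect_int a b c d) <= 2 * e * L ^+ 2.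
  move=> H; pose e' := e / (2 * L ^+ 2 + 1).
  have p : 0 < 2 * L ^+ 2 + 1 by rewrite ltr_wpDl // mulr_ge0 // sqr_ge0.
  have e'0 : 0 < e' by rewrite divr_gt0.
  apply: le_trans (H _ e'0) _.
  have -> : e = e' * (2 * L ^+ 2 + 1) by rewrite divfK // lt0r_neq0.
  by lra.
pose w := b - a; pose v := d - c.
have w0 : 0 <= w by rewrite subr_ge0.
have v0 : 0 <= v by rewrite subr_ge0.
pose P k (p : R * R) := rnorm (rect_int p.1 (p.1 + w / 2 ^+ k) p.2 (p.2 + v / 2 ^+ k))
   <= 2 * e * (w / 2 ^+ k + v / 2 ^+ k) ^+ 2.
pose inside k (p : R * R) := [&& a <= p.1, p.1 + w / 2 ^+ k <= b, c <= p.2 & p.2 + v / 2 ^+ k <= d].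
pose sub k (p q : R * R) := [&& p.1 <= q.1, q.1 + w / 2 ^+ k.+1 <= p.1 + w / 2 ^+ k,
   p.2 <= q.2 & q.2 + v / 2 ^+ k.+1 <= p.2 + v / 2 ^+ k].
have dhS a' b' c' d' : a <= a' -> b' <= b -> c <= c' -> d' <= d -> cder_rect a' b' c' d'.
  move=> h1 h2 h3 h4 z /andP[h5 h6] /andP[h7 h8].
  by apply: dh; rewrite ?(le_trans h1 h5) ?(le_trans h3 h7) ?(le_trans h6) ?(le_trans h8).
have half k (x : R) : x / 2 ^+ k = x / 2 ^+ k.+1 + x / 2 ^+ k.+1.
  by rewrite exprS; field; rewrite expf_neq0.
have step k p : inside k p -> ~ P k p -> exists q, [/\ inside k.+1 q, ~ P k.+1 q & sub k p q].
  move=> ip np; apply: contrapT => nq; apply: np.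
  pose w' := w / 2 ^+ k.+1; pose v' := v / 2 ^+ k.+1.
  have w'0 : 0 <= w' by rewrite divr_ge0 // exprn_ge0.
  have v'0 : 0 <= v' by rewrite divr_ge0 // exprn_ge0.
  have Q q : sub k p q -> P k.+1 q.
    move=> s; apply: contrapT => nP; apply: nq; exists q; split=> //.
    move: s ip => /and4P[s1 s2 s3 s4] /and4P[i1 i2 i3 i4]; apply/and4P; split.
    - exact: le_trans i1 s1.
    - exact: le_trans s2 i2.
    - exact: le_trans i3 s3.
    - exact: le_trans s4 i4.
  have [h1 h2 h3 h4] : [/\ P k.+1 p, P k.+1 (p.1 + w', p.2), P k.+1 (p.1, p.2 + v')
      & P k.+1 (p.1 + w', p.2 + v')].
    by split; apply: Q; rewrite /sub /= !(half k) -/w' -/v' -?addrA ?lexx ?lerD2l ?lerDl ?w'0 ?v'0.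
  move: ip => /and4P[i1 i2 i3 i4].
  rewrite /P /= -/w' -/v' in h1 h2 h3 h4.
  rewrite /P (@rect_int_split _ (p.1 + w') _ _ (p.2 + v')); first last.
  - exact: dhS.
  - by rewrite (half k) addrA -/v' !lerDl v'0.
  - by rewrite (half k) addrA -/w' !lerDl w'0.
  rewrite !(half k) -/w' -/v' [p.1 + (w' + w')]addrA [p.2 + (v' + v')]addrA.
  apply: le_trans (rnormD _ _) _.
  apply: le_trans (lerD (rnormD _ _) (lexx _)) _.
  apply: le_trans (lerD (lerD (rnormD _ _) (lexx _)) (lexx _)) _.
  apply: le_trans (lerD (lerD (lerD h1 h2) h3) h4) _.
  by rewrite le_eqVlt; apply/orP; left; apply/eqP; ring.
have e1 : a + w / 2 ^+ 0 = b by rewrite expr0 divr1 /w; ring.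
have e2 : c + v / 2 ^+ 0 = d by rewrite expr0 divr1 /v; ring.
suff : P 0%N (a, c) by rewrite /P /= e1 e2 expr0 !divr1.
apply: contrapT => nP0.
(* The level is stored together with the corner and the two properties, so that a single type serves
   every step of the recursion. *)
pose T := {x : nat * (R * R) | inside x.1 x.2 /\ ~ P x.1 x.2}.
have i0 : inside 0%N (a, c) by rewrite /inside /= e1 e2 !lexx.
have stp (x : T) : {y : T | (sval y).1 = (sval x).1.+1 /\ sub (sval x).1 (sval x).2 (sval y).2}.
  apply: cid; case: x => -[k p] /= [ip np]; have [q [iq nq s]] := step k p ip np.
  by exists (exist _ (k.+1, q) (conj iq nq)).
pose S : nat -> T := fix S n := if n is m.+1 then sval (stp (S m)) else
  exist (fun x => inside x.1 x.2 /\ ~ P x.1 x.2) (0%N, (a, c)) (conj i0 nP0).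
have S1 n : (sval (S n)).1 = n.
  by elim: n => // n IH; have [/= -> _] := svalP (stp (S n)); rewrite IH.
pose p n := (sval (S n)).2.
have ps n : sub n (p n) (p n.+1).
  have [_] := svalP (stp (S n)); rewrite -[sval (stp (S n))]/(S n.+1) -/(p n) -/(p n.+1).
  by rewrite (S1 n).
have [x hx] : exists x, forall k, (p k).1 <= x <= (p k).1 + w / 2 ^+ k.
  by apply: nested_intervals => // k; have /and4P[] := ps k.
have [y hy] : exists y, forall k, (p k).2 <= y <= (p k).2 + v / 2 ^+ k.
  by apply: nested_intervals => // k; have /and4P[] := ps k.
have pin k : inside k (p k) /\ ~ P k (p k) by have := svalP (S k); rewrite S1.
have [||l hl] := dh (x +i* y)%C; rewrite /=.
  by have := hx 0%N; rewrite /p /= e1.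
  by have := hy 0%N; rewrite /p /= e2.
have [dl dl0 hdl] := hl e e0.
have [k hk] := @exists_small (w + v) dl dl0.
have [/and4P[i1 i2 i3 i4] nPk] := pin k; apply: nPk.
set wk := w / 2 ^+ k in i2; set vk := v / 2 ^+ k in i4.
have wk0 : 0 <= wk by rewrite divr_ge0 // exprn_ge0.
have vk0 : 0 <= vk by rewrite divr_ge0 // exprn_ge0.
rewrite /P -/wk -/vk; set z0 := (x +i* y)%C in hl hdl.
(* All points of this rectangle are within [wk + vk] of the limit point, so [h] deviates from its
   linearization by at most [e (wk + vk)]; the perimeter supplies the second factor [wk + vk]. *)
apply: le_trans (@rect_int_local _ _ _ _ (h z0 - l * z0) l (e * (wk + vk)) _ _ _ _) _.
- by rewrite lerDl.
- by rewrite lerDl.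
- exact: dhS.
- move=> z hz1 hz2.
  have n : rnorm (z - z0) <= wk + vk.
    apply: le_trans (rnorm_ReIm _) _; rewrite /z0; have := hx k; have := hy k.
    case: z hz1 hz2 => z1 z2 /=; rewrite -/wk -/vk => /andP[? ?] /andP[? ?] /andP[? ?] /andP[? ?].
    by rewrite lerD // ler_norml; apply/andP; split; lra.
  have /hdl : rnorm (z - z0) < dl by apply: le_lt_trans n _; rewrite /wk /vk -mulrDl.
  rewrite [z0 + _]addrC subrK => H; apply: le_trans (le_trans H _); last by rewrite ler_pM2l.
  by rewrite le_eqVlt; apply/orP; left; apply/eqP; congr rnorm; ring.
by rewrite le_eqVlt; apply/orP; left; apply/eqP; ring.
Qed.

End Goursat.

(** * The complex exponential and the mean value property *)

Section RealDerivative.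
Variable R : realType.

Lemma real_deriveP (f : R -> R) (x l : R) : is_derive x 1 f l <->
  forall e, 0 < e -> exists2 d, 0 < d &
    forall h, `|h| < d -> `|f (x + h) - f x - l * h| <= e * `|h|.
Proof.
split=> [[df <-] e e0|h].
  have /eqaddoP/(_ e e0)/near_real[d d0 hd] := derivable_nbhs df.
  exists d => // h /hd; rewrite !fctE /= /GRing.scale /= !add0r.
  by rewrite mulr1 [h + x]addrC [h * _]mulrC opprD addrA.
have E : f \o shift x = cst (f x) + ( *:%R l : R -> R) +o_ (0 : R) id.
  apply/eqaddoP => e /h[d d0 hd].
  apply/near_real; exists d => // y /hd.
  rewrite add0r; congr (`|_| <= _).
  by rewrite [x + y]addrC -addrA -opprD.
have dE := diff_unique (@scaler_continuous R R l) E.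
have df : differentiable f x by apply/diff_locallyP; rewrite dE; split=> //; exact: scaler_continuous.
apply: DeriveDef; first exact/derivable1_diffP.
by rewrite (deriveE _ df); exact: etrans (congr1 (@^~ 1) dE) (mulr1 l).
Qed.

End RealDerivative.

Section ComplexExponential.
Variable R : realType.
Local Notation C := R[i].

Definition cis (t : R) : C := (cos t +i* sin t)%C.

Definition cexp (z : C) : C := (expR (Re z))%:C%C * cis (Im z).

Lemma cisE t : cis t = (cos t)%:C%C + 'i%C * (sin t)%:C%C.
Proof. by apply/eqP; rewrite eq_complex /=; apply/andP; split; apply/eqP; ring. Qed.

Lemma rnorm_cis t : rnorm (cis t) = 1.
Proof. by rewrite /rnorm normc_def /= cos2Dsin2 sqrtr1. Qed.

Lemma cis_neq0 t : cis t != 0.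
Proof. by rewrite -rnorm_eq0 rnorm_cis oner_eq0. Qed.

Lemma cis_conj t : cis t * (cis t)^*%C = 1.
Proof. by rewrite mul_conj rnorm_cis expr1n. Qed.

Lemma cis_inv t : (cis t)^-1 = (cis t)^*%C.
Proof. by apply: (mulfI (cis_neq0 t)); rewrite cis_conj divff // cis_neq0. Qed.

Lemma cont_cis (t : R) : {for t, continuous cis}.
Proof.
have -> : cis = (fun t => (cos t)%:C%C + 'i%C * (sin t)%:C%C) by apply/funext => u; exact: cisE.
apply: (cont_add (cont_real_complex (@continuous_cos R t))).
exact: (cont_mul (@cont_cst R 'i%C t) (cont_real_complex (@continuous_sin R t))).
Qed.

Lemma cexpD z w : cexp (z + w) = cexp z * cexp w.
Proof.
rewrite /cexp !raddfD /= expRD rmorphM /= mulrACA; congr (_ * _).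
rewrite /cis cosD sinD; apply/eqP; rewrite eq_complex /=.
by apply/andP; split; apply/eqP; ring.
Qed.

Lemma cexp0 : cexp 0 = 1.
Proof. by rewrite /cexp /cis /= expR0 cos0 sin0 mul1r. Qed.

Lemma rnorm_cexp z : rnorm (cexp z) = expR (Re z).
Proof. by rewrite /cexp rnormM rnorm_cis mulr1 rnormR ger0_norm // expR_ge0. Qed.

Lemma cexp_neq0 z : cexp z != 0.
Proof. by rewrite -rnorm_eq0 rnorm_cexp gt_eqF // expR_gt0. Qed.

(** Only the derivatives of [expR], [cos] and [sin] at 0 enter; the addition law carries the result
    to other points. *)
Lemma cder_cexp0 : cder cexp 0 1.
Proof.
move=> e e0.
(* With [n] the norm of the increment, the real and imaginary parts of the error will be at most
   [4 k n] and [5 k n]; hence the factor 10. *)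
have [k [k0 k1 ke]] : exists k, [/\ 0 < k, k <= 1 & 10 * k <= e].
  exists (Num.min (e / 10) 1); split; first by rewrite lt_min ltr01 andbT divr_gt0.
    by rewrite ge_min lexx orbT.
  by rewrite mulrC -ler_pdivlMr // ge_min lexx.
have /real_deriveP/(_ k k0)[d1 d10 h1] := is_derive_expR (0 : R).
have /real_deriveP/(_ k k0)[d2 d20 h2] := is_derive_cos (0 : R).
have /real_deriveP/(_ k k0)[d3 d30 h3] := is_derive_sin (0 : R).
exists (Num.min (Num.min d1 d2) (Num.min d3 k)); first by rewrite !lt_min d10 d20 d30 k0.
case=> u v; rewrite !lt_min => /andP[/andP[l1 l2] /andP[l3 l4]].
set n := rnorm _ in l1 l2 l3 l4 *.
have un : `|u| <= n := Re_rnorm (u +i* v)%C.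
have vn : `|v| <= n := Im_rnorm (u +i* v)%C.
have := h1 u (le_lt_trans un l1); have := h2 v (le_lt_trans vn l2).
have := h3 v (le_lt_trans vn l3).
rewrite !add0r expR0 cos0 sin0 oppr0 !mul0r !mul1r ?subr0 ?oppr0 !addr0 => s3 s2 s1.
rewrite ?add0r ?mul1r cexp0 /cexp /cis /=.
apply: le_trans (rnorm_ReIm _) _; rewrite /= !mul0r !subr0 !addr0.
set a := expR u in s1 *; set b := cos v in s2 *; set c := sin v in s3 *.
have n0 : 0 <= n := rnorm_ge0 _.
have s1' : `|a - 1 - u| <= k * n by apply: le_trans s1 _; rewrite ler_pM2l.
have s2' : `|b - 1| <= k * n by apply: le_trans s2 _; rewrite ler_pM2l.
have s3' : `|c - v| <= k * n by apply: le_trans s3 _; rewrite ler_pM2l.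
have kn : k * n <= 1 by rewrite -[1]mulr1 ler_pM // ?(ltW k0) // (le_trans (ltW l4)).
have na : `|a| <= 3.
  have -> : a = (a - 1 - u) + u + 1 by ring.
  apply: le_trans (ler_normD _ _) _; rewrite normr1.
  have := ler_normD (a - 1 - u) u; lra.
have na1 : `|a - 1| <= 2 * k.
  have -> : a - 1 = (a - 1 - u) + u by ring.
  apply: le_trans (ler_normD _ _) _.
  have : k * n <= k by rewrite ger_pMr // (le_trans (ltW l4)).
  lra.
have r1 : `|a * b - 1 - u| <= 4 * (k * n).
  have -> : a * b - 1 - u = (a - 1 - u) + a * (b - 1) by ring.
  apply: le_trans (ler_normD _ _) _; rewrite normrM.
  have : `|a| * `|b - 1| <= 3 * (k * n) by apply: ler_pM.
  lra.
have r2 : `|a * c - v| <= 5 * (k * n).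
  have -> : a * c - v = a * (c - v) + (a - 1) * v by ring.
  apply: le_trans (ler_normD _ _) _; rewrite !normrM.
  have : `|a| * `|c - v| <= 3 * (k * n) by apply: ler_pM.
  have : `|a - 1| * `|v| <= 2 * k * n by apply: ler_pM.
  lra.
have kn0 : 0 <= k * n by rewrite mulr_ge0 // ltW.
have : 10 * k * n <= e * n by rewrite ler_wpM2r.
lra.
Qed.

Lemma cder_cexp z : cder cexp z (cexp z).
Proof.
have s : cder (fun w => w - z) z 1.
  by have := cderD (cder_id z) (cder_cst (- z) z); rewrite addr0.
have : cder (fun w => cexp (w - z)) z (1 * 1).
  by apply: cder_comp s _; rewrite subrr; exact: cder_cexp0.
rewrite mulr1 => /(cderZ (cexp z)); rewrite mulr1.
by apply: (@cder_near _ _ _ _ _ 1) => // h _; rewrite -cexpD [z + (_ - _)]addrC subrK.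
Qed.

End ComplexExponential.

(** * Circle averages, Cauchy's coefficient formulas and the maximum modulus principle *)

Section MeanValue.
Variable R : realType.
Local Notation C := R[i].

Implicit Types (phi psi : R -> C) (k : C).

Definition avg (phi : R -> C) : C := ((2 * pi)^-1)%:C%C * cint 0 (2 * pi) phi.

Lemma twopi_gt0 : 0 < 2 * pi :> R.
Proof. by rewrite mulr_gt0 // pi_gt0. Qed.

Local Notation cont phi := (cont_on 0 (2 * pi) phi).

Lemma twopiC : ((2 * pi)^-1)%:C%C * (2 * pi : R)%:C%C = 1 :> C.
Proof. by rewrite -rmorphM /= mulVf // gt_eqF // twopi_gt0. Qed.

Lemma avg_cst k : avg (fun=> k) = k.
Proof. by rewrite /avg (cint_cst k (ltW twopi_gt0)) subr0 mulrCA twopiC mulr1. Qed.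

Lemma avg_lin k phi psi : cont phi -> cont psi ->
  avg (fun t => k * phi t + psi t) = k * avg phi + avg psi.
Proof. by move=> h1 h2; rewrite /avg (cint_lin k (ltW twopi_gt0) h1 h2) mulrDr mulrCA. Qed.

Lemma avgZ k phi : cont phi -> avg (fun t => k * phi t) = k * avg phi.
Proof. by move=> h1; rewrite /avg (cintZ k (ltW twopi_gt0) h1) mulrCA. Qed.

Lemma avgB phi psi : cont phi -> cont psi ->
  avg (fun t => phi t - psi t) = avg phi - avg psi.
Proof. by move=> h1 h2; rewrite /avg (cintB (ltW twopi_gt0) h1 h2) mulrBr. Qed.

Lemma avg_conj phi : cont phi -> avg (fun t => (phi t)^*%C) = (avg phi)^*%C.
Proof.
move=> h1; rewrite /avg (cint_conj (ltW twopi_gt0) h1) rmorphM /=; congr (_ * _).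
by apply/eqP; rewrite eq_complex /= oppr0 !eqxx.
Qed.

Lemma avg_le phi K : cont phi -> (forall t, rnorm (phi t) <= K) -> rnorm (avg phi) <= K.
Proof.
move=> h1 h2; rewrite /avg rnormM rnormR ger0_norm ?invr_ge0 ?(ltW twopi_gt0) //.
rewrite ler_pdivrMl ?twopi_gt0 // [leRHS]mulrC.
by have := cint_le_cst (ltW twopi_gt0) h1 (fun t _ => h2 t); rewrite subr0.
Qed.

Lemma avg_le_Re phi psi : cont phi -> cont psi ->
  (forall t, rnorm (phi t) <= Re (psi t)) -> rnorm (avg phi) <= Re (avg psi).
Proof.
move=> h1 h2 h3; rewrite /avg rnormM rnormR ger0_norm ?invr_ge0 ?(ltW twopi_gt0) //.
have -> (a : R) (z : C) : Re (a%:C%C * z) = a * Re z by case: z => u v /=; ring.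
rewrite ler_pM2l ?invr_gt0 ?twopi_gt0 //.
by apply: (cint_le (ltW twopi_gt0) h1 _ (fun t _ => h3 t)) => t /h2; exact: cont_Re.
Qed.

Definition circ (r t : R) : C := r%:C%C * cis t.

Lemma rnorm_circ r t : 0 <= r -> rnorm (circ r t) = r.
Proof. by move=> r0; rewrite /circ rnormM rnorm_cis mulr1 rnormR ger0_norm. Qed.

Lemma cont_circ r (t : R) : {for t, continuous (circ r)}.
Proof. exact: (cont_mul (@cont_cst R r%:C%C t) (@cont_cis R t)). Qed.

Lemma cont_cder_circ (g : C -> C) r t l : cder g (circ r t) l ->
  {for t, continuous (fun t => g (circ r t))}.
Proof.
move=> /cder_cont dg; apply: (@cont_path R C g (circ r)) => //.
by move=> e e0; have /contRC/(_ e e0) := @cont_circ r t.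
Qed.

Definition hol (rho : R) (g : C -> C) := forall z, rnorm z < rho -> exists l, cder g z l.

Definition hol_off0 (rho : R) (g : C -> C) :=
  forall z, z != 0 -> rnorm z < rho -> exists l, cder g z l.

Definition cont0 (g : C -> C) := forall e, 0 < e -> exists2 d, 0 < d &
    forall h, rnorm h < d -> rnorm (g h - g 0) <= e.

Lemma cont_hol rho g r : hol rho g -> 0 <= r < rho -> cont (fun t => g (circ r t)).
Proof.
move=> hg /andP[r0 rr] t _; have [|l] := hg (circ r t); first by rewrite rnorm_circ.
exact: cont_cder_circ.
Qed.

Lemma cont_off0 rho g r : hol_off0 rho g -> 0 < r < rho -> cont (fun t => g (circ r t)).
Proof.
move=> hg /andP[r0 rr] t _.
have c : rnorm (circ r t) = r by rewrite rnorm_circ ?(ltW r0).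
have [||l] := hg (circ r t); rewrite ?c //; first by rewrite -rnorm_eq0 c gt_eqF.
exact: cont_cder_circ.
Qed.

Lemma cexp_ln r t : 0 < r -> cexp (ln r +i* t)%C = circ r t.
Proof. by move=> r0; rewrite /cexp /= lnK. Qed.

(** Under [z = exp(u + i t)] the annulus becomes the rectangle [[ln s, ln r] x [0, 2 pi]], on which
    [g] composed with [cexp] is differentiable because [cexp] avoids 0. The horizontal sides cancel
    by periodicity, leaving the two circles. *)
Lemma cint_circ_const rho g s r : hol_off0 rho g -> 0 < s <= r -> r < rho ->
  cint 0 (2 * pi) (fun t => g (circ s t)) = cint 0 (2 * pi) (fun t => g (circ r t)).
Proof.
move=> hg /andP[s0 sr] rrho; have r0 := lt_le_trans s0 sr.
have ls : ln s <= ln r by rewrite ler_ln.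
have dh : cder_rect (fun z => g (cexp z)) (ln s) (ln r) 0 (2 * pi).
  move=> z /andP[_ zr] _; have [|l hl] := hg (cexp z) (cexp_neq0 z).
    by rewrite rnorm_cexp (le_lt_trans _ rrho) // -ler_ln ?posrE ?expR_gt0 // expRK.
  by exists (l * cexp z); apply: (cder_comp (cder_cexp z) hl).
have := goursat ls (ltW twopi_gt0) dh; rewrite /rect_int.
have -> : (fun u => g (cexp (u +i* (2 * pi))%C)) = (fun u => g (cexp (u +i* 0)%C)).
  apply/funext => u; congr g; rewrite /cexp /cis /= cos0 sin0.
  have -> : 2 * pi = pi *+ 2 :> R by rewrite mulr_natl.
  by rewrite cos2pi sin2pi.
have E v : 0 < v -> (fun t => g (cexp (ln v +i* t)%C)) = (fun t => g (circ v t)).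
  by move=> v0; apply/funext => t; rewrite cexp_ln.
have aux (x y z : C) : x + y - x - z = y - z by ring.
rewrite (E s s0) (E r r0) aux => /eqP; rewrite subr_eq0 => /eqP.
have i0 : 'i%C != 0 :> C by rewrite eq_complex /= oner_eq0 andbF.
by move=> /(mulfI i0)/esym.
Qed.

(* The punctured version is what makes the coefficient formulas immediate: it
   applies to difference quotients without any removable singularity theorem. *)
Theorem mean_value rho g r : hol_off0 rho g -> cont0 g -> 0 < r < rho ->
  avg (fun t => g (circ r t)) = g 0.
Proof.
move=> hg cg /[dup] r0r /andP[r0 rr]; apply/eqP; rewrite -subr_eq0; apply/eqP.
apply: rnorm_le0 => e /cg[d d0 hd].
(* The circle is shrunk until [g] is within [e] of its value at the center. *)
pose s := Num.min r (d / 2).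
have s0 : 0 < s by rewrite lt_min r0 divr_gt0.
have sr : s <= r by rewrite ge_min lexx.
have sd : s < d.
  by apply: (@le_lt_trans _ _ (d / 2)); rewrite ?ge_min ?lexx ?orbT // ltr_pdivrMr // ltr_pMr // ltr1n.
have ss : 0 < s <= r by rewrite s0.
rewrite /avg -(cint_circ_const hg ss rr) -[cint _ _ _]/(cint 0 (2 * pi) (fun t => g (circ s t))) -/(avg _).
have c1 : cont (fun t => g (circ s t)) by apply: cont_off0 hg _; rewrite s0 (le_lt_trans sr).
have c2 : cont (fun _ : R => g 0) by move=> t tt; exact: cont_cst.
rewrite -[X in _ - X](avg_cst (g 0)) -(avgB c1 c2).
have c3 : cont (fun t => g (circ s t) - g 0).
  by move=> t tt; have := @continuousB C C R _ _ t (c1 t tt) (c2 t tt); apply.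
by apply: (avg_le c3) => t; apply: hd; rewrite rnorm_circ // ltW.
Qed.

Lemma hol_cont0 rho g : 0 < rho -> hol rho g -> cont0 g.
Proof.
move=> r0 hg; have [|l /cder_cont h e /h[d d0 hd]] := hg 0; first by rewrite rnorm0.
by exists d => // y /hd; rewrite add0r.
Qed.

Lemma mean_value_hol rho g r : hol rho g -> 0 < r < rho ->
  avg (fun t => g (circ r t)) = g 0.
Proof.
move=> hg /[dup] rr /andP[r0 r1]; apply: (@mean_value rho) => //.
  by move=> z _; exact: hg.
by apply: hol_cont0 hg; exact: lt_trans r1.
Qed.

Lemma hol_id rho : hol rho (fun z => z).
Proof. by move=> z _; exists 1; exact: cder_id. Qed.

Lemma holM rho f g : hol rho f -> hol rho g -> hol rho (fun z => f z * g z).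
Proof.
move=> hf hg z /[dup] /hf[l hl] /hg[m hm].
by eexists; apply: cderM hl hm.
Qed.

Lemma cont_cisC : cont (fun t : R => (cis t)^*%C).
Proof. by move=> t _; exact: (cont_conj (@cont_cis R t)). Qed.

Lemma avg_cisC : avg (fun t : R => (cis t)^*%C) = 0.
Proof.
rewrite avg_conj => [|t _]; last exact: cont_cis.
have h : 0 < (1 : R) < 2 by rewrite ltr01 ltr1n.
have := mean_value_hol (@hol_id 2) h.
have -> : (fun t => circ 1 t) = @cis R by apply/funext => t; rewrite /circ mul1r.
by move=> ->; rewrite rmorph0.
Qed.

Lemma avg_cisC2 : avg (fun t : R => (cis t)^*%C * (cis t)^*%C) = 0.
Proof.
have -> : (fun t => (cis t)^*%C * (cis t)^*%C) = (fun t => (cis t * cis t)^*%C) :> (R -> C).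
  by apply/funext => t; rewrite rmorphM.
rewrite avg_conj => [|t _]; last exact: (cont_mul (@cont_cis R t) (@cont_cis R t)).
have h : 0 < (1 : R) < 2 by rewrite ltr01 ltr1n.
have := mean_value_hol (holM (@hol_id 2) (@hol_id 2)) h.
have -> : (fun t => circ 1 t * circ 1 t) = (fun t => cis t * cis t) :> (R -> C).
  by apply/funext => t; rewrite /circ mul1r.
by move=> ->; rewrite mul0r rmorph0.
Qed.

(** In the applications [p] is the Taylor polynomial of [g] of degree [n - 1] at 0 and [k] the next
    coefficient. *)
Lemma hol_off0_quot rho g (p : C -> C) k n : hol rho g -> hol rho p ->
  hol_off0 rho (fun z => if z == 0 then k else (g z - p z) / z ^+ n).
Proof.
move=> hg hp z z0 zr; have [l hl] := hg z zr; have [m hm] := hp z zr.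
have [q hq] : exists q, cder (fun z => z ^+ n) z q.
  elim: n => [|n [q hq]]; first by exists 0; exact: cder_cst.
  eexists; have := cderM (cder_id z) hq.
  by apply: (@cder_near _ _ _ _ _ 1) => // h _; rewrite exprS.
have d := cderM (cderD hl (cderZ (-1) hm)) (cderV hq (expf_neq0 n z0)).
eexists; apply: (@cder_near R _ _ _ _ (rnorm z) _ _ d); first by rewrite rnorm_gt0.
move=> h hh; rewrite ifF ?mulN1r //; apply/negP => /eqP/eqP; rewrite addrC addr_eq0 => /eqP E.
by move: hh; rewrite E rnormN ltxx.
Qed.

Lemma circ_inv r t : 0 < r -> (circ r t)^-1 = (r^-1)%:C%C * (cis t)^*%C.
Proof. by move=> r0; rewrite /circ invfM cis_inv fmorphV. Qed.

Lemma circ_neq0 r t : 0 < r -> circ r t != 0.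
Proof. by move=> r0; rewrite -rnorm_eq0 rnorm_circ ?(ltW r0) // gt_eqF. Qed.

(** Mean value of the difference quotient, completed at 0 by the derivative. On the circle, division
    by [z] is multiplication by [conj(cis t) / r], and the constant [g 0] then averages to 0. *)
Lemma cauchy_coef1 rho g r l : hol rho g -> 0 < r < rho -> cder g 0 l ->
  avg (fun t => g (circ r t) * (cis t)^*%C) = l * r%:C%C.
Proof.
move=> hg /[dup] rr /andP[r0 r1] dg.
have hp : hol rho (fun=> g 0) by move=> z _; exists 0; exact: cder_cst.
pose k z := if z == 0 then l else (g z - g 0) / z ^+ 1.
have ck : cont0 k.
  move=> e /[dup] e0 /dg[d d0 hd]; exists d => // h /hd; rewrite /k eqxx expr1 add0r.
  have [->|h0] := eqVneq h 0; first by move=> _; rewrite subrr rnorm0 ltW.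
  move=> le; rewrite -(ler_pM2r (_ : 0 < rnorm h)) ?rnorm_gt0 // -rnormM mulrBl divfK //.
have := mean_value (hol_off0_quot l 1 hg hp) ck rr; rewrite /k eqxx => <-.
have c1 : cont (fun t => g (circ r t) * (cis t)^*%C).
  move=> t tt; apply: (cont_mul _ (cont_cisC tt)).
  by apply: (cont_hol hg _ tt); rewrite ltW.
have E : (fun t => if circ r t == 0 then l else (g (circ r t) - g 0) / circ r t ^+ 1) =
   (fun t => (r^-1)%:C%C * ((- g 0) * (cis t)^*%C + g (circ r t) * (cis t)^*%C)).
  apply/funext => t; rewrite (negbTE (circ_neq0 t r0)) expr1 circ_inv //; ring.
have c2 : cont (fun t => (- g 0) * (cis t)^*%C + g (circ r t) * (cis t)^*%C).
  move=> t tt; apply: cont_add (c1 t tt); exact: (cont_mul (@cont_cst R (- g 0) t) (cont_cisC tt)).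
rewrite E (avgZ _ c2) (avg_lin (- g 0) cont_cisC c1) avg_cisC mulr0 add0r mulrAC -rmorphM /=.
by rewrite mulVf ?gt_eqF // mul1r.
Qed.

(** The second order expansion at 0 is exactly what makes [(g z - g 0 - l z) / z^2] continuous there
    with value [m]; so [m] is a Taylor coefficient, half of a second derivative. *)
Lemma cauchy_coef2 rho g r l m : hol rho g -> 0 < r < rho ->
  (forall e, 0 < e -> exists2 d, 0 < d & forall h, rnorm h < d ->
     rnorm (g h - (g 0 + l * h) - m * h ^+ 2) <= e * rnorm h ^+ 2) ->
  avg (fun t => g (circ r t) * ((cis t)^*%C * (cis t)^*%C)) = m * (r%:C%C) ^+ 2.
Proof.
move=> hg /[dup] rr /andP[r0 r1] dg.
have hp : hol rho (fun z => g 0 + l * z).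
  move=> z _; eexists; exact: (cderD (cder_cst (g 0) z) (cderZ l (cder_id z))).
pose k z := if z == 0 then m else (g z - (g 0 + l * z)) / z ^+ 2.
have ck : cont0 k.
  move=> e /[dup] e0 /dg[d d0 hd]; exists d => // h /hd; rewrite /k eqxx.
  have [->|h0] := eqVneq h 0; first by move=> _; rewrite subrr rnorm0 ltW.
  move=> le; rewrite -(ler_pM2r (_ : 0 < rnorm h ^+ 2)) ?exprn_gt0 ?rnorm_gt0 //.
  by rewrite -rnormX -rnormM mulrBl divfK ?rnormX // expf_neq0.
have := mean_value (hol_off0_quot m 2 hg hp) ck rr; rewrite /k eqxx => <-.
have cc : cont (fun t : R => (cis t)^*%C * (cis t)^*%C).
  by move=> t tt; exact: (cont_mul (cont_cisC tt) (cont_cisC tt)).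
have c1 : cont (fun t => g (circ r t) * ((cis t)^*%C * (cis t)^*%C)).
  move=> t tt; apply: (cont_mul _ (cc t tt)).
  by apply: (cont_hol hg _ tt); rewrite ltW.
have E : (fun t => if circ r t == 0 then m else (g (circ r t) - (g 0 + l * circ r t)) / circ r t ^+ 2) =
   (fun t => (r^-1)%:C%C ^+ 2 * ((- g 0) * ((cis t)^*%C * (cis t)^*%C) +
      ((- (l * r%:C%C)) * (cis t)^*%C + g (circ r t) * ((cis t)^*%C * (cis t)^*%C)))).
  apply/funext => t; rewrite (negbTE (circ_neq0 t r0)) -exprVn circ_inv // {2}/circ.
  by have c := @cis_conj R t; ring: c.
have c2 : cont (fun t => (- (l * r%:C%C)) * (cis t)^*%C + g (circ r t) * ((cis t)^*%C * (cis t)^*%C)).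
  move=> t tt; apply: cont_add (c1 t tt); exact: (cont_mul (@cont_cst R _ t) (cont_cisC tt)).
have c3 : cont (fun t => (- g 0) * ((cis t)^*%C * (cis t)^*%C) +
      ((- (l * r%:C%C)) * (cis t)^*%C + g (circ r t) * ((cis t)^*%C * (cis t)^*%C))).
  move=> t tt; apply: cont_add (c2 t tt); exact: (cont_mul (@cont_cst R _ t) (cc t tt)).
rewrite E (avgZ _ c3) (avg_lin _ cc c2) (avg_lin _ cont_cisC c1) avg_cisC avg_cisC2.
rewrite !mulr0 !add0r mulrAC -exprMn -rmorphM /=.
by rewrite mulVf ?gt_eqF // expr1n mul1r.
Qed.

Lemma cauchy_estimate rho g l K : 0 < rho -> hol rho g -> cder g 0 l ->
  (forall z, rnorm z < rho -> rnorm (g z) <= K) -> rnorm l <= K / rho.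
Proof.
move=> rho0 hg dg gK.
have K0 : 0 <= K by apply: le_trans (gK 0 _); rewrite ?rnorm_ge0 ?rnorm0.
have H r : 0 < r < rho -> rnorm l * r <= K.
  move=> /[dup] rr /andP[r0 r1]; have E := cauchy_coef1 hg rr dg.
  have <- : rnorm (l * r%:C%C) = rnorm l * r by rewrite rnormM rnormR gtr0_norm.
  have c1 : cont (fun t => g (circ r t) * (cis t)^*%C).
    move=> t tt; apply: (cont_mul _ (cont_cisC tt)).
    by apply: (cont_hol hg _ tt); rewrite ltW.
  rewrite -E; apply: (avg_le c1) => t.
  by rewrite rnormM rnorm_conj rnorm_cis mulr1; apply: gK; rewrite rnorm_circ // ltW.
rewrite ler_pdivlMr //; apply/ler_addgt0Pr => e e0.
have n0 : 0 < rnorm l + 1 by rewrite ltr_wpDl ?rnorm_ge0.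
(* A radius below [rho] for which [|l| (rho - r)] is at most [e]. *)
pose r := Num.max (rho / 2) (rho - e / (rnorm l + 1)).
have r0 : 0 < r by rewrite lt_max divr_gt0.
have /H h : 0 < r < rho.
  by rewrite r0 gt_max gtrBl divr_gt0 // ltr_pdivrMr // ltr_pMr // ltr1n.
have h2 : rho - e / (rnorm l + 1) <= r by rewrite le_max lexx orbT.
have h3 : rnorm l * (e / (rnorm l + 1)) <= e.
  by rewrite mulrA ler_pdivrMr // mulrC ler_pM2l // lerDl.
have := rnorm_ge0 l => l0.
have : rnorm l * (rho - r) <= rnorm l * (e / (rnorm l + 1)) by apply: ler_wpM2l => //; lra.
lra.
Qed.

Lemma rnorm_moebius (a z : C) : rnorm z = 1 -> rnorm (z + a) = rnorm (1 + a^*%C * z).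
Proof.
move=> z1; have zz : z * z^*%C = 1 by rewrite mul_conj z1 expr1n.
have -> : 1 + a^*%C * z = z * (z + a)^*%C by rewrite rmorphD /= mulrDr zz [_ * a^*%C]mulrC.
by rewrite rnormM z1 mul1r rnorm_conj.
Qed.

(** The Moebius map [(z + a) / (1 + conj(a) z)] preserves the unit circle and sends 0 to [a], so
    [g a] is an average of values of [g] on the circle. *)
Theorem maximum_modulus (g : C -> C) (K : R) (a : C) :
  (forall z, exists l, cder g z l) -> (forall z, rnorm z = 1 -> rnorm (g z) <= K) ->
  rnorm a <= 1 -> rnorm (g a) <= K.
Proof.
move=> hg gK; rewrite le_eqVlt => /orP[/eqP/gK //|a1].
(* Chosen with [1 < rho] and [|a| rho < 1]: the denominator has no zero on a disc larger than the
   unit disc. *)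
pose rho := 2 / (1 + rnorm a).
have na0 := rnorm_ge0 a.
have p : 0 < 1 + rnorm a by rewrite ltr_wpDr.
have rho1 : 1 < rho by rewrite ltr_pdivlMr // mul1r; lra.
have den z : rnorm z < rho -> 1 + a^*%C * z != 0.
  move=> zr; apply/negP => /eqP E.
  have : rnorm (a^*%C * z) = 1.
    by rewrite -(rnorm1 R) -[RHS]rnormN; congr rnorm; apply/eqP; rewrite -addr_eq0 addrC E.
  rewrite rnormM rnorm_conj => E1.
  have h : rnorm a * rnorm z <= rnorm a * rho by rewrite ler_wpM2l // ltW.
  have : rnorm a * rho < 1 by rewrite /rho mulrA ltr_pdivrMr // mul1r; lra.
  lra.
pose k z := g ((z + a) / (1 + a^*%C * z)).
have hk : hol rho k.
  move=> z zr; have [l hl] := hg ((z + a) / (1 + a^*%C * z)).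
  have d1 := cderD (cder_id z) (cder_cst a z).
  have d2 := cderV (cderD (cder_cst 1 z) (cderZ a^*%C (cder_id z))) (den z zr).
  eexists; exact: (cder_comp (cderM d1 d2) hl).
have h1 : 0 < (1 : R) < rho by apply/andP; split; [exact: ltr01|exact: rho1].
have := mean_value_hol hk h1; rewrite {2}/k mulr0 add0r addr0 divr1 => <-.
have c1 : cont (fun t => k (circ 1 t)) by apply: (cont_hol hk); rewrite ler01 rho1.
apply: (avg_le c1) => t; rewrite /k; apply: gK.
have n1 : rnorm (circ 1 t) = 1 by rewrite rnorm_circ.
rewrite rnormM rnormV (rnorm_moebius _ n1) divff // rnorm_eq0; apply: den.
by rewrite n1.
Qed.

End MeanValue.

(** * Differentials of holomorphic maps of several variables *)

Section SeveralVariables.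
Variable R : realType.
Local Notation C := R[i].

(** A unimodular factor makes the increment real; the real part of the rotated function is then
    compared with [K t] on [[0, 1]]. *)
Lemma complex_mean_value_ineq (psi dpsi : C -> C) (K : R) :
  (forall t : R, 0 <= t <= 1 -> cder psi t%:C%C (dpsi t%:C%C)) ->
  (forall t : R, 0 <= t <= 1 -> rnorm (dpsi t%:C%C) <= K) ->
  rnorm (psi 1 - psi 0) <= K.
Proof.
move=> d dK; set D := psi 1 - psi 0.
have i0 : 0 <= (0 : R) <= 1 by rewrite lexx ler01.
have [->|D0] := eqVneq D 0.
  by rewrite rnorm0; apply: le_trans (dK 0 i0); rewrite rnorm_ge0.
pose k := D^*%C / (rnorm D)%:C%C.
have k1 : rnorm k = 1.
  by rewrite /k rnormM rnorm_conj rnormV rnormR ger0_norm ?rnorm_ge0 // divff // rnorm_eq0.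
have kD : k * D = (rnorm D)%:C%C.
  rewrite /k mulrAC [_ * D]mulrC mul_conj expr2 rmorphM /= mulfK //.
  by rewrite -(rmorph0 (real_complex R)) (inj_eq (@complexI R)) rnorm_eq0.
pose u (t : R) := Re (k * psi t%:C%C).
have du (t : R) : 0 <= t <= 1 -> is_derive t 1 u (Re (k * dpsi t%:C%C)).
  move=> /d dt; apply/real_deriveP => e /dt[r r0 hr]; exists r => // h hh.
  have := hr h%:C%C; rewrite rnormR => /(_ hh); apply: le_trans.
  rewrite /u -[in X in _ <= X](mul1r (rnorm _)) -k1 -rnormM.
  apply: le_trans (Re_rnorm _); rewrite le_eqVlt; apply/orP; left; apply/eqP; congr (`|_|).
  rewrite rmorphD /=; case: (k) => k1' k2; case: (psi _) => a1 a2; case: (psi _) => b1 b2.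
  by case: (dpsi _) => c1 c2 /=; ring.
have dK' (t : R) : 0 <= t <= 1 -> is_derive t 1 (K *: (id : R -> R)) K.
  by move=> _; apply: is_derive_eq; rewrite /GRing.scale /= mulr1.
have le (t : R) : 0 <= t <= 1 -> Re (k * dpsi t%:C%C) <= K.
  move=> /dK; apply: le_trans; apply: le_trans (Re_le_rnorm _) _.
  by rewrite rnormM k1 mul1r.
have := derive_le ler01 du dK' le; rewrite !fctE /GRing.scale /= mulr1 mulr0 subr0.
by apply: le_trans; rewrite /u -raddfB -mulrBr kD.
Qed.

Section Basics.
Variables V W : normedModType C.

Lemma diff_near_eq (f g : V -> W) x d : 0 < d ->
  (forall h, rnorm h < d -> g (x + h) = f (x + h)) -> differentiable f x ->
  differentiable g x /\ forall y, 'd g x y = 'd f x y.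
Proof.
move=> d0 E df; have hg : has_diff g x ('d f x).
  move=> e /(diff_has_diff df)[d1 d10 h1].
  exists (Num.min d d1); first by rewrite lt_min d0.
  move=> h; rewrite lt_min => /andP[h2 h3]; rewrite E //.
  have := E 0; rewrite rnorm0 addr0 => -> //; exact: h1.
have [dg Eg] := has_diff_diff (diff_continuous df) hg.
by split; [exact: dg|move=> y; exact: (congr1 (@^~ y) Eg)].
Qed.

Lemma bounded_linear_cont (L : {linear V -> W}) K :
  (forall h, rnorm (L h) <= K * rnorm h) -> continuous L.
Proof.
move=> LK x; apply/cont_rnorm => e e0.
have K0 : 0 < 1 + `|K| by rewrite ltr_pwDl.
exists (e / (1 + `|K|)); first by rewrite divr_gt0.
move=> h hh; rewrite linearD addrC addKr; apply: le_trans (LK h) _.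
apply: (@le_trans _ _ ((1 + `|K|) * rnorm h)).
  by rewrite ler_wpM2r ?rnorm_ge0 // (le_trans (ler_norm _)) // lerDr.
by rewrite mulrC -ler_pdivlMr // ltW.
Qed.

Lemma diff_bounded (f : V -> W) x : differentiable f x ->
  exists K, forall h, rnorm ('d f x h) <= K * rnorm h.
Proof.
move=> df; have [k k0 hk] := linear_lipschitz (diff_continuous df).
have [k' _ E] := gt0_complex k0.
by exists k' => h; rewrite -lecR rmorphM /= -!rnormE -E.
Qed.

End Basics.

Lemma cder_line (V : normedModType C) (f : V -> C) x y z :
  differentiable f (x + z *: y) ->
  cder (fun t => f (x + t *: y)) z ('d f (x + z *: y) y).
Proof.
move=> /diff_has_diff df e e0.
have n0 : 0 < 1 + rnorm y by rewrite ltr_wpDr ?rnorm_ge0.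
have [d d0 hd] := df _ (divr_gt0 e0 n0).
exists (d / (1 + rnorm y)); first by rewrite divr_gt0.
move=> h; rewrite ltr_pdivlMr // => hh.
have ny : rnorm (h *: y) <= rnorm h * (1 + rnorm y).
  by rewrite rnormZ ler_wpM2l ?rnorm_ge0 // lerDr.
have E1 : x + z *: y + h *: y = x + (z + h) *: y by rewrite -addrA -scalerDl.
have E2 : 'd f (x + z *: y) (h *: y) = 'd f (x + z *: y) y * h :=
  etrans (linearZ_LR _ h y) (mulrC _ _).
have := hd _ (le_lt_trans ny hh); rewrite E1 E2 => h1; apply: le_trans h1 _.
apply: le_trans (ler_wpM2l (ltW (divr_gt0 e0 n0)) ny) _.
by rewrite mulrCA (divfK (lt0r_neq0 n0)) mulrC.
Qed.

Section Local.
Variables (V : normedModType C) (f : V -> C) (x0 : V) (K delta : R).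
Hypothesis d0 : 0 < delta.
Hypothesis df : forall x, rnorm (x - x0) < 4 * delta -> differentiable f x.
Hypothesis fK : forall x, rnorm (x - x0) < 4 * delta -> rnorm (f x) <= K.

Let nD (x y : V) (r s : R) : rnorm (x - x0) < r -> rnorm y <= s -> rnorm (x + y - x0) < r + s.
Proof.
move=> h1 h2; rewrite addrAC; apply: le_lt_trans (rnormD _ _) _.
by rewrite ltr_leD.
Qed.

Let near_line (x h : V) (r s : R) (z : C) : rnorm (x - x0) < r -> 0 < rnorm h -> rnorm z < s / rnorm h ->
  rnorm (x + z *: h - x0) < r + s.
Proof.
move=> xr h0 zs; apply: nD => //; rewrite rnormZ -ler_pdivlMr //; exact: ltW.
Qed.

(** Cauchy's estimate on the complex line through [x] in direction [h], over a disc of radius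
    [delta / |h|]. It uses up one [delta] of the ball of radius [4 delta] on which [f] is bounded;
    the next two estimates each use up one more. *)
Lemma diff_cauchy x h : rnorm (x - x0) < 3 * delta ->
  rnorm ('d f x h) <= K / delta * rnorm h.
Proof.
move=> xd; have [->|h0] := eqVneq h 0; first by rewrite linear0 !rnorm0 mulr0.
rewrite -rnorm_gt0 in h0.
have dd (z : C) : rnorm z < delta / rnorm h -> rnorm (x + z *: h - x0) < 4 * delta.
  by move=> /(near_line xd h0) /lt_le_trans; apply; lra.
have hh : hol (delta / rnorm h) (fun z => f (x + z *: h)).
  by move=> z /dd zz; exists ('d f (x + z *: h) h); exact: cder_line (df zz).
have d00 := @cder_line V f x h 0; rewrite scale0r addr0 in d00.
have := cauchy_estimate (divr_gt0 d0 h0) hh (d00 (df _)) (fun z hz => fK (dd z hz)).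
rewrite invf_div mulrA mulrAC; apply; apply: lt_trans xd _.
by rewrite ltr_pM2r // ltr_nat.
Qed.

Lemma local_lipschitz x h : rnorm (x - x0) < 2 * delta -> rnorm h < delta ->
  rnorm (f (x + h) - f x) <= K / delta * rnorm h.
Proof.
move=> xd hd.
have dd (t : R) : 0 <= t <= 1 -> rnorm (x + t%:C%C *: h - x0) < 3 * delta.
  move=> /andP[t0 t1]; have : rnorm (t%:C%C *: h) <= delta.
    rewrite rnormZ rnormRp // -[delta]mul1r ler_pM ?rnorm_ge0 //; exact: ltW.
  by move=> /(nD xd) /lt_le_trans; apply; lra.
have := @complex_mean_value_ineq (fun t => f (x + t *: h)) (fun t => 'd f (x + t *: h) h)
  (K / delta * rnorm h).
rewrite scale1r scale0r addr0; apply=> t /dd td; last exact: diff_cauchy.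
by apply: cder_line; apply: df; apply: lt_trans td _; rewrite ltr_pM2r // ltr_nat.
Qed.

(** Cauchy's estimate for the difference [f (x + k + z h) - f (x + z h)], which is small by the
    Lipschitz bound for [f]. *)
Lemma diff_lipschitz x k h : rnorm (x - x0) < delta -> rnorm k < delta ->
  rnorm ('d f (x + k) h - 'd f x h) <= K / delta ^+ 2 * rnorm k * rnorm h.
Proof.
move=> xd kd; have [->|h0] := eqVneq h 0; first by rewrite (linear0 ('d f (x + k))) (linear0 ('d f x)) subrr !rnorm0 mulr0.
rewrite -rnorm_gt0 in h0.
have dd (z : C) : rnorm z < delta / rnorm h -> rnorm (x + z *: h - x0) < 2 * delta.
  by move=> /(near_line xd h0) /lt_le_trans; apply; lra.
have dk (z : C) : rnorm z < delta / rnorm h -> rnorm (x + k + z *: h - x0) < 4 * delta.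
  by move=> /dd h1; rewrite [x + k + _]addrAC; apply: lt_le_trans (nD h1 (ltW kd)) _; have := d0; lra.
have d4 (z : V) : rnorm z < 2 * delta -> rnorm z < 4 * delta.
  by move=> /lt_le_trans; apply; have := d0; lra.
have cd (z : C) : rnorm z < delta / rnorm h -> cder (fun z => f (x + k + z *: h) - f (x + z *: h)) z
    ('d f (x + k + z *: h) h - 'd f (x + z *: h) h).
  move=> zz; have c1 := cder_line (df (dk z zz)).
  have := cderD c1 (cderZ (-1) (cder_line (df (d4 _ (dd z zz))))).
  rewrite mulN1r; apply: (@cder_near _ _ _ _ _ 1) => // u _.
  by rewrite mulN1r.
have hh : hol (delta / rnorm h) (fun z => f (x + k + z *: h) - f (x + z *: h)).
  by move=> z /cd zz; eexists; exact: zz.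
have bd (z : C) : rnorm z < delta / rnorm h ->
    rnorm (f (x + k + z *: h) - f (x + z *: h)) <= K / delta * rnorm k.
  by move=> /dd h1; rewrite [x + k + _]addrAC; exact: local_lipschitz.
have z0 : rnorm (0 : C) < delta / rnorm h by rewrite rnorm0 divr_gt0.
have := cd 0 z0; rewrite scale0r !addr0 => c0.
have := cauchy_estimate (divr_gt0 d0 h0) hh c0 bd.
rewrite invf_div => h1; apply: le_trans h1 _.
rewrite le_eqVlt; apply/orP; left; apply/eqP; field; exact: lt0r_neq0.
Qed.

(** Mean value inequality for [f (x + t h) - t Df(x) h]. The constant does not depend on [x], which
    is what permits differentiation under a circle average. *)
Lemma taylor1_local x h : rnorm (x - x0) < delta -> rnorm h < delta ->
  rnorm (f (x + h) - f x - 'd f x h) <= K / delta ^+ 2 * rnorm h ^+ 2.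
Proof.
move=> xd hd.
have K0 : 0 <= K.
  by apply: le_trans (@fK x0 _); rewrite ?rnorm_ge0 // subrr rnorm0 mulr_gt0.
have tn (t : R) : 0 <= t <= 1 -> rnorm (t%:C%C *: h) <= rnorm h.
  by move=> /andP[t0 t1]; rewrite rnormZ rnormRp // ler_piMl ?rnorm_ge0.
have dd (t : R) : 0 <= t <= 1 -> rnorm (x + t%:C%C *: h - x0) < 4 * delta.
  move=> /tn/le_trans/(_ (ltW hd)) /(nD xd) /lt_le_trans; apply; have := d0; lra.
have := @complex_mean_value_ineq (fun t => f (x + t *: h) + (- 'd f x h) * t)
  (fun t => 'd f (x + t *: h) h - 'd f x h) (K / delta ^+ 2 * rnorm h ^+ 2).
rewrite scale1r scale0r addr0 mulr0 addr0 mulr1 addrAC; apply=> t ht.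
  have := cderD (cder_line (df (dd t ht))) (cderZ (- 'd f x h) (cder_id t%:C%C)).
  by rewrite mulr1.
have := diff_lipschitz h xd (le_lt_trans (tn t ht) hd) => h1; apply: le_trans h1 _.
rewrite expr2 mulrA; apply: ler_wpM2r; rewrite ?rnorm_ge0 //.
exact: (ler_wpM2l (divr_ge0 K0 (exprn_ge0 2 (ltW d0))) (tn t ht)).
Qed.

Variable y : V.

(** The factor 2 makes room for a disc of radius [2 r] on which [x0 + z y] stays within [delta] of
    [x0], so the circle of radius [r] lies well inside. *)
Let r := delta / (2 * (1 + rnorm y)).
Let p (t : R) := x0 + circ r t *: y.

Let ny : 0 < 2 * (1 + rnorm y).
Proof. by rewrite mulr_gt0 // ltr_wpDr ?rnorm_ge0. Qed.

Let r0 : 0 < r.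
Proof. by rewrite divr_gt0. Qed.

Let ry (z : C) : rnorm z < 2 * r -> rnorm (z *: y) < delta.
Proof.
have n1 : 0 < 1 + rnorm y by rewrite ltr_wpDr ?rnorm_ge0.
move=> zr; rewrite rnormZ; apply: (@le_lt_trans _ _ (rnorm z * (1 + rnorm y))).
  by rewrite ler_wpM2l ?rnorm_ge0 // lerDr.
rewrite -ltr_pdivlMr //; apply: lt_le_trans zr _; rewrite /r le_eqVlt; apply/orP; left.
by apply/eqP; field; exact: lt0r_neq0.
Qed.

Let rr : 0 < r < 2 * r.
Proof. by rewrite r0 ltr_pMl // ltr1n. Qed.

Let pd t : rnorm (p t - x0) < delta.
Proof.
rewrite /p addrAC subrr add0r; apply: ry.
by rewrite rnorm_circ ?(ltW r0) //; case/andP: rr.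
Qed.

Let df' x : rnorm (x - x0) < 2 * delta -> differentiable f x.
Proof. by move=> h; apply: df; apply: lt_trans h _; rewrite ltr_pM2r // ltr_nat. Qed.

Let hol_line x : rnorm (x - x0) < delta -> hol (2 * r) (fun z => f (x + z *: y)).
Proof.
move=> xd z /ry zy; exists ('d f (x + z *: y) y); apply: cder_line; apply: df'.
by have := nD xd (ltW zy); rewrite (_ : delta + delta = 2 * delta) //; ring.
Qed.

(** Cauchy's formula: the differential in direction [y] is an average of values of [f], so
    differentiating it in [x] involves only first derivatives of [f]. *)
Let diffE x : rnorm (x - x0) < delta ->
  'd f x y = (r^-1)%:C%C * avg (fun t => f (x + circ r t *: y) * (cis t)^*%C).
Proof.
move=> xd; have := @cder_line V f x y 0; rewrite scale0r addr0 => h.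
rewrite (cauchy_coef1 (hol_line xd) rr (h _)); last first.
  by apply: df'; apply: lt_trans xd _; rewrite ltr_pMl // ltr1n.
by rewrite mulrCA -rmorphM /= mulVf ?gt_eqF // mulr1.
Qed.

Local Notation cont phi := (cont_on 0 (2 * pi) phi).

Let cont_f x : rnorm (x - x0) < delta ->
  cont (fun t => f (x + circ r t *: y) * (cis t)^*%C).
Proof.
move=> xd t tt; apply: (cont_mul _ (cont_cisC tt)).
apply: (cont_hol (hol_line xd) _ tt); rewrite (ltW r0) /=; by case/andP: rr.
Qed.

Let cont_d h : cont (fun t => 'd f (p t) h * (cis t)^*%C).
Proof.
have K0 : 0 <= K.
  by apply: le_trans (@fK x0 _); rewrite ?rnorm_ge0 // subrr rnorm0 mulr_gt0.
move=> t tt; apply: (cont_mul _ (cont_cisC tt)).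
apply: (@cont_path R V (fun x => 'd f x h) p t).
  move=> e e0.
  have c0 : 0 < K / delta ^+ 2 * rnorm h + 1.
    by rewrite ltr_wpDl // mulr_ge0 ?rnorm_ge0 // (divr_ge0 K0 (exprn_ge0 2 (ltW d0))).
  exists (Num.min delta (e / (K / delta ^+ 2 * rnorm h + 1))); first by rewrite lt_min d0 divr_gt0.
  move=> k; rewrite lt_min => /andP[k1]; rewrite ltr_pdivlMr // => k2.
  apply: le_trans (diff_lipschitz h (pd t) k1) _; apply: ltW; apply: le_lt_trans k2.
  by rewrite mulrDr mulr1 mulrAC mulrC lerDl rnorm_ge0.
move=> e e0; have n1 : 0 < 1 + rnorm y by rewrite ltr_wpDr ?rnorm_ge0.
have /contRC/(_ _ (divr_gt0 e0 n1))[d dd0 hd] := @cont_circ R r t.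
exists d => // s /hd; rewrite ler_pdivlMr // => h1; apply: le_trans h1.
rewrite /p opprD addrACA subrr add0r -scalerBl rnormZ.
by rewrite ler_wpM2l ?rnorm_ge0 // lerDr.
Qed.

(** The candidate for the differential at [x0] of [Df(x) y] as a function of [x], obtained by
    differentiating Cauchy's formula under the integral sign. *)
Let L h := (r^-1)%:C%C * avg (fun t => 'd f (p t) h * (cis t)^*%C).

Let L_linear : linear L.
Proof.
move=> a h k; suff : L (a *: h + k) = a * L h + L k by [].
rewrite /L.
have -> : (fun t => 'd f (p t) (a *: h + k) * (cis t)^*%C) =
    (fun t => a * ('d f (p t) h * (cis t)^*%C) + 'd f (p t) k * (cis t)^*%C).
  by apply/funext => t; rewrite linearP /= mulrDl mulrA.
by rewrite (avg_lin a (@cont_d h) (@cont_d k)) mulrDr mulrCA.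
Qed.

Let LL : {linear V -> C} := HB.pack L (GRing.isLinear.Build _ _ _ _ L L_linear).

Let L_cont : continuous LL.
Proof.
apply: (@bounded_linear_cont _ _ LL (r^-1 * (K / delta))) => h.
rewrite -[LL h]/(L h) /L rnormM rnormRp ?invr_ge0 ?(ltW r0) // -mulrA ler_pM2l ?invr_gt0 //.
apply: (avg_le (@cont_d h)) => t; rewrite rnormM rnorm_conj rnorm_cis mulr1.
by apply: diff_cauchy; apply: lt_trans (pd t) _; rewrite ltr_pMl // ltr1n.
Qed.

(** The remainder is the average of the first order remainders of [f] at the points [p t], which
    [taylor1_local] bounds uniformly in [t]. *)
Let L_diff : has_diff (fun x => 'd f x y) x0 LL.
Proof.
have K0 : 0 <= K.
  by apply: le_trans (@fK x0 _); rewrite ?rnorm_ge0 // subrr rnorm0 mulr_gt0.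
have c0 : 0 < r^-1 * (K / delta ^+ 2) + 1.
  by rewrite ltr_wpDl // mulr_ge0 // ?invr_ge0 ?(ltW r0) // (divr_ge0 K0 (exprn_ge0 2 (ltW d0))).
move=> e e0; exists (Num.min delta (e / (r^-1 * (K / delta ^+ 2) + 1))).
  by rewrite lt_min d0 divr_gt0.
move=> h; rewrite lt_min => /andP[h1]; rewrite ltr_pdivlMr // => h2.
have x0d : rnorm (x0 - x0) < delta by rewrite subrr rnorm0.
have xhd : rnorm (x0 + h - x0) < delta by rewrite addrAC subrr add0r.
have c1 := cont_f x0d; have c2 := cont_f xhd; have c3 := @cont_d h.
rewrite (diffE x0d) (diffE xhd) -[LL h]/(L h) /L -mulrBr -mulrBr -(avgB c2 c1).
have c4 : cont (fun t => f (x0 + h + circ r t *: y) * (cis t)^*%C - f (x0 + circ r t *: y) * (cis t)^*%C).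
  by move=> t tt; have := @continuousB C C R _ _ t (c2 t tt) (c1 t tt); apply.
rewrite -(avgB c4 c3) rnormM rnormRp ?invr_ge0 ?(ltW r0) //.
have c5 : cont (fun t => f (x0 + h + circ r t *: y) * (cis t)^*%C - f (x0 + circ r t *: y) * (cis t)^*%C
    - 'd f (p t) h * (cis t)^*%C).
  by move=> t tt; have := @continuousB C C R _ _ t (c4 t tt) (c3 t tt); apply.
apply: (@le_trans _ _ (r^-1 * (K / delta ^+ 2 * rnorm h ^+ 2))).
  rewrite ler_pM2l ?invr_gt0 //; apply: (avg_le c5) => t.
  rewrite -!mulrBl rnormM rnorm_conj rnorm_cis mulr1 [x0 + h + _]addrAC.
  exact: (taylor1_local (pd t) h1).
rewrite expr2 !mulrA; apply: ler_wpM2r; first exact: rnorm_ge0.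
apply: ltW; apply: le_lt_trans h2.
rewrite [leRHS](_ : _ = r^-1 * K / delta ^+ 2 * rnorm h + rnorm h); last by ring.
by rewrite lerDl rnorm_ge0.
Qed.

Lemma diff_differentiable_local : differentiable (fun x => 'd f x y) x0 /\
  forall h, 'd (fun x => 'd f x y) x0 h =
    (r^-1)%:C%C * avg (fun t => 'd f (x0 + circ r t *: y) h * (cis t)^*%C).
Proof.
have [dd E] := has_diff_diff L_cont L_diff.
by split; [exact: dd|move=> h; exact: (congr1 (@^~ h) E)].
Qed.

(** The average that represents [D^2f(x0)(h, y)] is also Cauchy's coefficient formula for
    [Df(x0 + z y) h] as a function of [z], whose derivative at 0 is [D^2f(x0)(y, h)]. *)
Lemma diff_sym_local h :
  (forall x, rnorm (x - x0) < delta -> differentiable (fun x => 'd f x h) x) ->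
  'd (fun x => 'd f x y) x0 h = 'd (fun x => 'd f x h) x0 y.
Proof.
have aux (z : C) : (r^-1)%:C%C * (z * r%:C%C) = z.
  by rewrite mulrCA -rmorphM /= mulVf ?gt_eqF // mulr1.
move=> dh; have [_ E] := diff_differentiable_local; apply: etrans (E h) _.
have x0d : rnorm (x0 - x0) < delta by rewrite subrr rnorm0.
have hl : hol (2 * r) (fun z => 'd f (x0 + z *: y) h).
  move=> z zr; exists ('d (fun x => 'd f x h) (x0 + z *: y) y).
  apply: (@cder_line V (fun x => 'd f x h)); apply: dh.
  by rewrite addrAC subrr add0r ry.
have := @cder_line V (fun x => 'd f x h) x0 y 0; rewrite scale0r addr0 => /(_ (dh _ x0d)) c.
apply: etrans (congr1 ( *%R _) (cauchy_coef1 hl rr c)) _.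
exact: aux.
Qed.

End Local.
End SeveralVariables.

(** * Iterated differentials on open sets: existence, multilinearity, symmetry *)

Section Global.
Variable R : realType.
Local Notation C := R[i].

Definition is_open (V : normedModType C) (U : V -> Prop) :=
  forall x, U x -> exists2 d, 0 < d & forall h, rnorm h < d -> U (x + h).

(** Differentiability at the point gives continuity there, hence the local bound on which Cauchy's
    estimates rest. *)
Lemma locally_bounded (V : normedModType C) (U : V -> Prop) (f : V -> C) x :
  is_open U -> (forall x, U x -> differentiable f x) -> U x ->
  exists d K, [/\ 0 < d, forall y, rnorm (y - x) < 4 * d -> U y &
    forall y, rnorm (y - x) < 4 * d -> rnorm (f y) <= K].
Proof.
move=> oU df Ux; have [d1 d10 h1] := oU x Ux.
have [K hK] := diff_bounded (df x Ux).
have [d2 d20 h2] := has_diff_cont hK (diff_has_diff (df x Ux)) ltr01.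
pose d := Num.min d1 d2.
have d0 : 0 < d by rewrite lt_min d10.
exists (d / 4), (1 + rnorm (f x)); split; first by rewrite divr_gt0.
  move=> y; rewrite mulrC divfK // lt_min => /andP[/h1 + _].
  by rewrite addrC subrK.
move=> y; rewrite mulrC divfK // lt_min => /andP[_ /h2].
rewrite [x + _]addrC subrK => h3; rewrite -[f y](subrK (f x)).
by apply: le_trans (rnormD _ _) _; rewrite lerD2r.
Qed.

Lemma diff_differentiable (V : normedModType C) (U : V -> Prop) (f : V -> C) x y :
  is_open U -> (forall x, U x -> differentiable f x) -> U x ->
  differentiable (fun x => 'd f x y) x.
Proof.
move=> oU df Ux; have [d [K [d0 hU hK]]] := locally_bounded oU df Ux.
by have [] := @diff_differentiable_local R V f x K d d0 (fun y h => df y (hU y h)) hK y.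
Qed.

Lemma diff_sym (V : normedModType C) (U : V -> Prop) (f : V -> C) x y z :
  is_open U -> (forall x, U x -> differentiable f x) -> U x ->
  'd (fun x => 'd f x y) x z = 'd (fun x => 'd f x z) x y.
Proof.
move=> oU df Ux; have [d [K [d0 hU hK]]] := locally_bounded oU df Ux.
apply: (@diff_sym_local R V f x K d d0 (fun y h => df y (hU y h)) hK) => t ht.
apply: (diff_differentiable z oU df); apply: hU; apply: lt_trans ht _.
by rewrite ltr_pMl // ltr1n.
Qed.

Section Coordinates.
Variables (V : normedModType C) (n : nat).

Lemma diff_coord (f : V -> 'rV[C]_n) x k : differentiable f x ->
  differentiable (fun x => f x 0 k) x /\
  forall y, 'd (fun x => f x 0 k) x y = 'd f x y 0 k.
Proof.
move=> df; pose L y := 'd f x y 0 k.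
have L_lin : linear L.
  move=> a u v; rewrite /L.
  have -> : 'd f x (a *: u + v) = a *: 'd f x u + 'd f x v := linearP _ a u v.
  by rewrite mxE [X in X + _]mxE.
pose LL : {linear V -> C} := HB.pack L (GRing.isLinear.Build _ _ _ _ L L_lin).
have [K hK] := diff_bounded df.
have cL : continuous LL.
  apply: (@bounded_linear_cont _ _ _ LL K) => h.
  exact: le_trans (rnorm_coord ('d f x h) k) (hK h).
have hL : has_diff (fun x => f x 0 k) x LL.
  move=> e /(diff_has_diff df)[d d0 hd]; exists d => // h /hd; apply: le_trans.
  have := rnorm_coord (f (x + h) - f x - 'd f x h) k.
  by rewrite mxE [X in X + _]mxE [X in _ + X + _]mxE [X in _ + _ + X]mxE.
have [dd E] := has_diff_diff cL hL.
by split; [exact: dd|move=> y; exact: (congr1 (@^~ y) E)].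
Qed.

Lemma differentiable_coords (f : V -> 'rV[C]_n) x :
  (forall k, differentiable (fun x => f x 0 k) x) -> differentiable f x.
Proof.
move=> df; pose L y : 'rV[C]_n := \row_k 'd (fun x => f x 0 k) x y.
have L_lin : linear L.
  move=> a u v; apply/rowP => k; rewrite /L !mxE.
  exact: (linearP ('d (fun x => f x 0 k) x) a u v).
pose LL : {linear V -> 'rV[C]_n} := HB.pack L (GRing.isLinear.Build _ _ _ _ L L_lin).
have [K hK] := choice (fun k => diff_bounded (df k)).
have cL : continuous LL.
  apply: (@bounded_linear_cont _ _ _ LL (\sum_k `|K k|)) => h.
  apply/rnorm_rV_le; first by rewrite mulr_ge0 ?rnorm_ge0 // sumr_ge0.
  move=> k; rewrite -[LL h]/(L h) /L mxE; apply: le_trans (hK k h) _.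
  apply: ler_wpM2r; first exact: rnorm_ge0.
  apply: le_trans (ler_norm _) _.
  by rewrite (bigD1 k) //= lerDl sumr_ge0.
have hL : has_diff f x LL.
  move=> e e0.
  have : \forall h \near (0 : V), forall k, rnorm (f (x + h) 0 k - f x 0 k
      - 'd (fun x => f x 0 k) x h) <= e * rnorm h.
    apply: filter_forall => k; apply/near_rnorm.
    have [d d0 hd] := diff_has_diff (df k) e0.
    by exists d => // h /hd; rewrite add0r.
  move=> /near_rnorm[d d0 hd]; exists d => // h /hd; rewrite add0r => hh.
  apply/rnorm_rV_le; first by rewrite mulr_ge0 ?rnorm_ge0 // ltW.
  move=> k; have H := hh k; rewrite -[LL h]/(L h).
  have -> : (f (x + h) - f x - L h) 0 k =
      f (x + h) 0 k - f x 0 k - 'd (fun x => f x 0 k) x h by rewrite /L !mxE.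
  exact: H.
by have [] := has_diff_diff cL hL.
Qed.

Variables (U : V -> Prop) (f : V -> 'rV[C]_n).
Hypotheses (oU : is_open U) (df : forall x, U x -> differentiable f x).

Lemma diff_coord_near x y k : U x ->
  differentiable (fun x => 'd f x y 0 k) x /\
  forall z, 'd (fun x => 'd f x y 0 k) x z = 'd (fun x => 'd (fun x => f x 0 k) x y) x z.
Proof.
move=> Ux; have [d d0 hd] := oU Ux.
have dk t (Ut : U t) := (diff_coord k (df Ut)).1.
apply: (@diff_near_eq _ _ _ _ _ _ d d0); last exact: (diff_differentiable y oU dk Ux).
by move=> h /hd Uh; rewrite (diff_coord k (df Uh)).2.
Qed.

Lemma diff_differentiable_rV x y : U x -> differentiable (fun x => 'd f x y) x.
Proof.
by move=> Ux; apply: differentiable_coords => k; have [] := diff_coord_near y k Ux.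
Qed.

Lemma diff_sym_rV x y z : U x ->
  'd (fun x => 'd f x y) x z = 'd (fun x => 'd f x z) x y.
Proof.
move=> Ux; apply/rowP => k.
have dk t (Ut : U t) := (diff_coord k (df Ut)).1.
have H u v : 'd (fun x => 'd f x u) x v 0 k = 'd (fun x => 'd (fun x => f x 0 k) x u) x v.
  apply: etrans (esym ((diff_coord k (diff_differentiable_rV u Ux)).2 v)) _.
  exact: (diff_coord_near u k Ux).2.
exact: etrans (H y z) (etrans (diff_sym y z oU dk Ux) (esym (H z y))).
Qed.

End Coordinates.

Section IterDiff.
Variables (V : normedModType C) (n : nat) (U : V -> Prop) (f : V -> 'rV[C]_n).
Hypotheses (oU : is_open U) (df : forall x, U x -> differentiable f x).

Lemma iter_diff_differentiable ys x : U x -> differentiable (iter_diff f ys) x.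
Proof.
elim: ys x => [|y ys IH] x Ux; first exact: df.
exact: (diff_differentiable_rV oU IH y Ux).
Qed.

Lemma iter_diff_cons_lin (c : C) (b b' : V) (ys : seq V) x :
  iter_diff f ((c *: b + b') :: ys) x =
  c *: iter_diff f (b :: ys) x + iter_diff f (b' :: ys) x.
Proof. exact: (linearP ('d (iter_diff f ys) x) c b b'). Qed.

(** The outermost argument is linear because a differential is. For an inner one the identity holds
    at all points near [x] and is differentiated along the arguments in front of it. *)
Lemma iter_diff_lin (p : seq V) (c : C) (b b' : V) (ys : seq V) x : U x ->
  iter_diff f (p ++ (c *: b + b') :: ys) x =
  c *: iter_diff f (p ++ b :: ys) x + iter_diff f (p ++ b' :: ys) x.
Proof.
elim: p x => [|a p IH] x Ux; first exact: iter_diff_cons_lin.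
have [d d0 hd] := oU Ux.
pose F := iter_diff f (p ++ b :: ys); pose G := iter_diff f (p ++ b' :: ys).
have dF : differentiable F x := iter_diff_differentiable _ Ux.
have dG : differentiable G x := iter_diff_differentiable _ Ux.
have dZ : differentiable (c *: F) x := differentiableZ c dF.
have dS : differentiable (c *: F + G) x := differentiableD dZ dG.
have near h : rnorm h < d -> iter_diff f (p ++ (c *: b + b') :: ys) (x + h) = (c *: F + G) (x + h).
  by move=> /hd; exact: IH.
have [_ E] := diff_near_eq d0 near dS.
apply: etrans (E a) _.
apply: etrans (congr1 (@^~ a) (diffD dZ dG)) _.
by congr (_ + _); exact: (congr1 (@^~ a) (diffZ c dF)).
Qed.

Lemma iter_diffZ (p : seq V) (c : C) (b : V) (ys : seq V) x : U x ->
  iter_diff f (p ++ (c *: b) :: ys) x = c *: iter_diff f (p ++ b :: ys) x.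
Proof.
move=> Ux.
have E0 : iter_diff f (p ++ 0 :: ys) x = 0.
  have := iter_diff_lin p 1 0 0 ys Ux; rewrite scale1r scale1r addr0 => /eqP.
  by rewrite -subr_eq0 opprD addNKr oppr_eq0 => /eqP.
by have := iter_diff_lin p c b 0 ys Ux; rewrite addr0 E0 addr0.
Qed.

Lemma iter_diff_sum (p : seq V) m (c : 'I_m -> C) (b : 'I_m -> V) (ys : seq V) x : U x ->
  iter_diff f (p ++ (\sum_i c i *: b i) :: ys) x =
  \sum_i c i *: iter_diff f (p ++ b i :: ys) x.
Proof.
move=> Ux.
elim/big_rec2 : _ => [|i u v _ <-].
  by have := iter_diffZ p 0 0 ys Ux; rewrite !scale0r.
exact: iter_diff_lin.
Qed.

Lemma iter_diff_line ys x y z k : U (x + z *: y) ->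
  cder (fun t => iter_diff f ys (x + t *: y) 0 k) z (iter_diff f (y :: ys) (x + z *: y) 0 k).
Proof.
move=> Uz; have dd := iter_diff_differentiable ys Uz.
have [dk Ek] := diff_coord k dd.
have := @cder_line R V (fun x => iter_diff f ys x 0 k) x y z dk.
by rewrite (Ek y).
Qed.

Lemma iter_diff_swap x y z : U x ->
  iter_diff f [:: y; z] x = iter_diff f [:: z; y] x.
Proof. by move=> Ux; exact: (diff_sym_rV oU df z y Ux). Qed.

End IterDiff.
End Global.

(** * Holomorphic functions of one variable: algebraic operations and derivatives *)

Section HolomorphicClosure.
Variable R : realType.
Local Notation C := R[i].
Variable rho : R.
Local Notation hol := (@hol R rho).

Lemma hol_cst (k : C) : hol (fun=> k).
Proof. by move=> z _; exists 0; exact: cder_cst. Qed.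

Lemma holD (f g : C -> C) : hol f -> hol g -> hol (fun z => f z + g z).
Proof.
move=> hf hg z /[dup] /hf[l hl] /hg[m hm].
by eexists; apply: cderD hl hm.
Qed.

Lemma holV (f : C -> C) : (forall z, rnorm z < rho -> f z != 0) -> hol f ->
  hol (fun z => (f z)^-1).
Proof.
move=> f0 hf z /[dup] /f0 z0 /hf[l hl].
by eexists; apply: cderV hl z0.
Qed.

Lemma hol_sum I (r : seq I) (P : pred I) (F : I -> C -> C) :
  (forall i, hol (F i)) -> hol (fun z => \sum_(i <- r | P i) F i z).
Proof.
move=> hF; elim: r => [|i r IH].
  have -> : (fun z : C => \sum_(i <- [::] | P i) F i z) = fun=> 0.
    by apply/funext => z; rewrite big_nil.
  exact: hol_cst.
have -> : (fun z => \sum_(j <- i :: r | P j) F j z) =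
    (fun z => (if P i then F i z else 0) + \sum_(j <- r | P j) F j z).
  by apply/funext => z; rewrite big_cons; case: (P i) => //; rewrite add0r.
by apply: holD IH; case: (P i); [exact: hF|exact: hol_cst].
Qed.

Lemma hol_prod I (r : seq I) (P : pred I) (F : I -> C -> C) :
  (forall i, hol (F i)) -> hol (fun z => \prod_(i <- r | P i) F i z).
Proof.
move=> hF; elim: r => [|i r IH].
  have -> : (fun z : C => \prod_(i <- [::] | P i) F i z) = fun=> 1.
    by apply/funext => z; rewrite big_nil.
  exact: hol_cst.
have -> : (fun z => \prod_(j <- i :: r | P j) F j z) =
    (fun z => (if P i then F i z else 1) * \prod_(j <- r | P j) F j z).
  by apply/funext => z; rewrite big_cons; case: (P i) => //; rewrite mul1r.
by apply: holM IH; case: (P i); [exact: hF|exact: hol_cst].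
Qed.

Lemma hol_det n (A : C -> 'M[C]_n) : (forall i j, hol (fun z => A z i j)) ->
  hol (fun z => \det (A z)).
Proof.
move=> hA; rewrite /determinant; apply: hol_sum => s.
by apply: holM; [exact: hol_cst|apply: hol_prod => i; exact: hA].
Qed.

(** The cofactor formula. By definition [invmx] follows it only at invertible matrices, so it is
    applied on a small disc about each point that stays inside the given one. *)
Lemma hol_invmx n (A : C -> 'M[C]_n) i j :
  (forall z, rnorm z < rho -> A z \in unitmx) ->
  (forall i j, hol (fun z => A z i j)) -> hol (fun z => invmx (A z) i j).
Proof.
move=> uA hA.
have hd : hol (fun z => (\det (A z))^-1).
  apply: holV; last exact: hol_det.
  by move=> z /uA; rewrite unitmxE unitfE.
have hc : hol (fun z => \adj (A z) i j).
  have -> : (fun z => \adj (A z) i j) = (fun z => (-1) ^+ (j + i) * \det (row' j (col' i (A z)))).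
    by apply/funext => z; rewrite mxE.
  apply: holM; first exact: hol_cst.
  apply: hol_det => i' j'.
  have -> : (fun z => row' j (col' i (A z)) i' j') = (fun z => A z (lift j i') (lift i j')).
    by apply/funext => z; rewrite !mxE.
  exact: hA.
move=> z zr; have [l hl] := holM hd hc zr; exists l.
apply: (@cder_near R (fun z => (\det (A z))^-1 * \adj (A z) i j) _ z l (rho - rnorm z)) => //.
  by rewrite subr_gt0.
move=> h hh; rewrite /invmx uA; first by rewrite mxE.
by apply: le_lt_trans (rnormD _ _) _; rewrite addrC -ltrBrDr.
Qed.

(** This is [diff_differentiable] for the space [C] and the direction 1. *)
Lemma hol_deriv (q : C -> C) : hol q ->
  exists q1 : C -> C, (forall z, rnorm z < rho -> cder q z (q1 z)) /\ hol q1.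
Proof.
move=> hq; pose U (z : C) := rnorm z < rho.
have oU : is_open U.
  move=> z zr; exists (rho - rnorm z); first by rewrite subr_gt0.
  by move=> h hh; apply: le_lt_trans (rnormD _ _) _; rewrite addrC -ltrBrDr.
have dq z : U z -> differentiable q z by move=> /hq[l /cder_diff[]].
have line (g : C -> C) (dg : forall z, U z -> differentiable g z) z :
    U z -> cder g z ('d g z 1).
  move=> Uz; have := @cder_line R C g 0 1 z; rewrite add0r.
  have -> : z *: (1 : C) = z by exact: mulr1.
  move=> /(_ (dg z Uz)); apply: (@cder_near _ _ _ _ _ 1) => // h _.
  by congr g; rewrite add0r; apply: esym; exact: mulr1.
have dd z (Uz : U z) : differentiable (fun z => 'd q z 1) z :=
  @diff_differentiable R _ U q z 1 oU dq Uz.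
exists (fun z => 'd q z 1); split=> z Uz; first exact: (line q dq z Uz).
by exists ('d (fun z => 'd q z 1) z 1); exact: (line (fun z => 'd q z 1) dd z Uz).
Qed.

End HolomorphicClosure.

(** * Caratheodory's inequality for the first two coefficients *)

Section Caratheodory.
Variable R : realType.
Local Notation C := R[i].

(** Mean value inequality for [q (t h) - q1 0 h t - (m / 2) h^2 t^2] on [[0, 1]]. It turns a
    derivative of the derivative into the expansion that [cauchy_coef2] asks for. *)
Lemma taylor2 (q q1 : C -> C) rho m : 0 < rho ->
  (forall z, rnorm z < rho -> cder q z (q1 z)) -> cder q1 0 m ->
  forall e, 0 < e -> exists2 d, 0 < d & forall h, rnorm h < d ->
     rnorm (q h - (q 0 + q1 0 * h) - (m / 2) * h ^+ 2) <= e * rnorm h ^+ 2.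
Proof.
move=> rho0 dq dq1 e /[dup] /ltW e0 /dq1[d d0 hd].
exists (Num.min d rho); first by rewrite lt_min d0.
move=> h; rewrite lt_min => /andP[hh hr].
have tn (t : R) : 0 <= t <= 1 -> rnorm (t%:C%C * h) <= rnorm h.
  by move=> /andP[t0 t1]; rewrite rnormM rnormRp // ler_piMl ?rnorm_ge0.
have := @complex_mean_value_ineq R (fun t => q (t * h) + (- (q1 0 * h) * t + (- (m / 2 * h ^+ 2)) * (t * t)))
  (fun t => q1 (t * h) * h + (- (q1 0 * h) + (- (m / 2 * h ^+ 2)) * (t + t))) (e * rnorm h ^+ 2).
rewrite mul1r mul0r !mulr0 !addr0 !mulr1.
have -> : q h + (- (q1 0 * h) + - (m / 2 * h ^+ 2)) - q 0 =
  q h - (q 0 + q1 0 * h) - (m / 2) * h ^+ 2 by ring.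
apply=> t ht.
  have c1 := cderM (cder_id t%:C%C) (cder_cst h t%:C%C).
  rewrite mul1r mulr0 addr0 in c1.
  have c2 := cder_comp c1 (dq _ (le_lt_trans (tn t ht) hr)).
  have c3 := cderZ (- (q1 0 * h)) (cder_id t%:C%C).
  have c4 := cderZ (- (m / 2 * h ^+ 2)) (cderM (cder_id t%:C%C) (cder_id t%:C%C)).
  have := cderD c2 (cderD c3 c4).
  by rewrite mul1r !mulr1.
have -> : q1 (t%:C%C * h) * h + (- (q1 0 * h) + - (m / 2 * h ^+ 2) * (t%:C%C + t%:C%C)) =
   (q1 (0 + t%:C%C * h) - q1 0 - m * (t%:C%C * h)) * h by rewrite add0r; field.
rewrite rnormM [rnorm h ^+ 2]expr2 [leRHS]mulrA; apply: ler_wpM2r; first exact: rnorm_ge0.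
apply: le_trans (hd _ (le_lt_trans (tn t ht) hh)) _.
exact: (ler_wpM2l e0 (tn t ht)).
Qed.

Lemma limit_le (a K : R) : 0 <= a -> (forall r, 0 < r < 1 -> a * r ^+ 2 <= K) -> a <= K.
Proof.
move=> a0 h; apply/ler_addgt0Pr => e e0.
have p : 0 < 2 * (a + 1) by lra.
(* As [1 - (1 - u)^2 <= 2 u], the radius [1 - u] costs at most [e]. *)
pose u := Num.min (1 / 2) (e / (2 * (a + 1))).
have u0 : 0 < u by rewrite lt_min !divr_gt0.
have u1 : u <= 1 / 2 by rewrite ge_min lexx.
have u2 : u * (2 * (a + 1)) <= e by rewrite -ler_pdivlMr // ge_min lexx orbT.
have /h : 0 < 1 - u < 1 by lra.
have : 0 <= a * u ^+ 2 by rewrite mulr_ge0 // sqr_ge0.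
nra.
Qed.

Variables (q q1 : C -> C) (alpha : R) (m : C).
Hypothesis dq : forall z, rnorm z < 1 -> cder q z (q1 z).
Hypothesis dq1 : cder q1 0 m.
Hypothesis q0 : q 0 = 1.
Hypothesis Req : forall z, rnorm z < 1 -> alpha <= Re (q z).

Let hq : hol 1 q.
Proof. by move=> z /dq; eexists; eassumption. Qed.

Local Notation cont phi := (cont_on 0 (2 * pi) phi).

Let cont_q r : 0 < r < 1 -> cont (fun t => q (circ r t)).
Proof. by move=> /andP[r0 r1]; apply: (cont_hol hq); rewrite (ltW r0). Qed.

(** Since [mu] and [conj(q) mu] average to 0, the average of [q mu] equals that of
    [2 (Re q - alpha) mu]. The weight is nonnegative, so the modulus is at most the average of the
    weight, which is its value [2 (1 - alpha)] at the center. *)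
Let avg_q r (mu : R -> C) : 0 < r < 1 -> cont mu -> (forall t, rnorm (mu t) = 1) ->
  avg mu = 0 -> avg (fun t => q (circ r t) * (mu t)^*%C) = 0 ->
  rnorm (avg (fun t => q (circ r t) * mu t)) <= 2 * (1 - alpha).
Proof.
move=> rr cmu nmu amu aqmu.
have cq := cont_q rr.
have cqm : cont (fun t => q (circ r t) * mu t) by move=> t tt; exact: (cont_mul (cq t tt) (cmu t tt)).
have cqmc : cont (fun t => q (circ r t) * (mu t)^*%C).
  by move=> t tt; exact: (cont_mul (cq t tt) (cont_conj (cmu t tt))).
have cc : cont (fun t => (q (circ r t) * (mu t)^*%C)^*%C) by move=> t tt; exact: (cont_conj (cqmc t tt)).
have c1 : cont (fun t => (- (2 * alpha)%:C%C) * mu t + (q (circ r t) * (mu t)^*%C)^*%C).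
  by move=> t tt; exact: (cont_add (cont_mul (@cont_cst R _ t) (cmu t tt)) (cc t tt)).
have c2 : cont (fun t => 1 * ((- (2 * alpha)%:C%C) * mu t + (q (circ r t) * (mu t)^*%C)^*%C)
   + q (circ r t) * mu t).
  by move=> t tt; exact: (cont_add (cont_mul (@cont_cst R _ t) (c1 t tt)) (cqm t tt)).
have ccst : cont (fun _ : R => - (2 * alpha)%:C%C) by move=> t tt; exact: cont_cst.
have c3 : cont (fun t => 2%:C%C * q (circ r t) + - (2 * alpha)%:C%C).
  by move=> t tt; exact: (cont_add (cont_mul (@cont_cst R _ t) (cq t tt)) (ccst t tt)).
have E := avg_lin 1 c1 cqm.
rewrite (avg_lin _ cmu cc) amu mulr0 add0r (avg_conj cqmc) aqmu rmorph0 mulr0 add0r in E.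
rewrite -E.
have -> : 2 * (1 - alpha) = Re (avg (fun t => 2%:C%C * q (circ r t) + - (2 * alpha)%:C%C)).
  rewrite (avg_lin _ cq ccst) avg_cst (mean_value_hol hq rr) q0 /=; ring.
apply: (avg_le_Re c2 c3) => t.
have tr : rnorm (circ r t) < 1 by case/andP: rr => r0 r1; rewrite rnorm_circ // ltW.
have := Req tr; case: (q _) => u v /= uu.
have -> : 1 * (- (2 * alpha)%:C%C * mu t + ((u +i* v)%C * (mu t)^*%C)^*%C) + (u +i* v)%C * mu t =
  (2 * (u - alpha))%:C%C * mu t.
  by case: (mu t) => a b; apply/eqP; rewrite eq_complex /=; apply/andP; split; apply/eqP; ring.
rewrite rnormM nmu mulr1 rnormRp; first by rewrite le_eqVlt; apply/orP; left; apply/eqP; ring.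
by rewrite mulr_ge0 // subr_ge0.
Qed.

Let conj_nz n : hol 1 (fun z : C => q z * z ^+ n).
Proof.
apply: (holM hq); elim: n => [|n IH].
  by move=> z _; exists 0; exact: cder_cst.
have -> : (fun z : C => z ^+ n.+1) = (fun z => z * z ^+ n) by apply/funext => z; rewrite exprS.
exact: (holM (@hol_id R 1) IH).
Qed.

(** Supplies the vanishing average of [q conj(mu)] for [mu] a power of [conj(cis t)]: the function
    [q z^(n + 1)] is holomorphic and vanishes at 0. *)
Let avg_cis r n : 0 < r < 1 -> avg (fun t => q (circ r t) * cis t ^+ n.+1) = 0.
Proof.
move=> rr; have r0 : 0 < r by case/andP: rr.
have := mean_value_hol (@conj_nz n.+1) rr; rewrite expr0n mulr0 => E.
have -> : (fun t => q (circ r t) * cis t ^+ n.+1) =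
   (fun t => (r^-1)%:C%C ^+ n.+1 * (q (circ r t) * circ r t ^+ n.+1)).
  have E0 : (r^-1)%:C%C ^+ n.+1 * r%:C%C ^+ n.+1 = 1 :> C.
    by rewrite -exprMn -rmorphM /= mulVf ?gt_eqF // expr1n.
  apply/funext => t; set a := q _; rewrite /circ exprMn.
  move: E0; move: (_ ^+ n.+1) (_ ^+ n.+1) (_ ^+ n.+1) => S P c E0.
  by ring: E0.
rewrite avgZ ?E ?mulr0 //.
apply: (@cont_hol R 1 (fun z => q z * z ^+ n.+1) r (@conj_nz n.+1)).
by case/andP: rr => h1 h2; rewrite (ltW h1).
Qed.

Lemma caratheodory1 : rnorm (q1 0) <= 2 * (1 - alpha).
Proof.
have z1 : rnorm (0 : C) < 1 by rewrite rnorm0.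
have key r : 0 < r < 1 -> rnorm (q1 0) * r <= 2 * (1 - alpha).
  move=> /[dup] rr /andP[r0 r1].
  have := @avg_q r (fun t => (cis t)^*%C) rr (@cont_cisC R).
  rewrite (cauchy_coef1 hq rr (dq z1)) rnormM (rnormRp (ltW r0)); apply.
  - by move=> t; rewrite rnorm_conj rnorm_cis.
  - exact: avg_cisC.
  - rewrite -[RHS](@avg_cis r 0 rr); congr avg; apply/funext => t.
    by rewrite conjcK expr1.
apply: limit_le => [|r /[dup] /key h /andP[r0 r1]]; first exact: rnorm_ge0.
apply: le_trans h; apply: ler_wpM2l; first exact: rnorm_ge0.
by rewrite expr2 ger_pMr // ltW.
Qed.

Lemma caratheodory2 : rnorm (m / 2) <= 2 * (1 - alpha).
Proof.
apply: limit_le => [|r /[dup] rr /andP[r0 r1]]; first exact: rnorm_ge0.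
have := @avg_q r (fun t => (cis t)^*%C * (cis t)^*%C) rr.
have E : rnorm (m / 2 * r%:C%C ^+ 2) = rnorm (m / 2) * r ^+ 2.
  by rewrite [LHS]rnormM; congr (_ * _); rewrite [LHS]rnormX (rnormRp (ltW r0)).
rewrite (cauchy_coef2 hq rr (taylor2 ltr01 dq dq1)) E; apply.
- by move=> t tt; exact: (cont_mul (cont_cisC tt) (cont_cisC tt)).
- by move=> t; rewrite rnormM rnorm_conj rnorm_cis mulr1.
- exact: avg_cisC2.
- rewrite -[RHS](@avg_cis r 1 rr); congr avg; apply/funext => t.
  by congr (_ * _); rewrite rmorphM expr2; congr (_ * _); exact: conjcK.
Qed.

End Caratheodory.

(** * Polarization constants *)

Section Polarization.
Variable R : realType.
Local Notation C := R[i].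

Lemma cder_sum (I : Type) (r : seq I) (F : I -> C -> C) z (l : I -> C) :
  (forall i, cder (F i) z (l i)) ->
  cder (fun t => \sum_(i <- r) F i t) z (\sum_(i <- r) l i).
Proof.
move=> dF; elim: r => [|i r IH].
  have -> : (fun t : C => \sum_(i <- [::]) F i t) = fun=> 0.
    by apply/funext => t; rewrite big_nil.
  by rewrite big_nil; exact: cder_cst.
have -> : (fun t => \sum_(j <- i :: r) F j t) = (fun t => F i t + \sum_(j <- r) F j t).
  by apply/funext => t; rewrite big_cons.
by rewrite big_cons; exact: cderD.
Qed.

Lemma rnorm_moebius_le (b w : C) : rnorm b <= 1 -> rnorm w <= 1 ->
  rnorm (b + w) <= rnorm (1 + b^*%C * w).
Proof.
move=> b1 w1; rewrite -(@ler_pXn2r _ 2) ?nnegrE ?rnorm_ge0 // -subr_ge0.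
have -> : rnorm (1 + b^*%C * w) ^+ 2 - rnorm (b + w) ^+ 2 =
    (1 - rnorm b ^+ 2) * (1 - rnorm w ^+ 2).
  by rewrite !rnorm_sqr; case: b b1 => b1 b2 _; case: w w1 => w1 w2 _ /=; ring.
by apply: mulr_ge0; rewrite subr_ge0 expr_le1 // rnorm_ge0.
Qed.

Definition bil n (b : 'I_n -> 'I_n -> C) (x y : 'rV[C]_n) : C :=
  \sum_i \sum_j x 0 i * y 0 j * b i j.

(* Schwarz's lemma applied to the quadratic form along the analytic disc
   through [a z] in direction [(1 - a^2) y] whose coordinates are Moebius maps;
   [a = 1 / sqrt 3] maximizes [2 a (1 - a^2)]. *)
Theorem polarization n (b : 'I_n -> 'I_n -> C) (M : R) :
  (forall i j, b i j = b j i) ->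
  (forall x, rnorm x <= 1 -> rnorm (bil b x x) <= M) ->
  forall z y, rnorm z <= 1 -> rnorm y <= 1 -> rnorm (bil b z y) <= 3 / 4 * Num.sqrt 3 * M.
Proof.
move=> bs bM z y z1 y1.
pose s : R := Num.sqrt 3; have s0 : 0 < s by rewrite sqrtr_gt0.
have ss : s ^+ 2 = 3 by rewrite sqr_sqrtr.
pose a := s^-1; have a0 : 0 < a by rewrite invr_gt0.
have aa : a ^+ 2 = 1 / 3 by rewrite exprVn ss div1r.
have a1 : a < 1.
  by rewrite -(@ltr_pXn2r _ 2) ?nnegrE ?(ltW a0) // aa expr1n ltr_pdivrMr // mul1r ltr1n.
pose B j := a%:C%C * z 0 j.
have Ba j : rnorm (B j) <= a.
  rewrite /B rnormM (rnormRp (ltW a0)) ler_piMr ?(ltW a0) //.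
  exact: le_trans (rnorm_coord z j) z1.
have Bsq j : rnorm (B j) ^+ 2 <= 1 / 3.
  by rewrite -aa ler_pXn2r ?nnegrE ?rnorm_ge0 ?(ltW a0).
(* The derivative of [X j] at 0 is [c_j (1 - |B_j|^2)], and [k j] makes it [(2 / 3) y_j]. Here
   [2 / 3 = 1 - a^2] is the largest factor for which [|B_j| <= a] guarantees [k j <= 1]. *)
pose k j : R := (2 / 3) / (1 - rnorm (B j) ^+ 2).
have k0 j : 0 <= k j by rewrite divr_ge0 //; have := Bsq j; lra.
have k1 j : k j <= 1 by rewrite ler_pdivrMr; have := Bsq j; lra.
pose c j := (k j)%:C%C * y 0 j.
have c1 j : rnorm (c j) <= 1.
  rewrite /c rnormM (rnormRp (k0 j)) -[1]mulr1 ler_pM ?rnorm_ge0 ?k1 //.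
  exact: le_trans (rnorm_coord y j) y1.
have den j t : rnorm t < 1 -> 1 + (B j)^*%C * (c j * t) != 0.
  move=> t1; apply/negP => /eqP E.
  have : rnorm ((B j)^*%C * (c j * t)) = 1.
    by rewrite -(rnorm1 R) -[RHS]rnormN; congr rnorm; apply/eqP; rewrite -addr_eq0 addrC E.
  rewrite rnormM rnorm_conj (rnormM (c j) t) => E1.
  have h1 : rnorm (c j) * rnorm t <= 1 by rewrite -[1]mulr1 ler_pM ?rnorm_ge0 // ltW.
  have : rnorm (B j) * (rnorm (c j) * rnorm t) <= a * 1.
    by rewrite ler_pM ?rnorm_ge0 // mulr_ge0 ?rnorm_ge0.
  by rewrite E1 mulr1 leNgt a1.
pose X j t := (B j + c j * t) * (1 + (B j)^*%C * (c j * t))^-1.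
have dX j t : rnorm t < 1 -> cder (X j) t (c j * 1 * (1 + (B j)^*%C * (c j * t))^-1 +
    (B j + c j * t) * (- (1 + (B j)^*%C * (c j * t)) ^- 2 * (0 + (B j)^*%C * (c j * 1)))).
  move=> t1; have d1 := cderZ (c j) (cder_id t).
  have d2 := cderD (cder_cst (B j) t) d1; rewrite add0r in d2.
  exact: (cderM d2 (cderV (cderD (cder_cst 1 t) (cderZ (B j)^*%C d1)) (den j t t1))).
have z01 : rnorm (0 : C) < 1 by rewrite rnorm0.
have X0 j : X j 0 = a%:C%C * z 0 j by rewrite /X !mulr0 !addr0 invr1 mulr1.
have dX0 j : cder (X j) 0 ((2 / 3)%:C%C * y 0 j).
  have := dX j 0 z01; rewrite !mulr0 !addr0 add0r !mulr1 expr1n invr1 mulr1 mulN1r mulrN.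
  have -> // : c j - B j * ((B j)^*%C * c j) = (2 / 3)%:C%C * y 0 j.
  rewrite mulrA mul_conj -[X in X - _]mul1r -mulrBl /c mulrA; congr (_ * _).
  rewrite -(rmorph1 (real_complex R)) -rmorphB -rmorphM; congr (_%:C%C).
  by rewrite /k mulrC divfK // gt_eqF //; have := Bsq j; lra.
have X1 j t : rnorm t < 1 -> rnorm (X j t) <= 1.
  move=> t1; rewrite /X rnormM rnormV ler_pdivrMr ?rnorm_gt0 ?den // mul1r.
  apply: rnorm_moebius_le; first exact: le_trans (Ba j) (ltW a1).
  by rewrite rnormM -[1]mulr1 ler_pM ?rnorm_ge0 // ltW.
pose g t := \sum_i \sum_j X i t * X j t * b i j.
have hX j : hol 1 (X j) by move=> t /(dX j) d; eexists; exact: d.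
have hg : hol 1 g.
  apply: hol_sum => i; apply: hol_sum => j.
  by apply: holM; [apply: holM|exact: hol_cst].
have dg : cder g 0 (\sum_i \sum_j (((2 / 3)%:C%C * y 0 i * X j 0 + X i 0 * ((2 / 3)%:C%C * y 0 j)) * b i j
    + X i 0 * X j 0 * 0)).
  apply: cder_sum => i; apply: cder_sum => j.
  exact: (cderM (cderM (dX0 i) (dX0 j)) (cder_cst (b i j) 0)).
have gM t : rnorm t < 1 -> rnorm (g t) <= M.
  move=> t1; have := bM (\row_j X j t).
  have -> : bil b (\row_j X j t) (\row_j X j t) = g t.
    by apply: eq_bigr => i _; apply: eq_bigr => j _; rewrite !mxE.
  by apply; apply/rnorm_rV_le => // j; rewrite mxE; exact: X1.
have := cauchy_estimate ltr01 hg dg gM; rewrite divr1.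
(* By symmetry of [b] the product rule gives [2 a (1 - a^2)] times the bilinear value; the inverse
   of this number is [3 sqrt 3 / 4]. *)
have -> : \sum_i \sum_j (((2 / 3)%:C%C * y 0 i * X j 0 + X i 0 * ((2 / 3)%:C%C * y 0 j)) * b i j
    + X i 0 * X j 0 * 0) = (2 * (a * (2 / 3)))%:C%C * bil b z y.
  have E1 : \sum_i \sum_j ((a * (2 / 3))%:C%C * (z 0 j * y 0 i * b i j)) =
      (a * (2 / 3))%:C%C * bil b z y.
    rewrite exchange_big /= /bil mulr_sumr; apply: eq_bigr => i _.
    by rewrite mulr_sumr; apply: eq_bigr => j _; rewrite bs.
  have E2 : \sum_i \sum_j ((a * (2 / 3))%:C%C * (z 0 i * y 0 j * b i j)) =
      (a * (2 / 3))%:C%C * bil b z y.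
    rewrite /bil mulr_sumr; apply: eq_bigr => i _.
    by rewrite mulr_sumr.
  rewrite [in RHS](_ : (2 * (a * (2 / 3)))%:C%C = (a * (2 / 3))%:C%C + (a * (2 / 3))%:C%C); last first.
    by rewrite -rmorphD /=; congr (_%:C%C); ring.
  rewrite [RHS]mulrDl; apply: (etrans _ (congr2 +%R E1 E2)); rewrite -big_split.
  apply: eq_bigr => i _.
  rewrite -big_split; apply: eq_bigr => j _ /=.
  rewrite !X0 !rmorphM /=; ring.
have p : 0 < 2 * (a * (2 / 3)) by rewrite !mulr_gt0.
rewrite rnormM (rnormRp (ltW p)) => h.
have -> : 3 / 4 * Num.sqrt 3 * M = M / (2 * (a * (2 / 3))).
  by rewrite /a -/s; field; rewrite gt_eqF.
by rewrite ler_pdivlMr // mulrC.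
Qed.

Lemma affine_max (p q t : C) (K : R) : (forall u : C, rnorm u = 1 -> rnorm (p + q * u) <= K) ->
  rnorm t <= 1 -> rnorm (p + q * t) <= K.
Proof.
apply: (@maximum_modulus R (fun u => p + q * u)) => u; eexists.
exact: (cderD (cder_cst p u) (cderZ q (cder_id u))).
Qed.

(* On the torus, [z0 y0 = u0^2], [z1 y1 = u1^2] and [z0 y1 + z1 y0 = 2 s u0 u1]
   with [s] real in [-1, 1], so the bilinear value is a convex combination of
   the quadratic values at [(u0, u1)] and [(u0, - u1)]. *)
Lemma polarization_torus (a b c : C) (M : R) :
  (forall u v : C, rnorm u = 1 -> rnorm v = 1 ->
    rnorm (a * u ^+ 2 + 2 * b * u * v + c * v ^+ 2) <= M) ->
  forall z0 z1 y0 y1 : C, rnorm z0 = 1 -> rnorm z1 = 1 -> rnorm y0 = 1 -> rnorm y1 = 1 ->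
  rnorm (a * (z0 * y0) + b * (z0 * y1 + z1 * y0) + c * (z1 * y1)) <= M.
Proof.
move=> h z0 z1 y0 y1 nz0 nz1 ny0 ny1.
have root (w : C) : rnorm w = 1 -> exists2 u, u ^+ 2 = w & rnorm u = 1.
  move=> w1; exists (sqrtc w); first exact: sqr_sqrtc.
  by apply/eqP; rewrite -(@pexpr_eq1 _ _ 2) ?rnorm_ge0 // -rnormX sqr_sqrtc w1.
have [|u uE u1] := root (z0 * y0); first by rewrite rnormM nz0 ny0 mulr1.
have [|v vE v1] := root (z1 * y1); first by rewrite rnormM nz1 ny1 mulr1.
have u0 : u != 0 by rewrite -rnorm_eq0 u1 oner_eq0.
have v0 : v != 0 by rewrite -rnorm_eq0 v1 oner_eq0.
(* The product of [z0 y1] and [z1 y0] is [u^2 v^2], so their ratios to [u v] are inverse to each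
   other, hence conjugate because they are unimodular. *)
pose e := z0 * y1 / (u * v).
have ne : rnorm e = 1 by rewrite rnormM rnormV !rnormM nz0 ny1 u1 v1 mulr1 invr1 mulr1.
have e0 : e != 0 by rewrite -rnorm_eq0 ne oner_eq0.
have E1 : z0 * y1 = e * (u * v) by rewrite /e divfK // mulf_neq0.
have E2 : z1 * y0 = e^*%C * (u * v).
  apply: (mulfI (mulf_neq0 e0 (mulf_neq0 u0 v0))).
  rewrite -{1}E1.
  have ee : e * e^*%C = 1 by rewrite mul_conj ne expr1n.
  transitivity ((e * e^*%C) * (u ^+ 2 * v ^+ 2)); last by ring.
  by rewrite ee uE vE; ring.
pose s := Re e.
have es : e + e^*%C = (2 * s)%:C%C.
  by rewrite /s; case: (e) => x y; apply/eqP; rewrite eq_complex /=; apply/andP; split; apply/eqP; ring.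
have s1 : `|s| <= 1 by rewrite -ne; exact: Re_rnorm.
have := s1; rewrite ler_norml => /andP[sl su].
(* The weights have sum 1 and difference [s]; changing the sign of [v] affects only the cross
   term. *)
have -> : a * (z0 * y0) + b * (z0 * y1 + z1 * y0) + c * (z1 * y1) =
   ((1 + s) / 2)%:C%C * (a * u ^+ 2 + 2 * b * u * v + c * v ^+ 2) +
   ((1 - s) / 2)%:C%C * (a * u ^+ 2 + 2 * b * u * (- v) + c * (- v) ^+ 2).
  have c1 : ((1 + s) / 2)%:C%C + ((1 - s) / 2)%:C%C = 1 :> C.
    by rewrite -rmorphD /= -[RHS](rmorph1 (real_complex R)) /=; congr (_%:C%C); field.
  have c2 : ((1 + s) / 2)%:C%C - ((1 - s) / 2)%:C%C = s%:C%C :> C.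
    by rewrite -rmorphB /=; congr (_%:C%C); field.
  have c3 : (2 * s)%:C%C = 2 * s%:C%C :> C by rewrite rmorphM /= rmorph_nat.
  rewrite -uE -vE E1 E2 -mulrDl es c3 sqrrN.
  move: c1 c2; move: (((1 + s) / 2)%:C%C) (((1 - s) / 2)%:C%C) => p q c1 c2.
  rewrite -c2; have -> : q = 1 - p by rewrite -c1; ring.
  by ring.
apply: le_trans (rnormD _ _) _; rewrite !rnormM !rnormRp; try lra.
have h1 := h u v u1 v1.
have h2 : rnorm (a * u ^+ 2 + 2 * b * u * - v + c * (- v) ^+ 2) <= M.
  by apply: h => //; rewrite rnormN.
have : (1 + s) / 2 * rnorm (a * u ^+ 2 + 2 * b * u * v + c * v ^+ 2) <= (1 + s) / 2 * M.
  by apply: ler_wpM2l => //; lra.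
have : (1 - s) / 2 * rnorm (a * u ^+ 2 + 2 * b * u * - v + c * (- v) ^+ 2) <= (1 - s) / 2 * M.
  by apply: ler_wpM2l => //; lra.
lra.
Qed.

Lemma bil2E (b : 'I_2 -> 'I_2 -> C) x y : (forall i j, b i j = b j i) ->
  bil b x y = b 0 0 * (x 0 0 * y 0 0) + b 0 1 * (x 0 0 * y 0 1 + x 0 1 * y 0 0)
    + b 1 1 * (x 0 1 * y 0 1).
Proof.
move=> bs; rewrite /bil !big_ord_recl !big_ord0.
have -> : lift ord0 ord0 = 1 :> 'I_2 by apply/val_inj.
by rewrite -[ord0]/(0 : 'I_2) (bs 1 0); ring.
Qed.

(** The passage from the torus to the bidisc is made one coordinate at a time: the bilinear value is
    affine in each of the four coordinates, so [affine_max] applies. The factor 1 gives the bound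
    the shape [kappa * M] in which it is used for the upper bounds. *)
Theorem polarization2 (b : 'I_2 -> 'I_2 -> C) (M : R) :
  (forall i j, b i j = b j i) ->
  (forall x, rnorm x <= 1 -> rnorm (bil b x x) <= M) ->
  forall z y, rnorm z <= 1 -> rnorm y <= 1 -> rnorm (bil b z y) <= 1 * M.
Proof.
move=> bs bM z y z1 y1; rewrite mul1r bil2E //.
have cz j : rnorm (z 0 j) <= 1 := le_trans (rnorm_coord z j) z1.
have cy j : rnorm (y 0 j) <= 1 := le_trans (rnorm_coord y j) y1.
have h (u v : C) : rnorm u = 1 -> rnorm v = 1 ->
    rnorm (b 0 0 * u ^+ 2 + 2 * b 0 1 * u * v + b 1 1 * v ^+ 2) <= M.
  move=> u1 v1; pose x : 'rV[C]_2 := \row_j (if j == 0 then u else v).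
  have := bM x; rewrite bil2E // /x !mxE /=.
  have -> : b 0 0 * (u * u) + b 0 1 * (u * v + v * u) + b 1 1 * (v * v) =
    b 0 0 * u ^+ 2 + 2 * b 0 1 * u * v + b 1 1 * v ^+ 2 by ring.
  by apply; apply/rnorm_rV_le => // j; rewrite mxE; case: ifP; rewrite ?u1 ?v1.
have H0 := polarization_torus h.
have H1 (z0 z1' y0 y1' : C) : rnorm z0 <= 1 -> rnorm z1' = 1 -> rnorm y0 = 1 -> rnorm y1' = 1 ->
    rnorm (b 0 0 * (z0 * y0) + b 0 1 * (z0 * y1' + z1' * y0) + b 1 1 * (z1' * y1')) <= M.
  move=> n1 n2 n3 n4.
  have E t : b 0 0 * (t * y0) + b 0 1 * (t * y1' + z1' * y0) + b 1 1 * (z1' * y1') =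
     (b 0 1 * (z1' * y0) + b 1 1 * (z1' * y1')) + (b 0 0 * y0 + b 0 1 * y1') * t by ring.
  by rewrite E; apply: affine_max n1 => t t1; rewrite -E; exact: H0.
have H2 (z0 z1' y0 y1' : C) : rnorm z0 <= 1 -> rnorm z1' <= 1 -> rnorm y0 = 1 -> rnorm y1' = 1 ->
    rnorm (b 0 0 * (z0 * y0) + b 0 1 * (z0 * y1' + z1' * y0) + b 1 1 * (z1' * y1')) <= M.
  move=> n1 n2 n3 n4.
  have E t : b 0 0 * (z0 * y0) + b 0 1 * (z0 * y1' + t * y0) + b 1 1 * (t * y1') =
     (b 0 0 * (z0 * y0) + b 0 1 * (z0 * y1')) + (b 0 1 * y0 + b 1 1 * y1') * t by ring.
  by rewrite E; apply: affine_max n2 => t t1; rewrite -E; exact: H1.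
have H3 (z0 z1' y0 y1' : C) : rnorm z0 <= 1 -> rnorm z1' <= 1 -> rnorm y0 <= 1 -> rnorm y1' = 1 ->
    rnorm (b 0 0 * (z0 * y0) + b 0 1 * (z0 * y1' + z1' * y0) + b 1 1 * (z1' * y1')) <= M.
  move=> n1 n2 n3 n4.
  have E t : b 0 0 * (z0 * t) + b 0 1 * (z0 * y1' + z1' * t) + b 1 1 * (z1' * y1') =
     (b 0 1 * (z0 * y1') + b 1 1 * (z1' * y1')) + (b 0 0 * z0 + b 0 1 * z1') * t by ring.
  by rewrite E; apply: affine_max n3 => t t1; rewrite -E; exact: H2.
have E t : b 0 0 * (z 0 0 * y 0 0) + b 0 1 * (z 0 0 * t + z 0 1 * y 0 0) + b 1 1 * (z 0 1 * t) =
   (b 0 0 * (z 0 0 * y 0 0) + b 0 1 * (z 0 1 * y 0 0)) + (b 0 1 * z 0 0 + b 1 1 * z 0 1) * t by ring.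
by rewrite E; apply: (affine_max _ (cy 1)) => t t1; rewrite -E; exact: H3.
Qed.

End Polarization.

(** * The upper bounds *)

Section ThirdOrderBound.
Variable R : realType.
Local Notation C := R[i].
Variables (n : nat) (alpha : R) (f : 'rV[C]_n -> 'rV[C]_n).
Hypothesis alpha1 : alpha < 1.
Hypothesis qf : quasi_convex_B alpha f.

Let U (x : 'rV[C]_n) := rnorm x < 1.

Let oU : is_open U.
Proof.
move=> x xr; exists (1 - rnorm x); first by rewrite subr_gt0.
by move=> h hh; apply: le_lt_trans (rnormD _ _) _; rewrite addrC -ltrBrDr.
Qed.

Let df x : U x -> differentiable f x.
Proof. by move=> Ux; have [h _ _ _] := qf; exact: h. Qed.

Let U0 : U 0.
Proof. by rewrite /U rnorm0 ltr01. Qed.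

Let D ys := iter_diff f ys 0.

Let e (j : 'I_n) : 'rV[C]_n := delta_mx 0 j.

Lemma iter_diff_expand p ys x y k : U x ->
  iter_diff f (p ++ y :: ys) x 0 k = \sum_j y 0 j * iter_diff f (p ++ delta_mx 0 j :: ys) x 0 k.
Proof.
move=> Ux; rewrite {1}[y]row_sum_delta (iter_diff_sum oU df) // summxE.
by apply: eq_bigr => j _; rewrite mxE.
Qed.

Section Functional.
Variables (x : 'rV[C]_n) (k : 'I_n).
Hypothesis x0 : x != 0.
Hypothesis xk : rnorm (x 0 k) = rnorm x.

Let c : C := (x 0 k)^*%C / (rnorm x)%:C%C.
Let T (y : 'rV[C]_n) : C := c * y 0 k.

Let T_linear : linear_for *%R T.
Proof. by move=> a u v; rewrite /T !mxE mulrDr mulrCA. Qed.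

(** [T] selects a coordinate of maximal modulus and removes its phase. The condition defining
    [Q_B^alpha] is applied to these functionals alone when the upper bounds are proved. *)
Lemma coordinate_support : exists S : {scalar 'rV[C]_n},
  support_functional x S /\ forall y, S y = (x 0 k)^*%C / (rnorm x)%:C%C * y 0 k.
Proof.
pose S : {scalar 'rV[C]_n} := HB.pack T (GRing.isLinear.Build _ _ _ _ T T_linear).
have nx : rnorm x != 0 by rewrite rnorm_eq0.
have c1 : rnorm c = 1.
  by rewrite /c rnormM rnorm_conj rnormV rnormR ger0_norm ?rnorm_ge0 // xk divff.
exists S; split=> //; split; last first.
  rewrite rnormE -[S x]/(T x) /T /c mulrAC [_ * x 0 k]mulrC mul_conj xk expr2 rmorphM /=.
  by rewrite mulfK // -(rmorph0 (real_complex R)) (inj_eq (@complexI R)).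
have ub : ubound [set complex.Re `|S y| | y in [set y : 'rV[C]_n | rnorm y <= 1]]%classic 1.
  move=> _ [y y1 <-]; suff : rnorm (T y) <= 1 by [].
  by rewrite /T rnormM c1 mul1r; exact: le_trans (rnorm_coord y k) y1.
have mem : ([set complex.Re `|S y| | y in [set y : 'rV[C]_n | rnorm y <= 1]]%classic) 1.
  exists (e k).
    apply/rnorm_rV_le => // j; rewrite mxE eqxx /=.
    by case: (j == k); rewrite ?rnorm1 ?rnorm0.
  suff : rnorm (T (e k)) = 1 by [].
  by rewrite /T /e mxE !eqxx mulr1 c1.
apply/eqP; rewrite eq_le; apply/andP; split.
  by apply: ge_sup => //; exists 1.
by apply: ub_le_sup => //; exists 1.
Qed.

End Functional.

Section Direction.
Variables (z : 'rV[C]_n) (k : 'I_n).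
Hypothesis z1 : rnorm z = 1.
Hypothesis zk : rnorm (z 0 k) = 1.

(** Differentiating [G ys] in [t] puts [z] in front of [ys], so the Taylor coefficients along the
    disc [t z] are iterated differentials. *)
Let G ys (t : C) := iter_diff f ys (t *: z).

Let Uz (t : C) : rnorm t < 1 -> U (t *: z).
Proof. by rewrite /U rnormZ z1 mulr1. Qed.

Let dG ys (t : C) j : rnorm t < 1 ->
  cder (fun t => G ys t 0 j) t (G (z :: ys) t 0 j).
Proof.
move=> t1; have := @iter_diff_line R _ n U f oU df ys 0 z t j; rewrite add0r => /(_ (Uz t1)).
by apply: (@cder_near _ _ _ _ _ 1) => // h _; rewrite /G add0r.
Qed.

Let J t := 'J f (t *: z).

Let JE t i j : J t i j = G [:: e i] t 0 j.
Proof. by rewrite /J /jacobian mxE. Qed.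

Let uJ (t : C) : rnorm t < 1 -> J t \in unitmx.
Proof. by move=> t1; have [_ _ h _] := qf; apply: h; exact: Uz. Qed.

(** The vector in the quasi-convexity condition at [t z], with one factor [t] removed so that it is
    holomorphic across [t = 0], where its value is [z]. *)
Let v t := (t *: G [:: z; z] t + G [:: z] t) *m invmx (J t).

Let hG ys j : hol 1 (fun t => G ys t 0 j).
Proof. by move=> t /(dG ys j) h; eexists; exact: h. Qed.

Let hv j : hol 1 (fun t => v t 0 j).
Proof.
have -> : (fun t => v t 0 j) =
    (fun t => \sum_i (t * G [:: z; z] t 0 i + G [:: z] t 0 i) * invmx (J t) i j).
  by apply/funext => t; rewrite /v mxE; apply: eq_bigr => i _; rewrite !mxE.
apply: hol_sum => i; apply: holM.
  by apply: holD; [apply: holM; [exact: hol_id|exact: hG]|exact: hG].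
apply: hol_invmx => [t|a b]; first exact: uJ.
have -> : (fun t => J t a b) = (fun t => G [:: e a] t 0 b) by apply/funext => t; exact: JE.
exact: hG.
Qed.

Let vJ (t : C) j : rnorm t < 1 ->
  \sum_i v t 0 i * G [:: e i] t 0 j = t * G [:: z; z] t 0 j + G [:: z] t 0 j.
Proof.
move=> t1; transitivity ((v t *m J t) 0 j).
  by rewrite mxE; apply: eq_bigr => i _; rewrite JE.
by rewrite /v mulmxKV ?uJ // !mxE.
Qed.

Let G0 ys : G ys 0 = D ys.
Proof. by rewrite /G scale0r. Qed.

Let G1 j : G [:: e j] 0 = e j.
Proof.
have [_ [_ J0] _ _] := qf.
apply/rowP => i; rewrite -JE /J scale0r J0 !mxE eqxx /=.
by rewrite eq_sym.
Qed.

Let Dz : D [:: z] = z.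
Proof.
apply/rowP => j; transitivity (\sum_i z 0 i * e i 0 j).
  apply: etrans (@iter_diff_expand [::] [::] 0 z j U0) _; apply: eq_bigr => i _.
  congr (_ * _); exact: (congr1 (fun w : 'rV[C]_n => w 0 j) (etrans (esym (G0 [:: e i])) (G1 i))).
rewrite (bigD1 j) //= big1 => [|i ij]; first by rewrite mxE !eqxx addr0 mulr1.
by rewrite mxE eq_sym (negbTE ij) andbF mulr0.
Qed.

Let v0 : v 0 = z.
Proof.
have [_ [_ J0] _ _] := qf.
by rewrite /v scale0r add0r G0 Dz /J scale0r J0 invmx1 mulmx1.
Qed.

Let near_disc (g h : C -> C) (t l : C) : rnorm t < 1 ->
  (forall s : C, rnorm s < 1 -> g s = h s) -> cder h t l -> cder g t l.
Proof.
move=> t1 gh; apply: (@cder_near _ _ _ _ _ (1 - rnorm t)); first by rewrite subr_gt0.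
move=> s hs; apply: gh; apply: le_lt_trans (rnormD _ _) _.
by rewrite addrC -ltrBrDr.
Qed.

Lemma coefficients : exists (v1 : 'I_n -> C -> C) (v2 : 'I_n -> C),
  [/\ forall j (t : C), rnorm t < 1 -> cder (fun t => v t 0 j) t (v1 j t),
      forall j, cder (v1 j) 0 (v2 j),
      forall j, v1 j 0 = D [:: z; z] 0 j &
      forall j, v2 j / 2 = D [:: z; z; z] 0 j - D [:: z; D [:: z; z]] 0 j].
Proof.
have [v1 hv1] := choice (fun j => hol_deriv (@hv j)).
have dv j (t : C) (t1 : rnorm t < 1) := (hv1 j).1 t t1.
have z01 : rnorm (0 : C) < 1 by rewrite rnorm0.
have [v2 dv1] := choice (fun j => (hv1 j).2 0 z01).
have I1 (t : C) j : rnorm t < 1 ->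
    \sum_i (v1 i t * G [:: e i] t 0 j + v t 0 i * G [:: z; e i] t 0 j) =
    2 * G [:: z; z] t 0 j + t * G [:: z; z; z] t 0 j.
  move=> t1.
  have d1 : cder (fun t => \sum_i v t 0 i * G [:: e i] t 0 j) t
      (\sum_i (v1 i t * G [:: e i] t 0 j + v t 0 i * G [:: z; e i] t 0 j)).
    by apply: cder_sum => i; exact: (cderM (dv i t t1) (dG [:: e i] j t1)).
  have d2 := cderD (cderM (cder_id t) (dG [:: z; z] j t1)) (dG [:: z] j t1).
  have aux (A B : C) : 1 * A + t * B + A = 2 * A + t * B by ring.
  exact: etrans (cder_unique d1 (near_disc t1 (fun s => @vJ s j) d2)) (aux _ _).
have I2 j : \sum_i ((v2 i * G [:: e i] 0 0 j + v1 i 0 * G [:: z; e i] 0 0 j) +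
     (v1 i 0 * G [:: z; e i] 0 0 j + v 0 0 i * G [:: z; z; e i] 0 0 j)) =
    3 * G [:: z; z; z] 0 0 j.
  have d1 : cder (fun t => \sum_i (v1 i t * G [:: e i] t 0 j + v t 0 i * G [:: z; e i] t 0 j)) 0
      (\sum_i ((v2 i * G [:: e i] 0 0 j + v1 i 0 * G [:: z; e i] 0 0 j) +
     (v1 i 0 * G [:: z; e i] 0 0 j + v 0 0 i * G [:: z; z; e i] 0 0 j))).
    apply: cder_sum => i; apply: cderD.
      exact: (cderM (dv1 i) (dG [:: e i] j z01)).
    exact: (cderM (dv i 0 z01) (dG [:: z; e i] j z01)).
  have d2 := cderD (cderZ 2 (dG [:: z; z] j z01)) (cderM (cder_id 0) (dG [:: z; z; z] j z01)).
  have aux (A B : C) : 2 * A + (1 * A + 0 * B) = 3 * A by ring.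
  exact: etrans (cder_unique d1 (near_disc z01 (fun s => @I1 s j) d2)) (aux _ _).
have sum_e (w : 'I_n -> C) j : \sum_i w i * G [:: e i] 0 0 j = w j.
  rewrite (bigD1 j) //= big1 => [|i ij]; first by rewrite G1 mxE !eqxx mulr1 addr0.
  by rewrite G1 mxE eq_sym (negbTE ij) andbF mulr0.
have E1 j : v1 j 0 = D [:: z; z] 0 j.
  have := I1 0 j z01; rewrite mul0r addr0 big_split /= (sum_e (fun i => v1 i 0)).
  have -> : \sum_i v 0 0 i * G [:: z; e i] 0 0 j = D [:: z; z] 0 j.
    apply: esym; apply: etrans (@iter_diff_expand [:: z] [::] 0 z j U0) _.
    by apply: eq_bigr => i _; rewrite v0 G0.
  rewrite G0; move: (D [:: z; z] 0 j) => A h.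
  have -> : A = 2 * A - A by ring.
  by rewrite -h addrK.
exists v1, v2; split=> // j.
have S (p q r w : 'I_n -> C) : \sum_i (p i + q i + (r i + w i)) =
    \sum_i p i + \sum_i q i + (\sum_i r i + \sum_i w i) by rewrite !big_split.
have h0 := etrans (esym (S (fun i => v2 i * G [:: e i] 0 0 j) (fun i => v1 i 0 * G [:: z; e i] 0 0 j)
  (fun i => v1 i 0 * G [:: z; e i] 0 0 j) (fun i => v 0 0 i * G [:: z; z; e i] 0 0 j))) (I2 j).
have F2 : \sum_i v1 i 0 * G [:: z; e i] 0 0 j = D [:: z; D [:: z; z]] 0 j.
  apply: esym; apply: etrans (@iter_diff_expand [:: z] [::] 0 (D [:: z; z]) j U0) _.
  apply: eq_bigr => i _; apply: congr2; first exact: esym (E1 i).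
  exact: (congr1 (fun w : 'rV[C]_n => w 0 j) (esym (G0 [:: z; e i]))).
have F3 : \sum_i v 0 0 i * G [:: z; z; e i] 0 0 j = D [:: z; z; z] 0 j.
  apply: esym; apply: etrans (@iter_diff_expand [:: z; z] [::] 0 z j U0) _.
  apply: eq_bigr => i _; apply: congr2; first by rewrite v0.
  exact: (congr1 (fun w : 'rV[C]_n => w 0 j) (esym (G0 [:: z; z; e i]))).
have F4 : G [:: z; z; z] 0 0 j = D [:: z; z; z] 0 j := congr1 (fun w : 'rV[C]_n => w 0 j) (G0 [:: z; z; z]).
have aux (V A B : C) : V + B + (B + A) = 3 * A -> V / 2 = A - B.
  move=> h; have -> : V = (V + B + (B + A)) - A - 2 * B by ring.
  by rewrite h; field.
exact: (aux _ _ _ (etrans (esym (congr2 +%R (congr2 +%R (sum_e v2 j) F2) (congr2 +%R F2 F3)))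
  (etrans h0 (congr1 ( *%R 3) F4)))).
Qed.

(** For nonzero [t] the phases of [t] in the functional and in the vector cancel, leaving a factor
    [|t|] on both sides. At [t = 0] the value is [|z_k|^2 = 1]. *)
Lemma Re_quotient (t : C) : rnorm t < 1 -> alpha <= Re ((z 0 k)^*%C * v t 0 k).
Proof.
move=> t1; have [->|t0] := eqVneq t 0.
  by rewrite v0 mulrC mul_conj zk expr1n /= ltW.
have [_ _ _ h] := qf.
have nt : rnorm (t *: z) = rnorm t by rewrite rnormZ z1 mulr1.
have tz0 : t *: z != 0 by rewrite -rnorm_eq0 nt rnorm_eq0.
have tk : rnorm ((t *: z) 0 k) = rnorm (t *: z) by rewrite mxE rnormM zk mulr1 nt.
have [S [hS SE]] := coordinate_support tz0 tk.
have := h (t *: z) S (Uz t1) tz0 hS; rewrite SE nt.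
have -> : diffn 2 f (t *: z) (t *: z) + diffn 1 f (t *: z) (t *: z) =
    t *: (t *: G [:: z; z] t + G [:: z] t).
  have E2 : diffn 2 f (t *: z) (t *: z) = t *: (t *: G [:: z; z] t).
    apply: etrans (iter_diffZ oU df [::] t z [:: t *: z] (Uz t1)) _.
    by congr (_ *: _); exact: (iter_diffZ oU df [:: z] t z [::] (Uz t1)).
  have E1 : diffn 1 f (t *: z) (t *: z) = t *: G [:: z] t.
    exact: (iter_diffZ oU df [::] t z [::] (Uz t1)).
  by rewrite E2 E1 scalerDr.
rewrite -scalemxAl -/(J t) -/(v t).
have -> : (t *: v t) 0 k = t * v t 0 k by rewrite mxE.
have -> : (t *: z) 0 k = t * z 0 k by rewrite mxE.
have -> : (t * z 0 k)^*%C / (rnorm t)%:C%C * (t * v t 0 k) =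
    (rnorm t)%:C%C * ((z 0 k)^*%C * v t 0 k).
  have -> : (t * z 0 k)^*%C = t^*%C * (z 0 k)^*%C by rewrite rmorphM.
  transitivity ((t * t^*%C) / (rnorm t)%:C%C * ((z 0 k)^*%C * v t 0 k)); first by ring.
  rewrite mul_conj expr2 rmorphM /= mulfK //.
  by rewrite -(rmorph0 (real_complex R)) (inj_eq (@complexI R)) rnorm_eq0.
have Rr (a : R) (w : C) : Re (a%:C%C * w) = a * Re w by case: w => x y /=; ring.
by rewrite Rr mulrC ler_pM2l // rnorm_gt0.
Qed.

Lemma coefficient_bounds :
  rnorm (D [:: z; z] 0 k) <= 2 * (1 - alpha) /\
  rnorm (D [:: z; z; z] 0 k - D [:: z; D [:: z; z]] 0 k) <= 2 * (1 - alpha).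
Proof.
have [v1 [v2 [dv dv1 E1 E2]]] := coefficients.
pose w := (z 0 k)^*%C.
have w1 : rnorm w = 1 by rewrite rnorm_conj.
have dq (t : C) : rnorm t < 1 -> cder (fun t => w * v t 0 k) t (w * v1 k t).
  by move=> t1; exact: (cderZ w (dv k t t1)).
have dq1 := cderZ w (dv1 k).
have q0 : w * v 0 0 k = 1 by rewrite v0 mulrC mul_conj zk expr1n.
split.
  have := caratheodory1 dq q0 Re_quotient.
  by rewrite rnormM w1 mul1r E1.
have := caratheodory2 dq dq1 q0 Re_quotient.
by rewrite -mulrA rnormM w1 mul1r E2.
Qed.

End Direction.

Let bform k (i j : 'I_n) : C := D [:: e i; e j] 0 k.

Let D2E k x y : D [:: x; y] 0 k = bil (bform k) x y.
Proof.
apply: etrans (@iter_diff_expand [::] [:: y] 0 x k U0) _; apply: eq_bigr => i _.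
apply: etrans (congr1 ( *%R _) (@iter_diff_expand [:: e i] [::] 0 y k U0)) _.
by rewrite mulr_sumr; apply: eq_bigr => j _; rewrite mulrA.
Qed.

Let bform_sym k i j : bform k i j = bform k j i.
Proof. exact: (congr1 (fun w : 'rV[C]_n => w 0 k) (iter_diff_swap oU df (e i) (e j) U0)). Qed.

Let D3E k x : D [:: x; x; x] 0 k =
  \sum_i \sum_j \sum_l x 0 i * x 0 j * x 0 l * D [:: e i; e j; e l] 0 k.
Proof.
apply: etrans (@iter_diff_expand [::] [:: x; x] 0 x k U0) _; apply: eq_bigr => i _.
apply: etrans (congr1 ( *%R _) (@iter_diff_expand [:: e i] [:: x] 0 x k U0)) _.
rewrite mulr_sumr; apply: eq_bigr => j _.
apply: etrans (congr1 (fun w => x 0 i * (x 0 j * w)) (@iter_diff_expand [:: e i; e j] [::] 0 x k U0)) _.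
rewrite !mulr_sumr; apply: eq_bigr => l _.
by rewrite !mulrA.
Qed.

Let repl (z : 'rV[C]_n) k (t : C) : 'rV[C]_n := \row_j (if j == k then t else z 0 j).

Let repl_id z k : repl z k (z 0 k) = z.
Proof. by apply/rowP => j; rewrite mxE; case: eqP => // ->. Qed.

(** A unimodular [k]-th entry is of maximal modulus whatever the other entries in the closed disc
    are; at such points [coefficient_bounds] applies. *)
Let repl_norm z k (t : C) : rnorm z <= 1 -> rnorm t = 1 ->
  rnorm (repl z k t) = 1 /\ rnorm (repl z k t 0 k) = 1.
Proof.
move=> z1 t1; have E : repl z k t 0 k = t by rewrite mxE eqxx.
split; last by rewrite E.
apply/eqP; rewrite eq_le; apply/andP; split.
  apply/rnorm_rV_le => // j; rewrite mxE; case: ifP => _; first by rewrite t1.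
  exact: le_trans (rnorm_coord z j) z1.
by rewrite -t1 -{1}E; exact: rnorm_coord.
Qed.

Let hol_repl rho z k j : hol rho (fun t => repl z k t 0 j).
Proof.
have -> : (fun t => repl z k t 0 j) = (fun t => if j == k then t else z 0 j).
  by apply/funext => t; rewrite mxE.
by case: (j == k); [exact: hol_id|exact: hol_cst].
Qed.

Let entire (g : C -> C) : (forall rho, hol rho g) -> forall t, exists l, cder g t l.
Proof. by move=> h t; apply: (h (rnorm t + 1) t); rewrite ltrDl ltr01. Qed.

Let m := 2 * (1 - alpha).

Let m0 : 0 < m.
Proof. by rewrite mulr_gt0 // subr_gt0. Qed.

Lemma second_order_bound (z : 'rV[C]_n) k : rnorm z <= 1 -> rnorm (D [:: z; z] 0 k) <= m.
Proof.
move=> z1; rewrite -{1 2}(repl_id z k).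
apply: (@maximum_modulus R (fun t => D [:: repl z k t; repl z k t] 0 k)).
- apply: entire => rho.
  have -> : (fun t => D [:: repl z k t; repl z k t] 0 k) =
      (fun t => \sum_i \sum_j repl z k t 0 i * repl z k t 0 j * bform k i j).
    by apply/funext => t; rewrite D2E.
  apply: hol_sum => i; apply: hol_sum => j.
  by apply: holM; [apply: holM; exact: hol_repl|exact: hol_cst].
- move=> t t1; have [h1 h2] := repl_norm k z1 t1.
  exact: (coefficient_bounds h1 h2).1.
- exact: le_trans (rnorm_coord z k) z1.
Qed.

(** A polarization constant for the maximum norm, kept abstract so that one argument serves every
    dimension. *)
Variable kappa : R.
Hypothesis kappaP : forall (b : 'I_n -> 'I_n -> C) (M : R),
  (forall i j, b i j = b j i) ->
  (forall x : 'rV[C]_n, rnorm x <= 1 -> rnorm (bil b x x) <= M) ->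
  forall z y : 'rV[C]_n, rnorm z <= 1 -> rnorm y <= 1 -> rnorm (bil b z y) <= kappa * M.

(** One factor [m] scales [D^2f(0)(z^2)] into the unit ball; the other bounds the quadratic form
    that is polarized. *)
Lemma mixed_bound (z : 'rV[C]_n) k : rnorm z <= 1 -> rnorm (D [:: z; D [:: z; z]] 0 k) <= kappa * m * m.
Proof.
move=> z1; pose y := (m^-1)%:C%C *: D [:: z; z].
have y1 : rnorm y <= 1.
  rewrite rnormZ rnormRp ?invr_ge0 ?(ltW m0) // ler_pdivrMl // mulr1.
  by apply/rnorm_rV_le; [exact: ltW m0|move=> j; exact: second_order_bound].
have E : D [:: z; z] = m%:C%C *: y.
  by rewrite /y scalerA -rmorphM /= divff ?gt_eqF // scale1r.
have -> : D [:: z; D [:: z; z]] = m%:C%C *: D [:: z; y].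
  by rewrite {1}E; exact: (iter_diffZ oU df [:: z] m%:C%C y [::] U0).
rewrite mxE rnormM (rnormRp (ltW m0)) mulrC ler_pM2r // D2E.
apply: (kappaP (@bform_sym k) _ z1 y1).
by move=> x x1; rewrite -D2E; exact: second_order_bound.
Qed.

Lemma third_order_bound1 (z : 'rV[C]_n) k : rnorm z <= 1 ->
  rnorm (D [:: z; z; z] 0 k) <= m + kappa * m * m.
Proof.
move=> z1; rewrite -{1 2 3}(repl_id z k).
apply: (@maximum_modulus R (fun t => D [:: repl z k t; repl z k t; repl z k t] 0 k)).
- apply: entire => rho.
  have -> : (fun t => D [:: repl z k t; repl z k t; repl z k t] 0 k) =
      (fun t => \sum_i \sum_j \sum_l repl z k t 0 i * repl z k t 0 j * repl z k t 0 l
         * D [:: e i; e j; e l] 0 k).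
    by apply/funext => t; rewrite D3E.
  apply: hol_sum => i; apply: hol_sum => j; apply: hol_sum => l.
  apply: holM; last exact: hol_cst.
  by apply: holM; [apply: holM; exact: hol_repl|exact: hol_repl].
- move=> t t1; have [h1 h2] := repl_norm k z1 t1.
  have [_ h3] := coefficient_bounds h1 h2.
  have h4 : rnorm (repl z k t) <= 1 by rewrite h1.
  have h5 := mixed_bound k h4.
  set x := repl z k t in h3 h5 *.
  rewrite -(subrK (D [:: x; D [:: x; x]] 0 k) (D [:: x; x; x] 0 k)).
  by apply: le_trans (rnormD _ _) _; exact: lerD.
- exact: le_trans (rnorm_coord z k) z1.
Qed.

Theorem third_order_bound z :
  rnorm (diffn 3 f 0 z) <= (m + kappa * m * m) * rnorm z ^+ 3.
Proof.
have ex c x : D [:: c *: x; c *: x; c *: x] = c *: (c *: (c *: D [:: x; x; x])).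
  apply: etrans (iter_diffZ oU df [::] c x [:: c *: x; c *: x] U0) _; congr (_ *: _).
  apply: etrans (iter_diffZ oU df [:: x] c x [:: c *: x] U0) _; congr (_ *: _).
  exact: (iter_diffZ oU df [:: x; x] c x [::] U0).
rewrite -[diffn 3 f 0 z]/(D [:: z; z; z]).
have [->|z0] := eqVneq z 0.
  have := ex 0 0; rewrite !scale0r => ->.
  by rewrite !rnorm0 expr0n mulr0.
have nz : 0 < rnorm z by rewrite rnorm_gt0.
pose x := ((rnorm z)^-1)%:C%C *: z.
have x1 : rnorm x <= 1.
  by rewrite rnormZ rnormRp ?invr_ge0 ?(ltW nz) // mulVf ?gt_eqF.
have E : z = (rnorm z)%:C%C *: x.
  by rewrite /x scalerA -rmorphM /= divff ?gt_eqF // scale1r.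
(* Nonnegativity of the constant is read off the bound itself at some index; an index exists because
   [z] is nonzero. *)
have b0 : 0 <= m + kappa * m * m.
  case: (pickP (fun _ : 'I_n => true)) => [j _|no]; last first.
    by case/negP: z0; apply/eqP/rowP => j; have := no j.
  exact: le_trans (rnorm_ge0 _) (third_order_bound1 j x1).
have h : rnorm (D [:: x; x; x]) <= m + kappa * m * m.
  by apply/rnorm_rV_le => // j; exact: third_order_bound1.
have -> : D [:: z; z; z] = (rnorm z)%:C%C *: ((rnorm z)%:C%C *: ((rnorm z)%:C%C *: D [:: x; x; x])).
  by rewrite -ex -E.
rewrite !rnormZ (rnormRp (ltW nz)).
have -> : rnorm z * (rnorm z * (rnorm z * rnorm (D [:: x; x; x]))) =
  rnorm (D [:: x; x; x]) * rnorm z ^+ 3 by ring.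
by apply: ler_wpM2r h; rewrite exprn_ge0 // ltW.
Qed.

End ThirdOrderBound.

(** * The extremal map *)

Section Extremal.
Variable R : realType.
Local Notation C := R[i].

Lemma contCR (u : C -> R) w : {for w, continuous u} <->
  forall e, 0 < e -> exists2 d, 0 < d & forall h, rnorm h < d -> `|u (w + h) - u w| <= e.
Proof.
split=> [/cvgrPdist_le H e e0|H].
  have /near_rnorm[d d0 hd] := H e e0.
  by exists d => // h /hd; rewrite distrC.
apply/(@cvgrPdist_le R R C (nbhs w) (@nbhs_filter C w) u (u w)) => e e0.
have [d d0 hd] := H e e0.
by apply/near_rnorm; exists d => // h /hd; rewrite distrC.
Qed.

Lemma Re_gt0_neq0 (w : C) : 0 < Re w -> w != 0.
Proof. by move=> h; apply/negP => /eqP E; move: h; rewrite E ltxx. Qed.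

(** The principal branch on the right half-plane: [atan (Im w / Re w)] is the argument when
    [Re w > 0]. *)
Definition clog (w : C) : C := (ln (rnorm w) +i* atan (Im w / Re w))%C.

Lemma cexp_clog w : 0 < Re w -> cexp (clog w) = w.
Proof.
move=> h; have w0 := Re_gt0_neq0 h; have n0 : 0 < rnorm w by rewrite rnorm_gt0.
rewrite /cexp /clog /= lnK // /cis.
have sa (q : R) : sin (atan q) = q * cos (atan q).
  rewrite -[X in X * _](atanK q) /tan divfK // cos_atan invr_eq0 gt_eqF //.
  by rewrite sqrtr_gt0 ltr_pwDl // sqr_ge0.
rewrite sa cos_atan.
have -> : Num.sqrt (1 + (Im w / Re w) ^+ 2) = rnorm w / Re w.
  have p : 0 <= rnorm w / Re w by rewrite divr_ge0 ?(ltW h) ?rnorm_ge0.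
  rewrite -[RHS](ger0_norm p) -sqrtr_sqr !expr_div_n rnorm_sqr; congr Num.sqrt.
  by field; rewrite gt_eqF.
have [nz rz] : rnorm w != 0 /\ Re w != 0 by rewrite !gt_eqF.
by apply/eqP; rewrite eq_complex /=; apply/andP; split; apply/eqP; field; rewrite ?nz ?rz.
Qed.

Lemma clog_cont w : 0 < Re w -> forall e, 0 < e -> exists2 d, 0 < d &
  forall h, rnorm h < d -> rnorm (clog (w + h) - clog w) <= e.
Proof.
move=> h e e0; have n0 : 0 < rnorm w by rewrite rnorm_gt0 Re_gt0_neq0.
have e2 : 0 < e / 2 by rewrite divr_gt0.
have cn : {for w, continuous (fun w : C => rnorm w)}.
  apply/contCR => r r0; exists r => // k kr; rewrite ler_norml; apply/andP.
  by have := rnormB (w + k) k; rewrite addrK; have := rnormD w k; split; lra.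
have cR : {for w, continuous (fun w : C => Re w)}.
  apply/contCR => r r0; exists r => // k /ltW kr.
  by rewrite -raddfB addrC addKr; exact: le_trans (Re_rnorm k) kr.
have cI : {for w, continuous (fun w : C => Im w)}.
  apply/contCR => r r0; exists r => // k /ltW kr.
  by rewrite -raddfB addrC addKr; exact: le_trans (Im_rnorm k) kr.
have c1 : {for w, continuous (fun w : C => ln (rnorm w))}.
  by have := @continuous_comp C R R (fun w : C => rnorm w) (@ln R) w cn (continuous_ln n0); apply.
have cV : {for w, continuous (fun w : C => (Re w)^-1)}.
  by have := @cvgV R C _ _ (fun w : C => Re w) (Re w) (lt0r_neq0 h) cR; apply.
have cq : {for w, continuous (fun w : C => Im w / Re w)}.
  by have := @continuousM R C _ _ w cI cV; apply.
have c2 : {for w, continuous (fun w : C => atan (Im w / Re w))}.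
  by have := @continuous_comp C R R (fun w : C => Im w / Re w) (@atan R) w cq (@continuous_atan R _); apply.
have [d1 d10 h1] := (contCR _ _).1 c1 _ e2; have [d2 d20 h2] := (contCR _ _).1 c2 _ e2.
exists (Num.min d1 d2); first by rewrite lt_min d10.
move=> k; rewrite lt_min => /andP[/h1 k1 /h2 k2].
apply: le_trans (rnorm_ReIm _) _; rewrite raddfB raddfB /= (splitr e).
exact: lerD k1 k2.
Qed.

(** Derivative of an inverse function: with [l] the increment of [clog], the derivative of [cexp]
    gives [k = w l] up to [e' |l|], and continuity of [clog] makes [l] small enough for this to
    apply. *)
Lemma cder_clog w : 0 < Re w -> cder clog w w^-1.
Proof.
move=> h e e0; have w0 := Re_gt0_neq0 h; have n0 : 0 < rnorm w by rewrite rnorm_gt0.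
(* The first bound yields [|w| |l| <= 2 |k|]; the second then turns [e' |l|] into [e |w| |k|]. *)
pose e' := Num.min (rnorm w / 2) (e * rnorm w ^+ 2 / 2).
have e'0 : 0 < e' by rewrite lt_min !divr_gt0 // mulr_gt0 // exprn_gt0.
have e'1 : e' <= rnorm w / 2 by rewrite ge_min lexx.
have e'2 : e' <= e * rnorm w ^+ 2 / 2 by rewrite ge_min lexx orbT.
have [d d0 hd] := cder_cexp (clog w) e'0.
have d2 : 0 < d / 2 by rewrite divr_gt0.
have [r r0 hr] := clog_cont h d2.
exists (Num.min r (Re w)); first by rewrite lt_min r0.
move=> k; rewrite lt_min => /andP[/hr k1 k2].
have hk : 0 < Re (w + k).
  by rewrite raddfD /=; have := Re_rnorm k; rewrite ler_norml => /andP[? _]; lra.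
set l := clog (w + k) - clog w in k1 *.
have ld : rnorm l < d by apply: le_lt_trans k1 _; rewrite ltr_pdivrMr // ltr_pMr // ltr1n.
have := hd l ld; rewrite {1}/l [clog w + _]addrC subrK !cexp_clog // [w + k]addrC addrK => h1.
have h2 : rnorm w * rnorm l <= rnorm k + e' * rnorm l.
  have : rnorm (w * l) <= rnorm k + rnorm (k - w * l).
    by have := rnormB k (k - w * l); rewrite opprB addrC subrK.
  by rewrite rnormM; lra.
have nl := rnorm_ge0 l; have nk := rnorm_ge0 k.
have h3 : e' * rnorm l <= rnorm w / 2 * rnorm l by rewrite ler_wpM2r.
have h4 : rnorm w * rnorm l <= 2 * rnorm k by lra.
have -> : l - w^-1 * k = - (w^-1 * (k - w * l)) by field.
rewrite rnormN rnormM rnormV ler_pdivrMl //; apply: le_trans h1 _.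
apply: (@le_trans _ _ (e * rnorm w ^+ 2 / 2 * rnorm l)); first by rewrite ler_wpM2r.
have -> : e * rnorm w ^+ 2 / 2 * rnorm l = (e * rnorm w / 2) * (rnorm w * rnorm l) by ring.
have -> : rnorm w * (e * rnorm k) = (e * rnorm w / 2) * (2 * rnorm k) by field.
by apply: ler_wpM2l h4; rewrite divr_ge0 // mulr_ge0 // ltW.
Qed.

(* [F' = (1 - z)^(-beta)], so that [z F'' / F' = beta z / (1 - z)]. *)
Lemma extremal_function (beta : R) : exists F F1 F2 : C -> C,
  [/\ forall z, rnorm z < 1 -> cder F z (F1 z),
      forall z, rnorm z < 1 -> cder F1 z (F2 z),
      cder F2 0 (beta * (1 + beta))%:C%C,
      F 0 = 0 /\ F1 0 = 1 &
      forall z, rnorm z < 1 -> F1 z != 0 /\ (1 - z) * F2 z = beta%:C%C * F1 z].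
Proof.
have pos (z : C) : rnorm z < 1 -> 0 < Re (1 - z).
  move=> z1; rewrite raddfB /= subr_gt0; exact: le_lt_trans (Re_le_rnorm z) z1.
have nz (z : C) : rnorm z < 1 -> 1 - z != 0 by move=> /pos; exact: Re_gt0_neq0.
pose L z := clog (1 - z).
have d1 z : cder (fun z : C => 1 - z) z (-1).
  have := cderD (cder_cst 1 z) (cderZ (-1) (cder_id z)); rewrite add0r mulr1.
  by apply: (@cder_near R _ _ _ _ 1) => // h _; rewrite mulN1r.
have dL z : rnorm z < 1 -> cder L z (- (1 - z)^-1).
  by move=> z1; have := cder_comp (d1 z) (cder_clog (pos z z1)); rewrite mulrN1.
have dE (g z : C) : rnorm z < 1 -> cder (fun z => cexp (g * L z)) z
    (cexp (g * L z) * (g * - (1 - z)^-1)).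
  by move=> z1; exact: (cder_comp (cderZ g (dL z z1)) (cder_cexp _)).
have EL z : rnorm z < 1 -> cexp (L z) = 1 - z by move=> /pos/cexp_clog.
have z0 : rnorm (0 : C) < 1 by rewrite rnorm0.
have L0 : L 0 = 0.
  rewrite /L subr0 /clog rnorm1 ln1 /= mul0r atan0; by [].
pose b : C := beta%:C%C.
pose F1 z := cexp (- b * L z); pose F2 z := b * ((1 - z)^-1 * F1 z).
have dF1 z : rnorm z < 1 -> cder F1 z (F2 z).
  move=> z1; have := dE (- b) z z1.
  by rewrite (_ : cexp (- b * L z) * (- b * - (1 - z)^-1) = F2 z) // /F2 /F1; ring.
have F10 : F1 0 = 1 by rewrite /F1 L0 mulr0 cexp0.
have dF2 : cder F2 0 (beta * (1 + beta))%:C%C.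
  have := cderZ b (cderM (cderV (d1 0) (nz 0 z0)) (dF1 0 z0)).
  have -> // : b * (- (1 - 0) ^- 2 * -1 * F1 0 + (1 - 0)^-1 * F2 0) = (beta * (1 + beta))%:C%C.
  rewrite /F2 F10 subr0 expr1n invr1 rmorphM rmorphD /= -/b -[1%:C%C]/(1 : C); ring.
have dF : exists F : C -> C, (forall z, rnorm z < 1 -> cder F z (F1 z)) /\ F 0 = 0.
  (* A primitive of [(1 - z)^(-beta)] vanishing at 0 is [- log (1 - z)] for [beta = 1] and
     [(1 - (1 - z)^(1 - beta)) / (1 - beta)] otherwise. *)
  have [b1|b1] := eqVneq b 1.
    exists (fun z => -1 * L z); split; last by rewrite L0 mulr0.
    move=> z z1; have := cderZ (-1) (dL z z1).
    rewrite (_ : -1 * - (1 - z)^-1 = F1 z) //.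
    have -> : -1 * - (1 - z)^-1 = (1 - z)^-1 by ring.
    have -> : F1 z = cexp (- L z) by rewrite /F1 b1 mulN1r.
    apply: (mulfI (nz z z1)); rewrite divff ?nz // -[X in _ = X * _](EL z z1) -cexpD subrr.
    by rewrite cexp0.
  have g0 : 1 - b != 0 by rewrite subr_eq0 eq_sym.
  exists (fun z => (1 - b)^-1 * (1 + -1 * cexp ((1 - b) * L z))).
  split; last by rewrite L0 mulr0 cexp0 mulr1 subrr mulr0.
  move=> z z1.
  have := cderZ (1 - b)^-1 (cderD (cder_cst 1 z) (cderZ (-1) (dE (1 - b) z z1))).
  rewrite (_ : (1 - b)^-1 * _ = F1 z) //.
  have -> : cexp ((1 - b) * L z) = (1 - z) * F1 z.
    by rewrite -(EL z z1) /F1 -cexpD; congr cexp; ring.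
  by field; rewrite g0 nz.
have [F [dF0 F0]] := dF.
exists F, F1, F2; split=> // z z1; split; first exact: cexp_neq0.
by rewrite /F2; field; exact: nz.
Qed.

(** The function [t / (1 - t)] maps the disc into the half-plane of real part at least [-1/2]: after
    clearing denominators this is [|t|^2 <= 1]. *)
Lemma Re_halfplane (beta : R) (t : C) : 0 <= beta -> rnorm t < 1 ->
  1 - beta / 2 <= Re (1 + beta%:C%C * (t / (1 - t))).
Proof.
move=> b0 t1.
have p : 0 < Re (1 - t) by rewrite raddfB /= subr_gt0; exact: le_lt_trans (Re_le_rnorm t) t1.
have q : 0 < rnorm (1 - t) ^+ 2 by rewrite exprn_gt0 // rnorm_gt0 Re_gt0_neq0.
have t2 : rnorm t ^+ 2 <= 1 by rewrite expr_le1 ?rnorm_ge0 // ltW.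
suff h : - (1 / 2) <= Re (t / (1 - t)).
  have -> : Re (1 + beta%:C%C * (t / (1 - t))) = 1 + beta * Re (t / (1 - t)).
    by case: (t / (1 - t)) => x y /=; ring.
  have := ler_wpM2l b0 h; lra.
have -> : Re (t / (1 - t)) = (Re t - rnorm t ^+ 2) / rnorm (1 - t) ^+ 2.
  have -> : t / (1 - t) = (t * (1 - t)^*%C) * ((rnorm (1 - t) ^+ 2)^-1)%:C%C.
    rewrite fmorphV /= -mul_conj invfM; move: (Re_gt0_neq0 p).
    have cz : (1 - t)^*%C = 0 -> 1 - t = 0 by move=> /eqP; rewrite conjc_eq0 => /eqP.
    move=> n; have n' : (1 - t)^*%C != 0 by apply/negP => /eqP/cz/eqP; rewrite (negbTE n).
    by rewrite mulrACA divff // mulr1.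
  rewrite [in LHS]mulrC rnorm_sqr; case: (t) => x y /=; rewrite rnorm_sqr /=; ring.
rewrite ler_pdivlMr // rnorm_sqr; move: t2; rewrite rnorm_sqr.
by case: (t) => x y /=; nra.
Qed.

Lemma forall_delta (V : normedModType C) n (P : 'I_n -> V -> Prop) :
  (forall j, exists2 d, 0 < d & forall h, rnorm h < d -> P j h) ->
  exists2 d, 0 < d & forall h, rnorm h < d -> forall j, P j h.
Proof.
move=> H; have : \forall h \near (0 : V), forall j, P j h.
  apply: filter_forall => j; apply/near_rnorm; have [d d0 hd] := H j.
  by exists d => // h /hd; rewrite add0r.
by move=> /near_rnorm[d d0 hd]; exists d => // h /hd; rewrite add0r.
Qed.

(** The formula for [g] is asked only near [x], so that the lemma can be iterated: the differential
    of a diagonal map is again diagonal, by a formula established only inside the polydisk. *)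
Lemma diag_diff n (g : 'rV[C]_n -> 'rV[C]_n) (G : 'I_n -> C -> C) (l : 'I_n -> C) x d :
  0 < d -> (forall h, rnorm h < d -> forall j, g (x + h) 0 j = G j ((x + h) 0 j)) ->
  (forall j, cder (G j) (x 0 j) (l j)) ->
  differentiable g x /\ forall y, 'd g x y = \row_j (l j * y 0 j).
Proof.
move=> d0 gG dG; pose L (y : 'rV[C]_n) : 'rV[C]_n := \row_j (l j * y 0 j).
have L_lin : linear L.
  by move=> a u v; apply/rowP => j; rewrite /L !mxE; ring.
pose LL : {linear 'rV[C]_n -> 'rV[C]_n} := HB.pack L (GRing.isLinear.Build _ _ _ _ L L_lin).
have cL : continuous LL.
  apply: (@bounded_linear_cont _ _ _ LL (\sum_j rnorm (l j))) => h.
  apply/rnorm_rV_le; first by rewrite mulr_ge0 ?rnorm_ge0 // sumr_ge0 // => j _; exact: rnorm_ge0.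
  move=> j; rewrite -[LL h]/(L h) /L mxE rnormM; apply: ler_pM; rewrite ?rnorm_ge0 ?rnorm_coord //.
  by rewrite (bigD1 j) //= lerDl sumr_ge0 // => i _; exact: rnorm_ge0.
have hL : has_diff g x LL.
  move=> e e0.
  have : exists2 r, 0 < r & forall h : 'rV[C]_n, rnorm h < r -> forall j,
      rnorm (g (x + h) 0 j - g x 0 j - l j * h 0 j) <= e * rnorm h.
    apply: (@forall_delta _ n (fun j h => rnorm (g (x + h) 0 j - g x 0 j - l j * h 0 j)
      <= e * rnorm h)) => j.
    have [r r0 hr] := dG j e e0; exists (Num.min d r); first by rewrite lt_min d0.
    move=> h; rewrite lt_min => /andP[/gG h1 h2].
    have := gG 0; rewrite rnorm0 addr0 => ->//; rewrite h1.
    have h3 := rnorm_coord h j; rewrite mxE.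
    by apply: le_trans (hr _ (le_lt_trans h3 h2)) _; rewrite ler_pM2l.
  move=> [r r0 hr]; exists r => // h /hr hh.
  apply/rnorm_rV_le; first by rewrite mulr_ge0 ?rnorm_ge0 // ltW.
  move=> j; have H := hh j; rewrite -[LL h]/(L h).
  by have -> : (g (x + h) - g x - L h) 0 j = g (x + h) 0 j - g x 0 j - l j * h 0 j by rewrite /L !mxE.
have [dd E] := has_diff_diff cL hL.
by split; [exact: dd|move=> y; exact: (congr1 (@^~ y) E)].
Qed.

(** The dual of the maximum norm is the [l^1] norm, so [T x = |x|] is the equality case of
    [|sum_j x_j t_j| <= |x| sum_j |t_j|] and forces every [x_j t_j] to be the nonnegative real
    [|x| |t_j|]. *)
Lemma support_coordinates n (x : 'rV[C]_n) (T : {scalar 'rV[C]_n}) :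
  support_functional x T -> exists r : 'I_n -> R,
  [/\ forall j, 0 <= r j, forall j, x 0 j * T (delta_mx 0 j) = (r j)%:C%C &
      \sum_j r j = rnorm x].
Proof.
move=> [T1 Tx]; pose t j := T (delta_mx 0 j).
have TE y : T y = \sum_j y 0 j * t j.
  rewrite {1}[y]row_sum_delta linear_sum; apply: eq_bigr => j _.
  by rewrite linearZ.
have tle : \sum_j rnorm (t j) <= 1.
  rewrite -T1.
  (* At the vector of conjugate phases [T] takes the value [sum_j |t_j|], which is therefore at most
     the dual norm; entries with [t_j = 0] are set to 0. *)
  pose y : 'rV[C]_n := \row_j (if t j == 0 then 0 else (t j)^*%C / (rnorm (t j))%:C%C).
  have Ty : T y = (\sum_j rnorm (t j))%:C%C.
    rewrite TE rmorph_sum; apply: eq_bigr => j _; rewrite mxE.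
    case: eqP => [->|/eqP tj]; first by rewrite mul0r rnorm0.
    rewrite mulrAC [_ * t j]mulrC mul_conj expr2 rmorphM /= mulfK //.
    by rewrite -(rmorph0 (real_complex R)) (inj_eq (@complexI R)) rnorm_eq0.
  have s0 : 0 <= \sum_j rnorm (t j) by rewrite sumr_ge0 // => j _; exact: rnorm_ge0.
  apply: ub_le_sup.
    exists (\sum_j rnorm (t j)) => _ [w w1 <-]; suff : rnorm (T w) <= \sum_j rnorm (t j) by [].
    rewrite TE; apply: le_trans (rnorm_sum _ _ _) _; apply: ler_sum => j _.
    rewrite rnormM ler_piMl ?rnorm_ge0 //; exact: le_trans (rnorm_coord w j) w1.
  exists y; last by suff : rnorm (T y) = \sum_j rnorm (t j) by []; rewrite Ty rnormRp.
  apply/rnorm_rV_le => // j; rewrite mxE; case: eqP => [_|/eqP tj]; first by rewrite rnorm0.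
  by rewrite rnormM rnorm_conj rnormV rnormRp ?rnorm_ge0 // divff // rnorm_eq0.
have le j : rnorm (x 0 j * t j) <= rnorm x * rnorm (t j).
  by rewrite rnormM ler_wpM2r ?rnorm_ge0 ?rnorm_coord.
have S : \sum_j Re (x 0 j * t j) = rnorm x.
  have := Tx; rewrite TE rnormE => /(congr1 (@complex.Re R)) /= <-.
  by rewrite (big_morph (@complex.Re R) (raddfD _) (raddf0 _)).
(* The deficits are nonnegative and their sum is at most 0, so each of them vanishes. *)
have Z : \sum_j (rnorm x * rnorm (t j) - Re (x 0 j * t j)) = 0.
  apply/eqP; rewrite eq_le; apply/andP; split.
    by rewrite big_split /= sumrN S -mulr_sumr subr_le0 ler_piMr ?rnorm_ge0.
  by rewrite sumr_ge0 // => j _; rewrite subr_ge0; exact: le_trans (Re_le_rnorm _) (le j).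
have E j : Re (x 0 j * t j) = rnorm x * rnorm (t j).
  apply/eqP; rewrite eq_sym -subr_eq0; apply/eqP.
  apply: (psumr_eq0P _ Z) => // i _; rewrite subr_ge0.
  exact: le_trans (Re_le_rnorm _) (le i).
have Rn j : Re (x 0 j * t j) = rnorm (x 0 j * t j).
  by apply/eqP; rewrite eq_le Re_le_rnorm E le.
exists (fun j => Re (x 0 j * t j)); split=> // j; first by rewrite Rn rnorm_ge0.
rewrite -/(t j); have := rnorm_sqr (x 0 j * t j); rewrite -Rn => /eqP.
rewrite -[X in X == _]addr0 (inj_eq (addrI _)) eq_sym sqrf_eq0 => /eqP.
by case: (_ * _) => u v /= ->.
Qed.

(** For this diagonal map the vector in the quasi-convexity condition has entries
    [x_j (1 + beta x_j / (1 - x_j))]. A support functional turns it into a sum, with nonnegative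
    weights [r_j] of total [|x|], of numbers of real part at least [1 - beta / 2], and [beta] is
    chosen to make this [alpha]. *)
Theorem sharp_map (alpha : R) n : 0 <= alpha -> alpha < 1 ->
  exists2 f : 'rV[C]_n -> 'rV[C]_n, quasi_convex_B alpha f &
  forall z, diffn 3 f 0 z =
    \row_j ((2 * (1 - alpha) * (1 + 2 * (1 - alpha)))%:C%C * z 0 j * z 0 j * z 0 j).
Proof.
move=> a0 a1; pose beta := 2 * (1 - alpha).
have b0 : 0 <= beta by rewrite mulr_ge0 // subr_ge0 ltW.
have [F [F1 [F2 [dF dF1 dF2 [F0 F10] hF]]]] := extremal_function beta.
pose f (x : 'rV[C]_n) : 'rV[C]_n := \row_j F (x 0 j).
have xj (x : 'rV[C]_n) j : rnorm x < 1 -> rnorm (x 0 j) < 1 := le_lt_trans (rnorm_coord x j).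
have D1 (x : 'rV[C]_n) : rnorm x < 1 ->
    differentiable f x /\ forall y, 'd f x y = \row_j (F1 (x 0 j) * y 0 j).
  move=> x1; apply: (@diag_diff n f (fun=> F) _ x 1) => // [h _ j|j]; first by rewrite mxE.
  exact: (dF _ (xj x j x1)).
have rad (x h : 'rV[C]_n) : rnorm h < 1 - rnorm x -> rnorm (x + h) < 1.
  by move=> hh; apply: le_lt_trans (rnormD _ _) _; rewrite addrC -ltrBrDr.
have D2 (x z : 'rV[C]_n) : rnorm x < 1 -> differentiable (fun x => 'd f x z) x /\
    forall y, 'd (fun x => 'd f x z) x y = \row_j (F2 (x 0 j) * z 0 j * y 0 j).
  move=> x1; apply: (@diag_diff n _ (fun j t => F1 t * z 0 j) _ x (1 - rnorm x)).
  - by rewrite subr_gt0.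
  - by move=> h /rad xh j; rewrite (D1 _ xh).2 mxE.
  - move=> j; have := cderM (dF1 _ (xj x j x1)) (cder_cst (z 0 j) (x 0 j)).
    by rewrite mulr0 addr0.
have n00 : rnorm (0 : 'rV[C]_n) < 1 by rewrite rnorm0.
have D3 (z : 'rV[C]_n) : diffn 3 f 0 z =
    \row_j ((beta * (1 + beta))%:C%C * z 0 j * z 0 j * z 0 j).
  have h1 (h : 'rV[C]_n) : rnorm h < 1 -> forall j,
      'd (fun x => 'd f x z) (0 + h) z 0 j = F2 ((0 + h) 0 j) * z 0 j * z 0 j.
    by rewrite add0r => h1 j; rewrite (D2 _ z h1).2 mxE.
  have h2 j : cder (fun t => F2 t * z 0 j * z 0 j) ((0 : 'rV[C]_n) 0 j)
      ((beta * (1 + beta))%:C%C * z 0 j * z 0 j).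
    rewrite mxE; have := cderM (cderM dF2 (cder_cst (z 0 j) 0)) (cder_cst (z 0 j) 0).
    by rewrite !mulr0 !addr0.
  exact: (@diag_diff n (fun x => 'd (fun x => 'd f x z) x z)
    (fun j t => F2 t * z 0 j * z 0 j) _ 0 1 ltr01 h1 h2).2 z.
have JE x : rnorm x < 1 -> 'J f x = diag_mx (\row_j F1 (x 0 j)).
  move=> x1; apply/matrixP => i j; rewrite /jacobian mxE (D1 x x1).2 !mxE eqxx /=.
  by rewrite eq_sym; case: eqP => [->|_]; rewrite ?mulr1 ?mulr0.
have JV x : rnorm x < 1 -> 'J f x *m diag_mx (\row_j (F1 (x 0 j))^-1) = 1%:M.
  move=> x1; rewrite JE // mulmx_diag; apply/matrixP => i j; rewrite !mxE.
  by rewrite divff //; exact: (hF _ (xj x _ x1)).1.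
have uJ x (x1 : rnorm x < 1) : 'J f x \in unitmx := (mulmx1_unit (JV x x1)).1.
exists f; last exact: D3.
split.
- by move=> x x1; exact: (D1 x x1).1.
- split; first by apply/rowP => j; rewrite !mxE.
  by rewrite JE //; apply/matrixP => i j; rewrite !mxE F10.
- by move=> x x1; exact: uJ.
move=> x T x1 x0 /support_coordinates[r [r0 rE rS]].
have -> : invmx ('J f x) = diag_mx (\row_j (F1 (x 0 j))^-1).
  by rewrite -[LHS]mulmx1 -(JV x x1) mulmxA mulVmx ?mul1mx // uJ.
have -> : diffn 2 f x x + diffn 1 f x x = \row_j (F2 (x 0 j) * x 0 j * x 0 j + F1 (x 0 j) * x 0 j).
  have -> : diffn 2 f x x = \row_j (F2 (x 0 j) * x 0 j * x 0 j) := (D2 x x x1).2 x.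
  have -> : diffn 1 f x x = \row_j (F1 (x 0 j) * x 0 j) := (D1 x x1).2 x.
  by apply/rowP => j; rewrite !mxE.
set w := _ *m _.
have wE j : w 0 j = x 0 j * (1 + beta%:C%C * (x 0 j / (1 - x 0 j))).
  rewrite /w mul_mx_diag !mxE; have [h1 h2] := hF _ (xj x j x1).
  have nz : 1 - x 0 j != 0.
    rewrite subr_eq0; apply/negP => /eqP E; have := xj x j x1.
    by rewrite -E rnorm1 ltxx.
  have -> : F2 (x 0 j) = beta%:C%C * F1 (x 0 j) / (1 - x 0 j).
    by apply: (mulfI nz); rewrite h2; field.
  by field; rewrite nz h1.
have -> : T w = \sum_j (r j)%:C%C * (1 + beta%:C%C * (x 0 j / (1 - x 0 j))).
  rewrite {1}[w]row_sum_delta linear_sum; apply: eq_bigr => j _.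
  by rewrite linearZ /= wE -rE mulrAC.
rewrite (big_morph (@complex.Re R) (raddfD _) (raddf0 _)) -rS mulr_sumr.
apply: ler_sum => j _.
have -> (a : R) (v : C) : Re (a%:C%C * v) = a * Re v by case: v => p q /=; ring.
rewrite mulrC; apply: ler_wpM2l => //.
have := Re_halfplane b0 (xj x j x1); have -> // : 1 - beta / 2 = alpha by rewrite /beta; field.
Qed.

End Extremal.

Theorem theorem3p1 (R : realType) (alpha : R)
    (alpha_ge0 : 0 <= alpha) (alpha_lt1 : alpha < 1) :
  [/\ (forall f : 'rV[R[i]]_2 -> 'rV[R[i]]_2, quasi_convex_B alpha f ->
        forall z : 'rV[R[i]]_2, polydisk z ->
        rnorm (diffn 3 f 0 z) / (3`!)%:R <=
          (1 - alpha) * (3 - 2 * alpha) / 3 * rnorm z ^+ 3),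
      (forall (n : nat) (f : 'rV[R[i]]_n -> 'rV[R[i]]_n), (3 <= n)%N ->
        quasi_convex_B alpha f ->
        forall z : 'rV[R[i]]_n, polydisk z ->
        rnorm (diffn 3 f 0 z) / (3`!)%:R <=
          (1 - alpha) *
          (3 / 2 * Num.sqrt 3 + 1 - 3 / 2 * Num.sqrt 3 * alpha) / 3
          * rnorm z ^+ 3) &
      (forall M : R,
        (forall f : 'rV[R[i]]_2 -> 'rV[R[i]]_2, quasi_convex_B alpha f ->
          forall z : 'rV[R[i]]_2, polydisk z ->
          rnorm (diffn 3 f 0 z) / (3`!)%:R <= M * rnorm z ^+ 3) ->
        (1 - alpha) * (3 - 2 * alpha) / 3 <= M)].
Proof.
have fact3 : (3`!)%:R = 6 :> R by [].
split=> [f qf z _|n f _ qf z _|M hM].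
- rewrite fact3 ler_pdivrMr //.
  apply: le_trans (third_order_bound alpha_lt1 qf (@polarization2 R) z) _.
  by rewrite le_eqVlt; apply/orP; left; apply/eqP; field.
- rewrite fact3 ler_pdivrMr //.
  apply: le_trans (third_order_bound alpha_lt1 qf (@polarization R n) z) _.
  by rewrite le_eqVlt; apply/orP; left; apply/eqP; field.
- have [f qf fE] := @sharp_map R alpha 2 alpha_ge0 alpha_lt1.
  (* With all coordinates equal to [|z|], each entry of [D^3f(0)(z^3)] is [F'''(0) |z|^3], so one
     coordinate already gives the constant; the value 1/2 keeps [z] in the polydisk. *)
  pose h : R := 2^-1; pose z : 'rV[R[i]]_2 := \row__ h%:C%C.
  have h0 : 0 <= h by rewrite invr_ge0.
  have nz : rnorm z <= h by apply/rnorm_rV_le => // j; rewrite mxE rnormRp.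
  have pz : polydisk z by apply: le_lt_trans nz _; rewrite invf_lt1 // ltr1n.
  have := hM f qf z pz; rewrite fE fact3 ler_pdivrMr // => le.
  have k0 : 0 <= 2 * (1 - alpha) * (1 + 2 * (1 - alpha)).
    have p : 0 <= 1 - alpha by rewrite subr_ge0 ltW.
    by rewrite mulr_ge0 // ?mulr_ge0 // addr_ge0 // mulr_ge0.
  have := le_trans (rnorm_coord _ 0) le.
  rewrite !mxE !rnormM !rnormRp // => le2.
  have nzE : rnorm z = h.
    apply/eqP; rewrite eq_le nz /=.
    by have := rnorm_coord z 0; rewrite mxE rnormRp.
  move: le2; rewrite nzE => le2.
  have h3 : 0 < h ^+ 3 by rewrite exprn_gt0 // invr_gt0.
  rewrite -(ler_pM2r h3) -(ler_pM2r (_ : 0 < 6 :> R)) //.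
  apply: le_trans le2; rewrite le_eqVlt; apply/orP; left; apply/eqP.
  by field.
Qed.
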